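(* Let $F=F(X)$ be an $\mathbb{N}$-valued random variable in $L^2(P)$ with mean $\mu$ and variance $\sigma^2$. Then $$d_{W}(F,\mathrm{Pn}(\theta))\le|\theta-\mu|+\left(1\wedge\frac{8}{3\sqrt{2e\,\theta}}\right)E|\theta-Z|+\left(\frac23\wedge\frac1\theta\right)E\left[\sum_{i=1}^{\infty}\big[2(\mathfrak{d}_iF)^2+\mathfrak{D}_iF\big]\,\big|E[\mathfrak{D}_iF|\mathcal{F}_i]\big|\right]$$ and the right-hand side is in turn bounded by $$|\theta-\mu|+\left(1\wedge\frac{8}{3\sqrt{2e\,\theta}}\right)\left(|\theta-\sigma^2|+\sqrt{\mathrm{Var}(Z)}\right)+\left(\frac23\wedge\frac1\theta\right)\left(2\mathcal{L}_3(F)+\mathcal{L}_2(F)\right),$$ where $Z:=\sum_{i=1}^{\infty}\mathfrak{D}_iF\,E[\mathfrak{D}_iF|\mathcal{F}_i]$.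
   Context: $\mathbb{N}=\{0,1,2,\dots\}$ and $a\wedge b=\min(a,b)$. $\mathrm{Pn}(\theta)$ is a Poisson random variable with parameter $\theta>0$. $d_W(F,\mathrm{Pn}(\theta)):=\sup_h|E[h(F)]-E[h(\mathrm{Pn}(\theta))]|$, the supremum over all $h:\mathbb{N}\to\mathbb{R}$ with $|h(x)-h(y)|\le|x-y|$. $X=(X_1,X_2,\dots)$ is a sequence of independent random variables (not necessarily identically distributed) on a probability space $(\Omega,\mathfrak{F},P)$ with values in a measurable space $\mathcal{X}$. $F=F(X)$ means that $F$ is a measurable function of the sequence $X$. $X'=(X_1',X_2',\dots)$ is an independent copy of $X$, and $T_iF=F(X_1,\dots,X_{i-1},X_i',X_{i+1},\dots)$ for $i\ge1$. $E_i$ and $E_i'$ denote the expectations with respect to $X_i$ and $X_i'$, respectively; in particular $E_i[F]=E[F|\sigma(X_k,k\neq i)]$. Difference operators: $\mathfrak{D}_iF=F-E_i[F]$ for $F\in L^1(P)$, and $\mathfrak{d}_iF=\big(\tfrac12E_i'|F-T_iF|^2\big)^{1/2}$ for $F\in L^2(P)$, $i\ge1$. $\mathcal{F}_i=\sigma(X_k,k\le i)$. Generalized Lyapunov ratio: $\mathcal{L}_r(F):=\sum_{i=1}^\infty E|\mathfrak{D}_iF|^r$, $r>0$. *)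

(* Defs.v *)
From HB Require Import structures.
From mathcomp Require Import all_boot all_order all_algebra.
From mathcomp Require Import all_classical all_reals all_analysis.

Set Implicit Arguments.
Unset Strict Implicit.
Unset Printing Implicit Defensive.

Import Order.TTheory GRing.Theory Num.Theory.
Import numFieldNormedType.Exports.

Local Open Scope classical_set_scope.
Local Open Scope ring_scope.

(* Sequences are indexed from 0: X 0, X 1, ... stand for X_1, X_2, ... *)

Definition cylinders (d : measure_display) (T : measurableType d) :
    set (set (nat -> T)) :=
  [set A | exists i : nat, exists2 B : set T,
     measurable B & A = (fun x : nat -> T => x i) @^-1` B].

(* nat -> T with the product sigma-algebra *)
Definition seq_space (d : measure_display) (T : measurableType d) :=
  g_sigma_algebraType (@cylinders d T).

Section functionals.
Context {R : realType} {d d' : measure_display} {Omega : measurableType d}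
  {T : measurableType d'} (P : probability Omega R).
Implicit Types (X : nat -> {RV P >-> T}) (f : seq_space T -> nat) (i : nat).

Definition sample_path X : Omega -> seq_space T := fun w i => X i w.

Definition mutually_independent X : Prop :=
  forall (s : seq nat) (B : nat -> set T), uniq s ->
    (forall i, measurable (B i)) ->
    P (\bigcap_(i in [set` s]) (X i @^-1` B i)) =
    (\prod_(i <- s) P (X i @^-1` B i))%E.

Definition independent_copy X X' : Prop :=
  (forall A : set (seq_space T), measurable A ->
     P (sample_path X' @^-1` A) = P (sample_path X @^-1` A)) /\
  (forall A B : set (seq_space T), measurable A -> measurable B ->
     P (sample_path X @^-1` A `&` sample_path X' @^-1` B) =
     (P (sample_path X @^-1` A) * P (sample_path X' @^-1` B))%E).

(* sigma(X_k, k in J) *)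
Definition sigma_of X (J : set nat) : set (set Omega) :=
  <<s \bigcup_(k in J) preimage_set_system setT (X k) measurable >>.

Definition is_cond_exp (G : set (set Omega)) (Y W : Omega -> R) : Prop :=
  [/\ W \in Lfun P 1%:E,
      forall B : set R, measurable B -> G (W @^-1` B) &
      forall A, G A -> (\int[P]_(w in A) (W w)%:E =
                        \int[P]_(w in A) (Y w)%:E)%E].

(* E[Y | G]: a version, for Y integrable and G a sub-sigma-algebra *)
Definition cond_exp (G : set (set Omega)) (Y : Omega -> R) : Omega -> R :=
  xget (cst 0) [set W | is_cond_exp G Y W].

Definition rv X f : Omega -> nat := f \o sample_path X.

Definition rvR X f : Omega -> R := fun w => (rv X f w)%:R.

(* T_i F *)
Definition replaced X X' f i : Omega -> R :=
  fun w => (f (fun k => if k == i then X' k w else X k w))%:R.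

(* E_i[F] *)
Definition E_at X f i : Omega -> R :=
  cond_exp (sigma_of X [set k | k != i]) (rvR X f).

(* E_i'[Y], for Y a functional of (X, X'): only X'_i is integrated out *)
Definition E'_at X X' i (Y : Omega -> R) : Omega -> R :=
  cond_exp <<s sigma_of X setT `|` sigma_of X' [set k | k != i] >> Y.

(* \mathfrak{D}_i F *)
Definition frakD X f i : Omega -> R := fun w => rvR X f w - E_at X f i w.

(* \mathfrak{d}_i F *)
Definition frakd X X' f i : Omega -> R := fun w =>
  Num.sqrt (2^-1 *
    E'_at X X' i (fun w => `|rvR X f w - replaced X X' f i w| ^+ 2) w).

(* E[\mathfrak{D}_i F | F_i], where F_i = sigma(X_k, k <= i) *)
Definition proj_frakD X f i : Omega -> R :=
  cond_exp (sigma_of X [set k | (k <= i)%N]) (frakD X f i).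

Definition lyapunov X f (r : R) : \bar R :=
  (\sum_(0 <= i <oo) \int[P]_w ((`|frakD X f i w| `^ r)%R)%:E)%E.

Definition is_L1_sum (u : nat -> Omega -> R) (Z : Omega -> R) : Prop :=
  Z \in Lfun P 1%:E /\
  ((fun n => \int[P]_w (`|\sum_(i < n) u i w - Z w|)%:E)%E @ \oo --> 0%E).

(* In [poisson_prob theta 0], the second argument is a dummy one. *)
Definition dW_poisson (F : Omega -> nat) (theta : R) : \bar R :=
  ereal_sup [set `|'E_P[fun w => h (F w)] -
                   \int[poisson_prob theta 0]_k (h k)%:E|%E |
    h in [set h : nat -> R | forall x y, `|h x - h y| <= `|x%:R - y%:R| ]].

End functionals.

(* Main.v *)
Require Import Defs.
From HB Require Import structures.
From mathcomp Require Import all_boot all_order all_algebra.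
From mathcomp Require Import all_classical all_reals all_analysis.
From mathcomp Require Import measurable_realfun.
From mathcomp Require Import ring lra.

Set Implicit Arguments.
Unset Strict Implicit.
Unset Printing Implicit Defensive.

Import Order.TTheory GRing.Theory Num.Theory.
Import numFieldNormedType.Exports.

Local Open Scope classical_set_scope.
Local Open Scope ring_scope.

(* Let Q be the law of the path X and, for a coordinate set J, let CE J be the
   conditional expectation given (X_k, k in J), obtained by integrating out the
   other coordinates of the path. With D_i = F - E_i F and V_i = E[D_i | F_i], the
   V_i are the martingale differences of F, so L^2 martingale convergence gives
   Cov(F, G) = sum_i E[G V_i] for square-integrable G, and as V_i is centred given
   (X_k, k <> i), E[G V_i] only depends on G - T_i G.

   For a 1-Lipschitz h let g solve theta g(k+1) - k g(k) = h(k) - E h(Pn(theta)),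
   and put G = g(F), H = g(F+1) - g(F). Then E h(F) - E h(Pn(theta)) equals
   (theta - mu) E G + E[H (theta - Z)] up to the sum over i of the Taylor errors
   E[(G - T_i G - H (F - T_i F)) V_i]. As F is integer valued, the i-th error is at
   most max |g''| / 2 times E[((F - T_i F)^2 + (F - T_i F)) |V_i|], where g'' is the
   second difference; the weight is nonnegative because n^2 + n >= 0 for integers n.

   Bounds on g: g(k+1) is a combination of a lower and an upper Poisson sum of h
   whose coefficients are convex in k, which yields |g| <= 1 and |g''| <= 2 / theta.
   The differences of g solve birth-death equations, so the maximum principle yields
   |g'| <= 1 and |g''| <= 4 / 3. Finally |g'| is largest for h = - |. - (k + 1)|, for
   which it is a resolvent of the immigration-death semigroup, whose transition
   probabilities at time t are at most (2 e theta (1 - e^-t))^(-1/2). *)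

(** * The Stein equation of the Poisson law *)

(** Each minimum in the constants mixes two methods: the maximum principle gives the bounds free of
    [theta], while the decay in [theta] comes from the explicit solution for the second difference
    and from smoothing by the semigroup for the first. In 8 / 3, the factor 2 is the size of the
    second difference of the extremal function and 4 / 3 is the integral of 2 (1 - r^2) over [0, 1];
    the variable r with exp (- t) = 1 - r^2 makes the integrand bounded, although the bound on the
    transition probabilities is singular at t = 0. The conditional expectations of the statement are
    arbitrary versions chosen on [Omega], known only up to negligible events. All computations
    therefore take place on path space, where conditioning is an explicit integral and resampling a
    coordinate is a measure-preserving exchange between two independent paths. Integrability is the
    other constraint: [Z] is only an L1 limit, so it is tested only against bounded functions such
    as H, and the remainder series may be infinite, so it is kept in the extended reals. *)

Section discrete_maximum_principle.
Context {R : realType}.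
Variables (theta c C : R).
Hypotheses (theta_gt0 : 0 < theta) (c_gt0 : 0 < c).

(* Perturbing [w] to [w k - eps * k] makes the supremum attained. *)
Lemma maximum_principle (w : nat -> R) (M : R) :
  (forall k, `|w k| <= M) ->
  (forall k, - C <= theta * (w k.+1 - w k) - k%:R * (w k - w k.-1) - c * w k) ->
  forall k, w k <= C / c.
Proof.
move=> wM wC k.
suff key (eps : R) : 0 < eps -> w k <= (C + theta * eps) / c + eps * k%:R.
  apply/ler_addgt0Pr => e e0.
  have D0 : 0 < theta / c + k%:R + 1.
    by rewrite ltr_wpDl// addr_ge0// divr_ge0// ltW.
  apply: (le_trans (key _ (divr_gt0 e0 D0))).
  rewrite -subr_ge0; set t := e / _; have t0 : 0 <= t by rewrite divr_ge0// ltW.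
  have -> : e = t * (theta / c + k%:R + 1) by rewrite divfK// gt_eqF.
  suff -> : C / c + t * (theta / c + k%:R + 1) -
      ((C + theta * t) / c + t * k%:R) = t by [].
  by field; rewrite gt_eqF.
move=> eps0.
have M0 : 0 <= M by apply: le_trans (wM 0%N).
(* Beyond [N] the penalty [eps * m] exceeds [2 * M], so the maximum over [0, ..., N] is a global
   one. *)
pose N := Num.truncn (2 * M / eps).
have NP m : (N < m)%N -> 2 * M < eps * m%:R.
  move=> Nm; rewrite [ltRHS]mulrC -ltr_pdivrMr//.
  have /andP[_ h] := truncn_itv (divr_ge0 (mulr_ge0 (ler0n R 2) M0) (ltW eps0)).
  by apply: (lt_le_trans h); rewrite ler_nat.
pose F (i : 'I_N.+1) := w i - eps * i%:R.
have [i _ iP] := @Order.TotalTheory.arg_maxP _ _ 'I_N.+1 ord0 xpredT F isT.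
have {}iP m : w m - eps * m%:R <= F i.
  have [mN|Nm] := leqP m N.
    by have := iP (Ordinal (mN : (m < N.+1)%N)) isT.
  apply: le_trans (iP ord0 isT); rewrite /F /= mulr0 subr0.
  have := NP _ Nm; have := wM m; have := wM 0%N; rewrite !ler_norml => /andP[? ?] /andP[? ?]; lra.
rewrite /F in iP; move: (nat_of_ord i) iP => {F}{}i iP.
have h1 : w i.+1 - w i <= eps.
  by have := iP i.+1; rewrite -natr1 mulrDr mulr1; set a := eps * _; lra.
have h2 : 0 <= i%:R * (w i - w i.-1).
  case: i iP {h1} => [|j] iP; first by rewrite mul0r.
  apply: mulr_ge0 => //=; have := iP j.
  by rewrite -natr1 mulrDr mulr1; set a := eps * _; lra.
have h3 : w i <= (C + theta * eps) / c.
  rewrite ler_pdivlMr//; have := wC i.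
  have := ler_wpM2l (ltW theta_gt0) h1; lra.
have := iP k.
have : 0 <= eps * i%:R by rewrite mulr_ge0// ltW.
lra.
Qed.

Lemma maximum_principle_norm (w : nat -> R) (M : R) :
  (forall k, `|w k| <= M) ->
  (forall k, `|theta * (w k.+1 - w k) - k%:R * (w k - w k.-1) - c * w k| <= C) ->
  forall k, `|w k| <= C / c.
Proof.
move=> wM wC k; rewrite ler_norml; apply/andP; split.
  rewrite lerNl; apply: (@maximum_principle (fun k => - w k) M) => [j|j].
    by rewrite normrN.
  have := wC j; rewrite ler_norml => /andP[_]; lra.
apply: (@maximum_principle w M) => // j.
by have := wC j; rewrite ler_norml => /andP[].
Qed.

End discrete_maximum_principle.

Section backward_positivity.
Context {R : realType}.
Variable theta : R.
Hypothesis theta_gt0 : 0 < theta.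

(* Beyond [2 * theta] the recursion at least halves a negative lower bound. *)
Lemma backward_recursion_ge0 (x : nat -> R) (M : R) :
  (forall k, - M <= x k) ->
  (forall k, theta * x k.+1 <= k.+1%:R * x k) ->
  forall k, 0 <= x k.
Proof.
move=> xM xr.
pose K := (Num.truncn (2 * theta)).+1.
have KP k : (K <= k)%N -> 2 * theta <= k.+1%:R.
  move=> Kk; have /andP[_ h] := truncn_itv (mulr_ge0 (ler0n R 2) (ltW theta_gt0)).
  by apply: ltW; apply: (lt_le_trans h); rewrite ler_nat leqW.
have M0 : 0 <= Num.max M 0 by rewrite le_max lexx orbT.
have half n k : (K <= k)%N -> - Num.max M 0 / 2 ^+ n <= x k.
  elim: n k => [|n IH] k Kk.
    rewrite expr0 divr1; apply: le_trans (xM k).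
    by rewrite lerN2 le_max lexx.
  have h := IH _ (leqW Kk).
  have k0 : 0 < k.+1%:R :> R by [].
  rewrite -(ler_pM2l k0); apply: le_trans (xr k).
  apply: (@le_trans _ _ (theta * (- Num.max M 0 / 2 ^+ n))); last first.
    by rewrite ler_wpM2l// ltW.
  have := KP _ Kk; set m := Num.max M 0 in M0 *.
  rewrite exprS invfM.
  have : 0 <= (2 ^+ n)^-1 :> R by rewrite invr_ge0 exprn_ge0.
  set t := (2 ^+ n)^-1 => t0 h2.
  have : 0 <= m * t * (k.+1%:R - 2 * theta) by rewrite !mulr_ge0// subr_ge0.
  lra.
have tail k : (K <= k)%N -> 0 <= x k.
  move=> Kk; rewrite leNgt; apply/negP => xk0.
  set m := Num.max M 0 in M0 half.
  pose n := (Num.truncn (m / - x k)).+1.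
  have hn := half n k Kk.
  have xk0' : 0 < - x k by lra.
  have /andP[_ h] := truncn_itv (divr_ge0 M0 (ltW xk0')).
  have h2 : n%:R <= 2 ^+ n :> R by rewrite -natrX ler_nat ltnW// ltn_expl.
  have := lt_le_trans h h2; rewrite ltr_pdivrMr// => h3.
  move: hn; rewrite mulNr lerNl ler_pdivlMr ?exprn_gt0//; lra.
(* The recursion carries nonnegativity from [n + 1] down to [n], which settles the finitely many
   indices below [K]. *)
have down n : (forall k, (n <= k)%N -> 0 <= x k) -> forall k, 0 <= x k.
  elim: n => [|n IH] hn; first by move=> k; exact: hn.
  apply: IH => k; rewrite leq_eqVlt => /predU1P[<-|]; last exact: hn.
  have h := hn n.+1 (leqnn _).
  have := le_trans (mulr_ge0 (ltW theta_gt0) h) (xr n).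
  by rewrite pmulr_rge0.
exact: down tail.
Qed.

End backward_positivity.

(** * Poisson expectations of functions of linear growth *)

Section poisson_functional.
Context {R : realType}.
Implicit Types (phi psi : nat -> R) (theta : R).

Definition linear_growth phi : Prop :=
  exists C : R, forall k, `|phi k| <= C * k.+1%:R.

Lemma linear_growthP phi (A B : R) :
  (forall k, `|phi k| <= A + B * k%:R) -> linear_growth phi.
Proof.
move=> h; exists (`|A| + `|B|) => k; apply: (le_trans (h k)).
rewrite -natr1 mulrDr mulr1 addrC lerD//.
  rewrite mulrDl -[leLHS]add0r lerD ?mulr_ge0//.
  by rewrite ler_wpM2r// ler_norm.
by rewrite -[leLHS]addr0 lerD// ler_norm.
Qed.

Lemma linear_growth_comb (a : R) phi psi :
  linear_growth phi -> linear_growth psi ->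
  linear_growth (fun k => a * phi k + psi k).
Proof.
move=> [A hA] [B hB]; exists (`|a| * A + B) => k.
apply: (le_trans (ler_normD _ _)); rewrite normrM mulrDl lerD// -mulrA.
by rewrite ler_wpM2l.
Qed.

Lemma linear_growth_cst (c : R) : linear_growth (fun=> c).
Proof.
by apply: (@linear_growthP _ `|c| 0) => k; rewrite mul0r addr0.
Qed.

Lemma linear_growth_id : linear_growth (fun k => k%:R).
Proof. by apply: (@linear_growthP _ 0 1) => k; rewrite add0r mul1r normr_nat. Qed.

Lemma linear_growth_point j : linear_growth (fun k => (k == j)%:R).
Proof.
apply: (@linear_growthP _ 1 0) => k; rewrite mul0r addr0 normr_nat.
by case: (k == j).
Qed.

Lemma linear_growth_cut phi n :
  linear_growth phi -> linear_growth (fun j => if (j < n)%N then 0 else phi j).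
Proof.
move=> [A hA]; exists A => k; case: ifP => // _; rewrite normr0.
exact: le_trans (hA k).
Qed.

Definition lipschitz1 (h : nat -> R) : Prop :=
  forall x y, `|h x - h y| <= `|x%:R - y%:R|.

Lemma lipschitz1_growth h : lipschitz1 h -> linear_growth h.
Proof.
move=> hh; apply: (@linear_growthP _ `|h 0%N| 1) => k; rewrite mul1r.
have -> : h k = h 0%N + (h k - h 0%N) by lra.
apply: (le_trans (ler_normD _ _)); rewrite lerD//.
by apply: (le_trans (hh _ _)); rewrite subr0 normr_nat.
Qed.

(** The Stein equation is analysed from these five properties alone. An abstract [E] on functions of
    linear growth, a class that contains the Lipschitz functions, keeps integrability questions out
    of the algebra. *)
Definition poisson_functional theta (E : (nat -> R) -> R) : Prop :=
  [/\ forall a phi psi, linear_growth phi -> linear_growth psi ->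
        E (fun k => a * phi k + psi k) = a * E phi + E psi,
      forall phi, linear_growth phi -> (forall k, 0 <= phi k) -> 0 <= E phi,
      forall j, E (fun k => (k == j)%:R) = poisson_pmf theta j,
      E (fun=> 1) = 1 &
      E (fun k => k%:R) = theta].

End poisson_functional.

(** * Explicit solution of the Stein equation and its differences *)

Section poisson_stein.
Context {R : realType} (theta : R) (E : (nat -> R) -> R).
Hypotheses (theta_gt0 : 0 < theta) (poissonE : poisson_functional theta E).
Implicit Types (phi psi h : nat -> R).

Let p := poisson_pmf theta.
Let E_lin := let: And5 h _ _ _ _ := poissonE in h.
Let E_ge0 := let: And5 _ h _ _ _ := poissonE in h.
Let E_point := let: And5 _ _ h _ _ := poissonE in h.
Let E_1 := let: And5 _ _ _ h _ := poissonE in h.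
Let E_id := let: And5 _ _ _ _ h := poissonE in h.

Let p_gt0 k : 0 < p k.
Proof.
rewrite /p /poisson_pmf theta_gt0 !mulr_gt0 ?exprn_gt0 ?expR_gt0//.
Qed.

Let pS k : p k.+1 = theta * p k / k.+1%:R.
Proof.
rewrite /p /poisson_pmf theta_gt0 factS natrM exprS; field.
by rewrite nat1r !pnatr_eq0 -!lt0n fact_gt0.
Qed.

Definition poisson_low phi n : R := \sum_(j < n) phi j * p j.
Definition poisson_tail phi n : R := E phi - poisson_low phi n.
Definition poisson_cum k : R := \sum_(j < k.+1) p j.
(** In [stein_sol_split], [coef_b k] is the weight of the Poisson sum over [j <= k] and [coef_a k]
    that of the sum over [j > k]. Their monotonicity and convexity in [k] control the signs in the
    differences of the solution. *)
Definition coef_a k : R := poisson_cum k / (theta * p k).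
Definition coef_b k : R := (1 - poisson_cum k) / (theta * p k).

Local Notation low := poisson_low.
Local Notation tail := poisson_tail.
Local Notation cum := poisson_cum.
Local Notation a := coef_a.
Local Notation b := coef_b.

Lemma functionalB phi (c : R) :
  linear_growth phi -> E (fun k => phi k - c) = E phi - c.
Proof.
move=> hphi.
have := E_lin (- c) (linear_growth_cst 1) hphi.
rewrite E_1 mulr1 addrC => <-; congr E; apply/funext => k /=; lra.
Qed.

(** The tail is defined by subtraction because [E] is abstract; as [E] of a truncated function it
    becomes accessible to the positivity of [E]. *)
Lemma poisson_tail_cut phi n : linear_growth phi ->
  tail phi n = E (fun j => if (j < n)%N then 0 else phi j).
Proof.
move=> hphi; elim: n => [|n IH].
  by rewrite /tail /low big_ord0 subr0; congr E; apply/funext.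
have := E_lin (- phi n) (linear_growth_point n) (linear_growth_cut n hphi).
rewrite -IH E_point -/p => h.
rewrite /tail /low big_ord_recr /= opprD addrA -/(low phi n) -/(tail phi n).
rewrite [LHS]addrC -mulNr -h; congr E; apply/funext => j /=.
rewrite ltnS; case: (ltngtP j n) => [||->] /=.
- by rewrite mulr0 addr0.
- by rewrite mulr0 add0r.
- by rewrite mulr1 addNr.
Qed.

Lemma poisson_tail_le phi psi n : linear_growth phi -> linear_growth psi ->
  (forall j, (n <= j)%N -> `|phi j| <= psi j) -> `|tail phi n| <= tail psi n.
Proof.
move=> hphi hpsi le.
have gphi := linear_growth_cut n hphi; have gpsi := linear_growth_cut n hpsi.
have pos c : (forall j, (n <= j)%N -> 0 <= c * phi j + psi j) ->
    0 <= c * tail phi n + tail psi n.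
  move=> h; rewrite !poisson_tail_cut// -E_lin//.
  apply: E_ge0 => [|k]; first exact: linear_growth_comb.
  by case: ltnP => [_|/h//]; rewrite mulr0 addr0.
have h1 : 0 <= 1 * tail phi n + tail psi n.
  by apply: pos => j /le; rewrite ler_norml => /andP[]; lra.
have h2 : 0 <= -1 * tail phi n + tail psi n.
  by apply: pos => j /le; rewrite ler_norml => /andP[]; lra.
rewrite ler_norml; apply/andP; split; lra.
Qed.

Lemma poisson_low_le phi psi n :
  (forall j, (j < n)%N -> `|phi j| <= psi j) -> `|low phi n| <= low psi n.
Proof.
move=> le; apply: (le_trans (ler_norm_sum _ _ _)); apply: ler_sum => j _.
by rewrite normrM (ger0_norm (ltW (p_gt0 _))) ler_wpM2r ?le// ltW.
Qed.

Lemma poisson_lowS phi n : low phi n.+1 = low phi n + phi n * p n.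
Proof. by rewrite /low big_ord_recr. Qed.

Lemma poisson_cumS k : cum k.+1 = cum k + p k.+1.
Proof. by rewrite /cum big_ord_recr. Qed.

(** Since [j * p j = theta * p (j - 1)], weighting by [j] shifts the cumulative sum by one index.
    This yields closed forms for the affine moments with which Lipschitz functions are compared. *)
Lemma poisson_low_id k : low (fun j => j%:R) k.+1 = theta * (cum k - p k).
Proof.
rewrite /low /cum big_ord_recl mul0r add0r [in RHS]big_ord_recr /= addrK mulr_sumr.
by apply: eq_bigr => j _; rewrite pS mulrCA mulfV ?mulr1// pnatr_eq0.
Qed.

Lemma poisson_low_affine k (c : R) :
  low (fun j => c - j%:R) k.+1 = (c - theta) * cum k + theta * p k.
Proof.
have -> : low (fun j => c - j%:R) k.+1 = c * cum k - low (fun j => j%:R) k.+1.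
  rewrite /low /cum mulr_sumr -sumrB; apply: eq_bigr => j _; ring.
rewrite poisson_low_id; ring.
Qed.

Lemma poisson_tail_affine k (c : R) :
  tail (fun j => j%:R - c) k.+1 = (theta - c) * (1 - cum k) + theta * p k.
Proof.
rewrite /tail functionalB; last exact: linear_growth_id.
rewrite E_id.
have -> : low (fun j => j%:R - c) k.+1 = low (fun j => j%:R) k.+1 - c * cum k.
  rewrite /low /cum mulr_sumr -sumrB; apply: eq_bigr => j _; ring.
rewrite poisson_low_id; ring.
Qed.

Lemma poisson_cum_ge0 k : 0 <= cum k.
Proof. by apply: sumr_ge0 => j _; exact: ltW. Qed.

Lemma poisson_cum_le1 k : cum k <= 1.
Proof.
have := @poisson_tail_le (fun=> 0) (fun=> 1) k.+1 (linear_growth_cst 0)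
  (linear_growth_cst 1).
rewrite /tail E_1 => h; rewrite -subr_ge0.
have -> : cum k = low (fun=> 1) k.+1.
  by apply: eq_bigr => j _; rewrite mul1r.
by apply: le_trans (h _) => // j _; rewrite normr0.
Qed.

Lemma coef_a_ge0 k : 0 <= a k.
Proof. by rewrite divr_ge0 ?poisson_cum_ge0// mulr_ge0// ltW. Qed.

Lemma coef_b_ge0 k : 0 <= b k.
Proof. by rewrite divr_ge0 ?subr_ge0 ?poisson_cum_le1// mulr_ge0// ltW. Qed.

Lemma coef_aS k : theta * a k.+1 = 1 + k.+1%:R * a k.
Proof.
rewrite /a poisson_cumS !pS; field.
by rewrite nat1r !gt_eqF.
Qed.

Lemma coef_bS k : theta * b k.+1 = k.+1%:R * b k - 1.
Proof.
rewrite /b poisson_cumS !pS; field.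
by rewrite nat1r !gt_eqF.
Qed.

Lemma coef_a0 : theta * a 0 = 1.
Proof.
rewrite /a /cum big_ord1; field.
by rewrite !gt_eqF.
Qed.

Lemma coef_a_increasing k : a k <= a k.+1.
Proof.
elim: k => [|k IH]; rewrite -(ler_pM2l theta_gt0).
  by rewrite coef_aS coef_a0 lerDl mulr_ge0// coef_a_ge0.
rewrite !coef_aS lerD2l; apply: ler_pM => //; first exact: coef_a_ge0.
by rewrite ler_nat.
Qed.

(** By the recursion of [coef_a], [theta] times the second difference at [k + 1] is [k + 1] times
    the one at [k] plus twice a nonnegative first difference, so forward induction works. *)
Lemma coef_a_convex k : 0 <= a k.+2 - 2 * a k.+1 + a k.
Proof.
elim: k => [|k IH].
  have h0 := coef_a0; have h1 := coef_aS 0; have h2 := coef_aS 1.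
  have i0 := coef_a_increasing 0.
  rewrite -(pmulr_rge0 _ theta_gt0); have := coef_a_ge0 1; lra.
have h1 := coef_aS k; have h2 := coef_aS k.+1; have h3 := coef_aS k.+2.
have i1 := coef_a_increasing k.+1.
rewrite -(pmulr_rge0 _ theta_gt0).
have -> : theta * (a k.+3 - 2 * a k.+2 + a k.+1) =
  k.+1%:R * (a k.+2 - 2 * a k.+1 + a k) + 2 * (a k.+2 - a k.+1).
  transitivity (theta * a k.+3 - 2 * (theta * a k.+2) + theta * a k.+1).
    by ring.
  by rewrite h1 h2 h3; ring.
by rewrite addr_ge0// mulr_ge0// subr_ge0.
Qed.

(* The solution for the identity function is the constant [- 1]. *)
Lemma coef_ab_moments k (c : R) :
  ((c - theta) * cum k + theta * p k) * b k +
  ((theta - c) * (1 - cum k) + theta * p k) * a k = 1.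
Proof. by rewrite /a /b; field; rewrite !gt_eqF. Qed.

(** In the moment identity at index [k + 1] centred at [k + 1], both terms are nonnegative and the
    lower moment is at least [p 0], whence the bound [(p 0)^-1]. At index 0 the lower moment
    vanishes, so [b 0] is put into the maximum. Boundedness is what the backward recursion starts
    from. *)
Lemma coef_b_bounded : exists M, forall k, b k <= M.
Proof.
exists (Num.max (b 0) (p 0)^-1) => -[|k]; rewrite le_max ?lexx//.
apply/orP; right.
have := coef_ab_moments k.+1 k.+1%:R.
rewrite -poisson_low_affine -poisson_tail_affine.
set L := low _ _; set T := tail _ _ => LT.
have T0 : 0 <= T.
  have := @poisson_tail_le (fun=> 0) (fun j => j%:R - k.+1%:R) k.+2.
  move=> h; apply: le_trans (h _ _ _) => //.
  - exact: linear_growth_cst.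
  - apply: (@linear_growthP _ _ k.+1%:R 1) => j; rewrite mul1r.
    by rewrite (le_trans (ler_normB _ _))// !normr_nat addrC.
  - by move=> j /ltnW kj; rewrite normr0 subr_ge0 ler_nat.
have pL : p 0 <= L.
  rewrite /L /low big_ord_recl subr0 -[leLHS]addr0 lerD//.
    by rewrite ler_peMl ?(ltW (p_gt0 _))// ler1n.
  apply: sumr_ge0 => j _; apply: mulr_ge0; last exact: ltW.
  by rewrite subr_ge0 ler_nat lift0 ltn_ord.
have b0 := coef_b_ge0 k.+1; have a0 := coef_a_ge0 k.+1.
rewrite -[leRHS]mul1r ler_pdivlMr// -LT mulrC.
rewrite -[leLHS]addr0; apply: lerD; first exact: ler_wpM2r.
exact: mulr_ge0.
Qed.

(** The recursion of [coef_b] subtracts 1, so forward induction gives no sign. The decrements x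
    satisfy [theta * x (k + 1) = (k + 1) * x k - b (k + 1)], and dropping the last term leaves the
    hypothesis of [backward_recursion_ge0]. Convexity follows in the same way, with a first
    difference as the dropped term. *)
Lemma coef_b_decreasing k : b k.+1 <= b k.
Proof.
have [M bM] := coef_b_bounded.
rewrite -subr_ge0.
apply: (@backward_recursion_ge0 _ theta theta_gt0 (fun k => b k - b k.+1) M) => j.
  by have := bM j.+1; have := coef_b_ge0 j; lra.
have h1 := coef_bS j; have h2 := coef_bS j.+1.
rewrite mulrBr h1 h2 -(natr1 j.+1); have := coef_b_ge0 j.+1; lra.
Qed.

Lemma coef_b_convex k : 0 <= b k.+2 - 2 * b k.+1 + b k.
Proof.
have [M bM] := coef_b_bounded.
apply: (@backward_recursion_ge0 _ theta theta_gt0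
  (fun k => b k.+2 - 2 * b k.+1 + b k) (2 * M)) => j.
  by have := bM j.+1; have := coef_b_ge0 j; have := coef_b_ge0 j.+2; lra.
have h1 := coef_bS j; have h2 := coef_bS j.+1; have h3 := coef_bS j.+2.
rewrite mulrDr mulrBr (mulrCA theta 2) h1 h2 h3.
rewrite -(natr1 j.+2) -(natr1 j.+1); have := coef_b_decreasing j.+1; lra.
Qed.

(** The index is shifted by one: [stein_sol phi k] is the value at [k + 1] of the solution g. The
    value at 0, which the equation does not determine, is chosen in [poisson_stein_solution]. *)
Definition stein_sol phi k : R :=
  (low phi k.+1 - E phi * cum k) / (theta * p k).

Lemma stein_sol_split phi k :
  stein_sol phi k = low phi k.+1 * b k - tail phi k.+1 * a k.
Proof. by rewrite /stein_sol /tail /a /b; field; rewrite !gt_eqF. Qed.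

Lemma stein_sol_shift phi (c : R) k : linear_growth phi ->
  stein_sol (fun j => phi j - c) k = stein_sol phi k.
Proof.
move=> hphi; rewrite /stein_sol functionalB//; congr (_ / _).
have -> : low (fun j => phi j - c) k.+1 = low phi k.+1 - c * cum k.
  by rewrite /low /cum mulr_sumr -sumrB; apply: eq_bigr => j _; ring.
by ring.
Qed.

Lemma stein_sol_comb (c : R) phi psi k : linear_growth phi -> linear_growth psi ->
  stein_sol (fun j => c * phi j + psi j) k = c * stein_sol phi k + stein_sol psi k.
Proof.
move=> hphi hpsi; rewrite /stein_sol E_lin//.
have -> : low (fun j => c * phi j + psi j) k.+1 = c * low phi k.+1 + low psi k.+1.
  by rewrite /low mulr_sumr -big_split; apply: eq_bigr => j _ /=; ring.
by rewrite mulrA -mulrDl; congr (_ / _); ring.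
Qed.

Lemma stein_sol_id k : stein_sol (fun j => j%:R) k = -1.
Proof.
by rewrite /stein_sol poisson_low_id E_id; field; rewrite !gt_eqF.
Qed.

Lemma stein_equation h k :
  theta * stein_sol h k - k%:R * stein_sol h k.-1 = h k - E h.
Proof.
rewrite /stein_sol; case: k => [|k] /=.
  by rewrite mul0r subr0 /cum /low !big_ord1; field; rewrite !gt_eqF.
rewrite (poisson_lowS _ k.+1) poisson_cumS !pS; field.
by rewrite nat1r !gt_eqF.
Qed.

Definition birth_death (c : R) (r w : nat -> R) := forall k,
  theta * (w k.+1 - w k) - k%:R * (w k - w k.-1) - c * w k = r k.

(** The generator L of the immigration-death process, with immigration rate [theta] and death rate 1
    per individual, satisfies DL = (L - 1)D for the difference operator D. Differencing thus raises
    the killing rate [c] by one. *)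
Lemma birth_death_diff c r w : birth_death c r w ->
  birth_death (c + 1) (fun k => r k.+1 - r k) (fun k => w k.+1 - w k).
Proof.
move=> h [|k]; rewrite -!h /=.
  by ring.
by rewrite -(natr1 k.+1) /=; ring.
Qed.

Lemma stein_sol_birth_death h :
  birth_death 1 (fun k => h k.+1 - h k) (stein_sol h).
Proof.
move=> k; have := stein_equation h k; have := stein_equation h k.+1 => /=.
rewrite -(natr1 k); lra.
Qed.

(** After centring [h] at [h k], both Poisson sums are dominated by the affine moments about [k],
    whose weighted contributions add up to 1 by [coef_ab_moments]. *)
Lemma stein_sol_le1 h k : lipschitz1 h -> `|stein_sol h k| <= 1.
Proof.
move=> hh; have gh := lipschitz1_growth hh.
rewrite -(stein_sol_shift (h k))// stein_sol_split.
apply: (le_trans (ler_normB _ _)).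
rewrite (normrM (low _ _)) (normrM (tail _ _)).
rewrite (ger0_norm (coef_a_ge0 _)) (ger0_norm (coef_b_ge0 _)).
rewrite -(coef_ab_moments k k%:R) -poisson_low_affine -poisson_tail_affine.
apply: lerD; apply: ler_wpM2r; rewrite ?coef_a_ge0 ?coef_b_ge0//.
  apply: poisson_low_le => j; rewrite ltnS => jk.
  by rewrite (le_trans (hh _ _))// distrC ger0_norm// subr_ge0 ler_nat.
apply: poisson_tail_le => [||j kj].
- have := linear_growth_comb 1 gh (linear_growth_cst (- h k)).
  by congr linear_growth; apply/funext => j; rewrite mul1r.
- have := linear_growth_comb 1 linear_growth_id (linear_growth_cst (- k%:R : R)).
  by congr linear_growth; apply/funext => j; rewrite mul1r.
- by rewrite (le_trans (hh _ _))// ger0_norm// subr_ge0 ler_nat ltnW.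
Qed.

(** As [phi] vanishes at [k + 1], its lower sums and tails at [k + 1] and [k + 2] coincide, so only
    the coefficients are differenced. A Lipschitz function is brought to this case by subtracting
    its value at [k + 1]. *)
Lemma stein_sol_diff phi k : phi k.+1 = 0 ->
  stein_sol phi k.+1 - stein_sol phi k =
  - (low phi k.+2 * (b k - b k.+1)) - tail phi k.+2 * (a k.+1 - a k).
Proof.
move=> h; rewrite !stein_sol_split /tail !(poisson_lowS _ k.+1) h mul0r addr0.
by ring.
Qed.

Definition stein_bound k : R :=
  low (fun j => k.+1%:R - j%:R) k.+2 * (b k - b k.+1) +
  tail (fun j => j%:R - k.+1%:R) k.+2 * (a k.+1 - a k).

Lemma linear_growthB phi (c : R) : linear_growth phi ->
  linear_growth (fun j => phi j - c).
Proof.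
move=> hphi; have := linear_growth_comb 1 hphi (linear_growth_cst (- c)).
by congr linear_growth; apply/funext => j; rewrite mul1r.
Qed.

Lemma stein_sol_diff_le h k : lipschitz1 h ->
  `|stein_sol h k.+1 - stein_sol h k| <= stein_bound k.
Proof.
move=> hh; have gh := lipschitz1_growth hh.
rewrite -!(stein_sol_shift (h k.+1) _ gh) stein_sol_diff ?subrr//.
rewrite -opprD normrN; apply: (le_trans (ler_normD _ _)).
rewrite (normrM (low _ _)) (normrM (tail _ _)).
have a0 : 0 <= a k.+1 - a k by rewrite subr_ge0 coef_a_increasing.
have b0 : 0 <= b k - b k.+1 by rewrite subr_ge0 coef_b_decreasing.
rewrite (ger0_norm a0) (ger0_norm b0).
apply: lerD; apply: ler_wpM2r => //.
  apply: poisson_low_le => j; rewrite ltnS => jk.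
  by rewrite (le_trans (hh _ _))// distrC ger0_norm// subr_ge0 ler_nat.
apply: poisson_tail_le => [||j kj].
- exact: linear_growthB.
- exact/linear_growthB/linear_growth_id.
- by rewrite (le_trans (hh _ _))// ger0_norm// subr_ge0 ler_nat ltnW.
Qed.

Definition stein_extremal k : nat -> R := fun j => - `|j%:R - k.+1%:R|.

Lemma stein_extremal_lipschitz k : lipschitz1 (stein_extremal k).
Proof.
move=> x y; rewrite /stein_extremal opprK addrC -/(_ - _).
apply: le_trans (ler_dist_dist _ _) _.
by rewrite distrC opprB addrA subrK.
Qed.

(** The extremal function turns both Lipschitz estimates of [stein_sol_diff_le] into equalities of
    the same sign. So [stein_bound k] is a value of a function that solves a birth-death
    equation. *)
Lemma stein_sol_diff_extremal k :
  stein_sol (stein_extremal k) k.+1 - stein_sol (stein_extremal k) k =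
  stein_bound k.
Proof.
have ge := lipschitz1_growth (stein_extremal_lipschitz k).
rewrite stein_sol_diff; last by rewrite /stein_extremal subrr normr0 oppr0.
rewrite /stein_bound -!mulNr; congr (_ * _ + _ * _).
  rewrite /low -sumrN; apply: eq_bigr => j _; rewrite /stein_extremal -mulNr opprK.
  by rewrite distrC ger0_norm// subr_ge0 ler_nat -ltnS.
rewrite !poisson_tail_cut//; last exact/linear_growthB/linear_growth_id.
have := E_lin (-1) (linear_growth_cut k.+2 ge) (linear_growth_cst 0).
have E0 : E (fun=> 0) = 0.
  have := E_lin (-1) (linear_growth_cst 1) (linear_growth_cst 1).
  by rewrite E_1 mulN1r addNr.
rewrite E0 addr0 mulN1r => <-; congr E; apply/funext => j.
rewrite addr0 mulN1r; case: ltnP => [|kj]; first by rewrite oppr0.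
by rewrite /stein_extremal opprK ger0_norm// subr_ge0 ler_nat ltnW.
Qed.

(** The first difference solves the equation with killing rate 2, whose source is a second
    difference of [h], at most 2 in size: hence 2 / 2. One order up, the rate is 3 and the source at
    most 4, which gives 4 / 3. *)
Lemma stein_sol_diff_le1 h k : lipschitz1 h ->
  `|stein_sol h k.+1 - stein_sol h k| <= 1.
Proof.
move=> hh.
have step j : `|h j.+1 - h j| <= 1.
  apply: (le_trans (hh _ _)).
  by rewrite -natr1 addrAC subrr add0r normr1.
have bd := birth_death_diff (stein_sol_birth_death h).
have -> : 1 = 2 / (1 + 1) :> R by field.
apply: (@maximum_principle_norm _ theta (1 + 1) 2 theta_gt0 _
  (fun k => stein_sol h k.+1 - stein_sol h k) 2) => // j.
  apply: (le_trans (ler_normB _ _)).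
  by have := stein_sol_le1 j.+1 hh; have := stein_sol_le1 j hh; lra.
rewrite bd; apply: (le_trans (ler_normB _ _)).
by have := step j.+1; have := step j; lra.
Qed.

Lemma stein_sol_diff2_le43 h k : lipschitz1 h ->
  `|stein_sol h k.+2 - 2 * stein_sol h k.+1 + stein_sol h k| <= 4 / 3.
Proof.
move=> hh.
have step j : `|h j.+1 - h j| <= 1.
  apply: (le_trans (hh _ _)).
  by rewrite -natr1 addrAC subrr add0r normr1.
have bd := birth_death_diff (birth_death_diff (stein_sol_birth_death h)).
have -> : 4 / 3 = 4 / (1 + 1 + 1) :> R by congr (_ / _); ring.
have -> : stein_sol h k.+2 - 2 * stein_sol h k.+1 + stein_sol h k =
  stein_sol h k.+2 - stein_sol h k.+1 - (stein_sol h k.+1 - stein_sol h k).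
  by ring.
apply: (@maximum_principle_norm _ theta (1 + 1 + 1) 4 theta_gt0 _
  (fun k => stein_sol h k.+2 - stein_sol h k.+1 - (stein_sol h k.+1 - stein_sol h k)) 4).
- by [].
- move=> j; apply: (le_trans (ler_normB _ _)).
  by have := stein_sol_diff_le1 j.+1 hh; have := stein_sol_diff_le1 j hh; lra.
- move=> j; rewrite bd.
  have -> : h j.+3 - h j.+2 - (h j.+2 - h j.+1) - (h j.+2 - h j.+1 - (h j.+1 - h j)) =
    (h j.+3 - h j.+2) - (h j.+2 - h j.+1) - (h j.+2 - h j.+1) + (h j.+1 - h j).
    by ring.
  have := step j.+2; have := step j.+1; have := step j.
  by rewrite !ler_norml => /andP[? ?] /andP[? ?] /andP[? ?]; apply/andP; split; lra.
Qed.

(** The two factors in [c] are the lower moment about [k + 1] and the upper moment about [k + 2].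
    These centres are the two zeros of the function [eta] in [stein_sol_diff2_le]. The term
    subtracted on the right is nonnegative, so [theta^-1] bounds the sum. *)
Lemma stein_coef_second_difference k (c := cum k.+1) :
  ((k.+1%:R - theta) * c + theta * p k.+1) * (b k.+2 - 2 * b k.+1 + b k) +
  ((theta - k.+2%:R) * (1 - c) + theta * p k.+1) * (a k.+2 - 2 * a k.+1 + a k) =
  theta^-1 - (1 - c) * (a k.+2 - 2 * a k.+1 + a k).
Proof.
have th0 : theta != 0 by rewrite gt_eqF.
have -> : a k = (theta * a k.+1 - 1) / k.+1%:R.
  by rewrite coef_aS addrAC subrr add0r mulrAC mulfV ?mul1r// pnatr_eq0.
have -> : b k = (theta * b k.+1 + 1) / k.+1%:R.
  by rewrite coef_bS subrK mulrAC mulfV ?mul1r// pnatr_eq0.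
have -> : a k.+2 = (1 + k.+2%:R * a k.+1) / theta.
  by rewrite -coef_aS mulrAC mulfV ?mul1r.
have -> : b k.+2 = (k.+2%:R * b k.+1 - 1) / theta.
  by rewrite -coef_bS mulrAC mulfV ?mul1r.
rewrite /a /b -/c; field.
by rewrite nat1r !gt_eqF.
Qed.

(** An affine function has a constant solution, so subtracting the line through the values of [h] at
    [k + 1] and [k + 2] leaves the second difference unchanged. The rest [eta] vanishes at both
    points: the three values of the solution share the same two Poisson sums, and [eta j] is at most
    twice the distance of [j] to the nearer zero. *)
Lemma stein_sol_diff2_le h k : lipschitz1 h ->
  `|stein_sol h k.+2 - 2 * stein_sol h k.+1 + stein_sol h k| <= 2 / theta.
Proof.
move=> hh; have gh := lipschitz1_growth hh.
set s := h k.+2 - h k.+1.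
have s1 : `|s| <= 1.
  by apply: (le_trans (hh _ _)); rewrite -natr1 addrAC subrr add0r normr1.
pose eta j := - s * j%:R + h j - (h k.+1 - s * k.+1%:R).
have geta : linear_growth eta.
  by apply: linear_growthB; apply: linear_growth_comb => //; exact: linear_growth_id.
have eta1 : eta k.+1 = 0 by rewrite /eta; ring.
have eta2 : eta k.+2 = 0 by rewrite /eta /s -(natr1 k.+1); ring.
have etaE j : stein_sol h j = stein_sol eta j - s.
  rewrite /eta stein_sol_shift; last first.
    by apply: linear_growth_comb => //; exact: linear_growth_id.
  by rewrite stein_sol_comb ?stein_sol_id//; [ring|exact: linear_growth_id].
have -> : stein_sol h k.+2 - 2 * stein_sol h k.+1 + stein_sol h k =
   low eta k.+2 * (b k.+2 - 2 * b k.+1 + b k) -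
   tail eta k.+2 * (a k.+2 - 2 * a k.+1 + a k).
  rewrite !etaE !stein_sol_split /tail (poisson_lowS _ k.+2) (poisson_lowS _ k.+1).
  by rewrite eta1 eta2 !mul0r !addr0; ring.
apply: (le_trans (ler_normB _ _)); rewrite (normrM (low _ _)) (normrM (tail _ _)).
rewrite (ger0_norm (coef_a_convex _)) (ger0_norm (coef_b_convex _)).
have lowB : `|low eta k.+2| <= 2 * low (fun j => k.+1%:R - j%:R) k.+2.
  have -> : 2 * low (fun j => k.+1%:R - j%:R) k.+2 =
      low (fun j => 2 * (k.+1%:R - j%:R)) k.+2.
    by rewrite /low mulr_sumr; apply: eq_bigr => j _; rewrite mulrA.
  apply: poisson_low_le => j; rewrite ltnS => jk.
  have -> : eta j = (h j - h k.+1) + s * (k.+1%:R - j%:R) by rewrite /eta; ring.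
  apply: (le_trans (ler_normD _ _)).
  have jk0 : 0 <= k.+1%:R - j%:R :> R by rewrite subr_ge0 ler_nat.
  rewrite mulr_natl mulr2n lerD//.
    by apply: (le_trans (hh _ _)); rewrite distrC ger0_norm.
  by rewrite normrM (ger0_norm jk0) ler_piMl.
have tailB : `|tail eta k.+2| <= 2 * tail (fun j => j%:R - k.+2%:R) k.+2.
  have gid := linear_growthB k.+2%:R (@linear_growth_id R).
  have gid2 : linear_growth (fun j => 1 * (j%:R - k.+2%:R) + (j%:R - k.+2%:R) : R).
    exact: linear_growth_comb.
  have -> : 2 * tail (fun j => j%:R - k.+2%:R) k.+2 =
      tail (fun j => 1 * (j%:R - k.+2%:R) + (j%:R - k.+2%:R)) k.+2.
    rewrite /tail E_lin// /low mulrBr.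
    have -> : \sum_(j < k.+2) (1 * (j%:R - k.+2%:R) + (j%:R - k.+2%:R)) * p j =
      2 * \sum_(j < k.+2) (j%:R - k.+2%:R) * p j.
      by rewrite mulr_sumr; apply: eq_bigr => j _; ring.
    by ring.
  apply: poisson_tail_le => // j kj.
  have -> : eta j = (h j - h k.+2) + s * (k.+2%:R - j%:R).
    by rewrite /eta /s -(natr1 k.+1); ring.
  apply: (le_trans (ler_normD _ _)).
  have jk0 : 0 <= j%:R - k.+2%:R :> R by rewrite subr_ge0 ler_nat.
  rewrite mul1r lerD//.
    by apply: (le_trans (hh _ _)); rewrite ger0_norm.
  by rewrite normrM (distrC k.+2%:R) (ger0_norm jk0) ler_piMl.
apply: le_trans (lerD (ler_wpM2r (coef_b_convex _) lowB)
  (ler_wpM2r (coef_a_convex _) tailB)) _.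
rewrite -!mulrA -mulrDr ler_wpM2l//.
rewrite poisson_low_affine poisson_tail_affine stein_coef_second_difference.
by rewrite gerBl mulr_ge0 ?coef_a_convex// subr_ge0 poisson_cum_le1.
Qed.

End poisson_stein.

(** * A sharp bound on Poisson probabilities *)

Section poisson_pmf_bound.
Context {R : realType}.

Lemma MVT_is_derive (f df : R -> R) (a b : R) : a < b ->
  (forall x, a <= x <= b -> is_derive x (1 : R) f (df x)) ->
  exists2 c, a < c < b & f b - f a = df c * (b - a).
Proof.
move=> ab fdf.
have [x xab||c cab ->] := @MVT R f df a b ab.
- by apply: fdf; rewrite !ltW//; move: xab; rewrite in_itv/= => /andP[].
- apply: derivable_within_continuous => x xab.
  have [] // := fdf x _; by move: xab; rewrite in_itv.
- by exists c => //; move: cab; rewrite in_itv.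
Qed.

(* Hermite-Hadamard for [ln] on an interval centred at [1], of half-length [t]. *)
Lemma ln_hermite_hadamard (t : R) : 0 < t < 1 ->
  (1 + t) * ln (1 + t) - (1 - t) * ln (1 - t) <= 2 * t.
Proof.
move=> /andP[t0 t1].
pose f (x : R) := (1 + x) * ln (1 + x) - (1 - x) * ln (1 - x) - 2 * x.
pose df (x : R) := ln (1 + x) + ln (1 - x).
have [x /andP[x0 xt]|c /andP[c0 ct]] := @MVT_is_derive f df 0 t t0.
  have x1 : 0 < 1 - x by lra.
  have x2 : 0 < 1 + x by lra.
  have d1 := is_derive1_ln x1; have d2 := is_derive1_ln x2.
  have e1 : is_derive x 1 (fun x : R => 1 - x) (-1 : R).
    apply: is_derive_eq. by rewrite /GRing.scale /=; ring.
  have e2 : is_derive x 1 (fun x : R => 1 + x) (1 : R).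
    apply: is_derive_eq. by rewrite /GRing.scale /=; ring.
  have l1 := @is_derive1_comp _ (@ln R) _ x _ _ d1 e1.
  have l2 := @is_derive1_comp _ (@ln R) _ x _ _ d2 e2.
  apply: is_derive_eq.
  rewrite /GRing.scale /= /df; field.
  by rewrite !gt_eqF.
rewrite subr0 /f !addr0 !subr0 ln1 !mulr0 !subr0 => fE.
rewrite -subr_le0 fE pmulr_lle0// /df.
have c1 : 0 < 1 - c by lra.
have c2 : 0 < 1 + c by lra.
rewrite -lnM ?posrE// ln_le0//; nra.
Qed.

(** This is the induction step of [factorial_lower_bound]. With [t = 1 / (2 c)] the two exponents
    are [2 c (1 + t)] and [2 c (1 - t)], so its logarithm is [2 c] times the inequality of
    [ln_hermite_hadamard]. *)
Lemma factorial_step (m : nat) (c := m.+1%:R : R) :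
  (c + 2^-1) ^+ m.*2.+3 <= expR 2 * c ^+ 2 * (c - 2^-1) ^+ m.*2.+1.
Proof.
have c0 : 0 < c by rewrite ltr0n.
have c1 : 1 <= c by rewrite ler1n.
pose t := (2 * c)^-1.
have t0 : 0 < t by rewrite invr_gt0 mulr_gt0.
have t1 : t < 1 by rewrite invf_lt1 ?mulr_gt0//; lra.
have h := @ln_hermite_hadamard t; rewrite t0 t1 in h; have {}h := h isT.
have ct : c * t = 2^-1 by rewrite /t; field; rewrite gt_eqF.
have -> : c + 2^-1 = c * (1 + t) by rewrite mulrDr mulr1 ct.
have -> : c - 2^-1 = c * (1 - t) by rewrite mulrBr mulr1 ct.
have p1 : 0 < 1 + t by lra.
have p2 : 0 < 1 - t by lra.
have -> : expR 2 * c ^+ 2 * (c * (1 - t)) ^+ m.*2.+1 =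
    c ^+ (2 + m.*2.+1) * (expR 2 * (1 - t) ^+ m.*2.+1).
  by rewrite exprD exprMn; ring.
rewrite exprMn.
rewrite ler_pM2l ?exprn_gt0//.
rewrite -(lnK p1) -(lnK p2) -!expRM_natl -expRD ler_expR.
have e1 : m.*2.+3%:R = 2 * c * (1 + t).
  by rewrite -mulrA mulrDr ct mulr1 /c -addn3 natrD -mul2n natrM -natr1; field.
have e2 : m.*2.+1%:R = 2 * c * (1 - t).
  by rewrite -mulrA mulrBr ct mulr1 /c -addn1 natrD -mul2n natrM -natr1; field.
rewrite e1 e2.
have := ler_wpM2l (ltW (mulr_gt0 (ltr0n R 2) c0)) h.
have -> : 2 * c * (2 * t) = 2 by rewrite mulrACA -!mulrA ct; field.
lra.
Qed.

(** A Stirling bound about [m + 1/2], with equality at [m = 0]. The leading 2 becomes the 2 in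
    [2 * expR 1 * theta]; accordingly [poisson_pmf_sqr_le] is an equality for [m = 0], [l = 1/2]. *)
Lemma factorial_lower_bound (m : nat) :
  2 * (m%:R + 2^-1) ^+ m.*2.+1 <= expR m.*2%:R * m`!%:R ^+ 2 :> R.
Proof.
elim: m => [|m IH].
  by rewrite expR0 expr1n mulr1 expr1 add0r mulfV// pnatr_eq0.
rewrite doubleS.
have := factorial_step m; set c := m.+1%:R => step.
apply: le_trans (ler_wpM2l (ler0n R 2) step) _.
have cE : c - 2^-1 = m%:R + 2^-1 by rewrite /c -natr1; field.
rewrite cE.
have -> : 2 * (expR 2 * c ^+ 2 * (m%:R + 2^-1) ^+ m.*2.+1) =
   expR 2 * c ^+ 2 * (2 * (m%:R + 2^-1) ^+ m.*2.+1) by ring.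
have -> : expR m.*2.+2%:R * m.+1`!%:R ^+ 2 =
   expR 2 * c ^+ 2 * (expR m.*2%:R * m`!%:R ^+ 2).
  by rewrite -addn2 natrD expRD factS natrM /c; ring.
by rewrite ler_wpM2l// mulr_ge0// ?exprn_ge0// ltW// expR_gt0.
Qed.

(* For fixed [m] the left-hand side is maximal at [l = m + 1/2]. *)
Lemma poisson_pmf_sqr_le (m : nat) (l : R) : 0 < l ->
  2 * expR 1 * l * (expR (- l) * l ^+ m / m`!%:R) ^+ 2 <= 1.
Proof.
move=> l0; set y := m%:R + 2^-1 : R.
have y0 : 0 < y by rewrite /y ltr_wpDl.
have f0 : 0 < m`!%:R :> R by rewrite ltr0n fact_gt0.
have ly : l ^+ m.*2.+1 <= expR (2 * (l - y)) * y ^+ m.*2.+1.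
  have : l / y <= expR (l / y - 1).
    by have := expR_ge1Dx (l / y - 1); rewrite addrCA subrr addr0.
  move=> /(lerXn2r m.*2.+1); rewrite !nnegrE => /(_ _ _).
  rewrite -expRM_natl expr_div_n.
  have -> : m.*2.+1%:R * (l / y - 1) = 2 * (l - y).
    have -> : m.*2.+1%:R = 2 * y.
      by rewrite /y -addn1 natrD -mul2n natrM; field.
    by field; rewrite gt_eqF.
  rewrite ler_pdivrMr ?exprn_gt0//; apply.
    by rewrite ltW// divr_gt0.
  by rewrite ltW// expR_gt0.
have -> : 2 * expR 1 * l * (expR (- l) * l ^+ m / m`!%:R) ^+ 2 =
  2 * expR 1 * (expR (- l) ^+ 2) * l ^+ m.*2.+1 / m`!%:R ^+ 2.
  by rewrite (exprS l) -addnn exprD; field; rewrite gt_eqF.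
rewrite ler_pdivrMr ?exprn_gt0// mul1r.
have e0 : 0 < 2 * expR 1 * expR (- l) ^+ 2.
  by rewrite !mulr_gt0 ?expR_gt0// exprn_gt0// expR_gt0.
apply: le_trans (ler_wpM2l (ltW e0) ly) _.
have -> : 2 * expR 1 * expR (- l) ^+ 2 * (expR (2 * (l - y)) * y ^+ m.*2.+1) =
  expR (- m.*2%:R) * (2 * y ^+ m.*2.+1).
  have -> : expR (- m.*2%:R) = expR 1 * expR (- l) ^+ 2 * expR (2 * (l - y)).
    rewrite -expRM_natl -!expRD; congr expR.
    by rewrite /y -mul2n natrM; field.
  by ring.
have := factorial_lower_bound m; rewrite -/y => fb.
apply: le_trans (ler_wpM2l (ltW (expR_gt0 _)) fb) _.
by rewrite mulrA -expRD addNr expR0 mul1r.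
Qed.

End poisson_pmf_bound.

(** * Transition probabilities and resolvent of the immigration-death process *)

Section transition_kernel.
Context {R : realType} (theta : R).
Hypothesis theta_gt0 : 0 < theta.

Definition down (u : nat -> R) (m : nat) : R := if m is m'.+1 then u m' else 0.

(* The probability that a binomial [(k, 1 - r^2)] variable plus an independent
   Poisson [(theta r^2)] one equals [m]: the law at time [t] of the
   immigration-death process started at [k], where [exp (- t) = 1 - r^2]. *)
Fixpoint kernel (k m : nat) (r : R) : R :=
  if k is k'.+1 then
    (1 - r ^+ 2) * down (fun m => kernel k' m r) m + r ^+ 2 * kernel k' m r
  else expR (- (theta * r ^+ 2)) * (theta * r ^+ 2) ^+ m / m`!%:R.

Definition kernel_diff k m r := kernel k m r - down (fun m => kernel k m r) m.

Lemma kernel_diffS k m r : kernel_diff k.+1 m r =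
  (1 - r ^+ 2) * down (fun m => kernel_diff k m r) m + r ^+ 2 * kernel_diff k m r.
Proof.
rewrite /kernel_diff; case: m => [|m] /=; first by ring.
by ring.
Qed.

Definition dkernel k m r : R := - (2 * r) *
  (theta * kernel_diff k m r - k%:R * kernel_diff k.-1 m r).

(** Increasing [r ^+ 2] raises the Poisson mean at rate [theta] and lowers the success probability
    of each of the [k] initial individuals; each effect differentiates the law in its target, the
    second with one individual removed. *)
Lemma is_derive_kernel k m r :
  is_derive r (1 : R) (kernel k m) (dkernel k m r).
Proof.
elim: k m r => [|k IH] m r.
  rewrite /kernel /dkernel /kernel_diff mul0r subr0.
  have e1 : is_derive r 1 (fun r : R => - (theta * r ^+ 2)) (- (theta * (2 * r))).
    apply: is_derive_eq; rewrite /GRing.scale /=; ring.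
  have e2 : is_derive r 1 (fun r : R => theta * r ^+ 2) (theta * (2 * r)).
    apply: is_derive_eq; rewrite /GRing.scale /=; ring.
  have e3 := @is_derive1_comp _ (@expR R) _ r _ _ (is_derive_expR _) e1.
  case: m => [|m] /=.
    have -> : (fun r => expR (- (theta * r ^+ 2)) * (theta * r ^+ 2) ^+ 0 / 0`!%:R) =
        expR \o (fun r : R => - (theta * r ^+ 2)).
      by apply/funext => x /=; rewrite expr0 fact0 mulr1 divr1.
    by apply: is_derive_eq; rewrite fact0; field.
  have -> : (fun r => expR (- (theta * r ^+ 2)) * (theta * r ^+ 2) ^+ m.+1 /
      m.+1`!%:R) = (cst m.+1`!%:R^-1 * ((expR \o (fun r : R => - (theta * r ^+ 2))) *
        (fun r : R => theta * r ^+ 2) ^+ m.+1)).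
    by apply/funext => x; rewrite exprfctE /= mulrC.
  have e4 := @is_deriveX _ _ _ m.+1 _ _ _ e2.
  apply: is_derive_eq.
  rewrite scaler0 addr0 exprfctE /GRing.scale /= factS natrM (exprS _ m); field.
  by rewrite nat1r !pnatr_eq0 -!lt0n fact_gt0.
have dd : is_derive r (1 : R) (fun r => down (fun m => kernel k m r) m)
    (down (fun m => dkernel k m r) m).
  case: m => [|m] /=; first exact: is_derive_cst.
  exact: IH.
have dk := IH m r.
have -> : kernel k.+1 m = fun r => (1 - r ^+ 2) * down (fun m => kernel k m r) m
   + r ^+ 2 * kernel k m r by [].
apply: is_derive_eq; rewrite /GRing.scale /=.
rewrite /dkernel kernel_diffS.
have kk : k%:R * kernel_diff k m r = k%:R * ((1 - r ^+ 2) *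
    down (fun m => kernel_diff k.-1 m r) m + r ^+ 2 * kernel_diff k.-1 m r).
  by case: (k) => [|k'] /=; rewrite ?mul0r// -kernel_diffS.
rewrite -(natr1 k) /= [(k%:R + 1) * _]mulrDl kk.
case: m {dd dk kk} => [|m] /=; rewrite /kernel_diff /=; ring.
Qed.

(** One more initial individual changes the kernel by [- (1 - r ^+ 2) * kernel_diff]. This turns
    differences in the target into differences in the starting point, and with [is_derive_kernel] it
    is the backward Kolmogorov equation in the variable [r]. *)
Lemma kernel_backward k m r : (1 - r ^+ 2) * (theta * kernel_diff k m r -
     k%:R * kernel_diff k.-1 m r) =
   - (theta * (kernel k.+1 m r - kernel k m r) -
      k%:R * (kernel k m r - kernel k.-1 m r)).
Proof.
case: k => [|k] /=; rewrite /kernel_diff /=; ring.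
Qed.

Lemma kernel_ge0 k m r : 0 <= r <= 1 -> 0 <= kernel k m r.
Proof.
move=> /andP[r0 r1]; have s0 : 0 <= 1 - r ^+ 2 by nra.
elim: k m => [|k IH] m /=.
  rewrite divr_ge0// mulr_ge0 ?expR_ge0// exprn_ge0// mulr_ge0 ?(ltW theta_gt0)//.
  exact: sqr_ge0.
apply: addr_ge0; apply: mulr_ge0 => //; last exact: sqr_ge0.
by case: m => [|m] //=.
Qed.

(** For [k = 0] this is [poisson_pmf_sqr_le] at parameter [theta * r ^+ 2], the factor [r]
    accounting for the square root of [r ^+ 2]. Each further individual replaces the kernel by a
    convex combination of its values, which keeps the bound. *)
Lemma kernel_le k m r : 0 <= r <= 1 ->
  r * kernel k m r <= (Num.sqrt (2 * expR 1 * theta))^-1.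
Proof.
move=> /andP[r0 r1]; have s0 : 0 <= 1 - r ^+ 2 by nra.
have D0 : 0 < 2 * expR 1 * theta by rewrite !mulr_gt0 ?expR_gt0.
have c0 : 0 <= (Num.sqrt (2 * expR 1 * theta))^-1 by rewrite invr_ge0 sqrtr_ge0.
elim: k m => [|k IH] m.
  have [->|rn0] := eqVneq r 0; first by rewrite mul0r.
  have r0' : 0 < r by rewrite lt_neqAle eq_sym rn0.
  rewrite -ler_sqr ?nnegrE//; last first.
    by rewrite mulr_ge0// kernel_ge0// r0.
  rewrite exprVn sqr_sqrtr; last exact: ltW.
  rewrite -[leRHS]mul1r ler_pdivlMr//.
  have := @poisson_pmf_sqr_le R m (theta * r ^+ 2).
  rewrite mulr_gt0 ?exprn_gt0// => /(_ isT) /=; apply: le_trans.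
  by rewrite le_eqVlt; apply/orP; left; apply/eqP; ring.
rewrite /=; set c := _^-1 in c0 IH *.
have dc : r * down (fun m => kernel k m r) m <= c.
  by case: m => [|m] /=; rewrite ?mulr0//.
have := IH m; have := sqr_ge0 r.
set x := down _ _ in dc *; set y := kernel _ _ _; set z := r ^+ 2 in s0 *.
move=> z0 yc; rewrite mulrDr !(mulrCA r).
have := ler_wpM2l s0 dc; have := ler_wpM2l z0 yc; lra.
Qed.

Lemma kernel0 k m : kernel k m 0 = (k == m)%:R.
Proof.
elim: k m => [|k IH] m /=.
  rewrite expr0n mulr0 oppr0 expR0 mul1r; case: m => [|m].
    by rewrite expr0 fact0 divr1.
  by rewrite expr0n mul0r.
rewrite expr0n subr0 mul1r mul0r addr0; by case: m => [|m] //=.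
Qed.

Lemma exists_primitive (f : R -> R) : continuous f ->
  exists F : R -> R, forall x : R, 0 <= x <= 1 -> is_derive x (1 : R) F (f x).
Proof.
move=> cf.
(* Starting the integral at [-1] makes 0 an interior point, so that the derivative there is
   two-sided. *)
exists (fun x => \int[lebesgue_measure]_(t in `[(-1 : R), x]) f t).
move=> x /andP[x0 x1].
have [||||dF F'] := @continuous_FTC1_closed R f (-1) x 2.
- by lra.
- apply: continuous_compact_integrable; first exact: segment_compact.
  exact: continuous_subspaceT.
- by lra.
- exact: cf.
by apply: DeriveDef; [exact: dF|rewrite -derive1E].
Qed.


(** Under exp (- t) = 1 - r^2 one has exp (- 2 t) dt = 2 r (1 - r^2) dr, so the increment of [J k m]
    over [0, 1] is the resolvent at rate 2 of the point mass at [m]. The factor [r] is the one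
    controlled by [kernel_le]. *)
Lemma kernel_primitive : exists J : nat -> nat -> R -> R,
  forall k m (r : R), 0 <= r <= 1 -> is_derive r (1 : R) (J k m)
    (2 * (1 - r ^+ 2) * (r * kernel k m r)).
Proof.
suff /choice[J hJ] km : exists F : R -> R, forall r : R, 0 <= r <= 1 ->
    is_derive r (1 : R) F (2 * (1 - r ^+ 2) * (r * kernel km.1 km.2 r)).
  by exists (fun k m => J (k, m)) => k m; exact: (hJ (k, m)).
apply: (@exists_primitive (fun r => 2 * (1 - r ^+ 2) * (r * kernel km.1 km.2 r))).
move=> r; apply: differentiable_continuous; apply/derivable1_diffP.
have dk := is_derive_kernel km.1 km.2 r.
have [d _] : is_derive r (1 : R)
    (fun r => 2 * (1 - r ^+ 2) * (r * kernel km.1 km.2 r))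
    (- 4 * r * (r * kernel km.1 km.2 r) +
     2 * (1 - r ^+ 2) * (kernel km.1 km.2 r + r * dkernel km.1 km.2 r)).
  by apply: is_derive_eq; rewrite /GRing.scale /=; ring.
exact: d.
Qed.

Lemma resolvent_exists (m : nat) : exists V : nat -> R,
  (forall k, `|V k| <= 8 / (3 * Num.sqrt (2 * expR 1 * theta))) /\
  (forall k, theta * (V k.+1 - V k) - k%:R * (V k - V k.-1) - (1 + 1) * V k =
    - 2 * (k == m)%:R).
Proof.
have [J hJ] := kernel_primitive.
exists (fun k => 2 * (J k m 1 - J k m 0)); split=> k.
  set c := (Num.sqrt (2 * expR 1 * theta))^-1.
  have -> : 8 / (3 * Num.sqrt (2 * expR 1 * theta)) = 2 * (4 / 3 * c).
    by rewrite invfM -/c; move: (c) => c'; field.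
  rewrite normrM (ger0_norm (ler0n R 2)) ler_wpM2l//.
  have [x x01|y /andP[y0 y1] yE] := @MVT_is_derive R
    (fun r => J k m r) (fun r => 2 * (1 - r ^+ 2) * (r * kernel k m r)) 0 1 ltr01.
    exact: hJ.
  (* Comparison with a primitive of [2 * c * (1 - r ^+ 2)], whose increment over [0, 1] is
     [4 / 3 * c]. *)
  have [x x01|z /andP[z0 z1] zE] := @MVT_is_derive R
    (fun r => 2 * c * (r - r ^+ 3 / 3) - J k m r)
    (fun r => 2 * c * (1 - r ^+ 2) - 2 * (1 - r ^+ 2) * (r * kernel k m r)) 0 1 ltr01.
    have dJ := hJ k m x x01.
    by apply: is_derive_eq; rewrite /GRing.scale /=; field.
  have y01 : 0 <= y <= 1 by rewrite !ltW.
  have z01 : 0 <= z <= 1 by rewrite !ltW.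
  rewrite ger0_norm; last first.
    rewrite yE subr0 mulr1 !mulr_ge0 ?kernel_ge0//; [nra|lra].
  have : 0 <= 2 * c * (1 - z ^+ 2) - 2 * (1 - z ^+ 2) * (z * kernel k m z).
    have := kernel_le k m z01; rewrite -/c => zc.
    have -> : 2 * c * (1 - z ^+ 2) - 2 * (1 - z ^+ 2) * (z * kernel k m z) =
      2 * (1 - z ^+ 2) * (c - z * kernel k m z) by ring.
    by rewrite !mulr_ge0 ?subr_ge0//; nra.
  move: zE; rewrite subr0 mulr1 => <-.
  rewrite expr1n expr0n /=; lra.
(* By the backward equation [H] is constant. Its last term vanishes at [r = 1] and is the point mass
   at [r = 0], so equating the end values gives the resolvent equation. *)
pose H r := 2 * J k m r - (theta * (J k.+1 m r - J k m r) -
   k%:R * (J k m r - J k.-1 m r)) + (1 - r ^+ 2) ^+ 2 * kernel k m r.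
have [x x01|z _] := @MVT_is_derive R H (fun=> 0) 0 1 ltr01.
  have d1 := hJ k m x x01; have d2 := hJ k.+1 m x x01.
  have d3 := hJ k.-1 m x x01; have d4 := is_derive_kernel k m x.
  rewrite /H; apply: is_derive_eq; rewrite /GRing.scale /=.
  have := kernel_backward k m x; rewrite /dkernel /=.
  set K := kernel_diff _ _ _; set K' := kernel_diff _ _ _.
  set p := kernel k m x; set p1 := (X in theta * (X - p)).
  set p' := kernel k.-1 m x => h.
  transitivity (2 * x * (1 - x ^+ 2) * (- (theta * (p1 - p) - k%:R * (p - p')) -
    (1 - x ^+ 2) * (theta * K - k%:R * K'))); first by rewrite /p1; ring.
  by rewrite h subrr mulr0.
rewrite mul0r /H kernel0 => h; lra.
Qed.

End transition_kernel.

(** The second difference of the extremal function is -2 at [k] and 0 elsewhere, the source of the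
    resolvent equation. The maximum principle with zero source makes bounded solutions unique, which
    identifies the first difference of the extremal solution with [V]. *)
Lemma stein_bound_le (R : realType) (theta : R) (E : (nat -> R) -> R) k :
  0 < theta -> poisson_functional theta E ->
  stein_bound theta E k <= 8 / (3 * Num.sqrt (2 * expR 1 * theta)).
Proof.
move=> theta0 pE.
have [V [Vb Veq]] := resolvent_exists theta0 k.
have hlip := @stein_extremal_lipschitz R k.
pose v j := stein_sol theta E (stein_extremal k) j.+1 -
  stein_sol theta E (stein_extremal k) j.
rewrite -(stein_sol_diff_extremal theta0 pE) -/(v k).
have vbd : forall j, `|V j - v j| <= 8 / (3 * Num.sqrt (2 * expR 1 * theta)) + 1.
  move=> j; apply: (le_trans (ler_normB _ _)); apply: lerD => //.
  exact: (stein_sol_diff_le1 theta0 pE _ hlip).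
have vP := birth_death_diff (stein_sol_birth_death E theta0 (stein_extremal k)).
have : `|V k - v k| <= 0.
  rewrite -[leRHS](mul0r (1 + 1)^-1).
  apply: (@maximum_principle_norm R theta (1 + 1) 0 theta0 _ (fun j => V j - v j)).
  - by [].
  - exact: vbd.
  move=> j; rewrite normr_le0; apply/eqP.
  transitivity ((theta * (V j.+1 - V j) - j%:R * (V j - V j.-1) - (1 + 1) * V j) -
    (theta * (v j.+1 - v j) - j%:R * (v j - v j.-1) - (1 + 1) * v j)); first by ring.
  rewrite Veq vP /stein_extremal.
  have e i : `|i%:R - k.+1%:R| = if (i <= k)%N then k.+1%:R - i%:R else i%:R - k.+1%:R :> R.
    case: leqP => ik; last by rewrite ger0_norm// subr_ge0 ler_nat.
    by rewrite distrC ger0_norm// subr_ge0 ler_nat leqW.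
  rewrite !e; case: (ltngtP j k) => jk; rewrite ?mulr0n ?mulr1n.
  - case: (ltnP j.+1 k) => jk2; first by rewrite -(natr1 j.+1) -(natr1 j); ring.
    have -> : k = j.+1 by apply/eqP; rewrite eqn_leq jk andbT -ltnS.
    by rewrite -(natr1 j.+1) -(natr1 j); ring.
  - rewrite ltnNge (leq_trans (ltnW jk) (leqnSn j)) /=.
    by rewrite -(natr1 j.+1) -(natr1 j); ring.
  - by rewrite jk ltnNge leqnSn /= -(natr1 k.+1) -(natr1 k); ring.
rewrite normr_le0 subr_eq0 => /eqP <-.
exact: le_trans (ler_norm _) (Vb k).
Qed.

(** * The Poisson measure and the complete Stein solution *)

Section poisson_prob_functional.
Context {R : realType} (theta : R).
Hypothesis theta_gt0 : 0 < theta.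
Local Notation Pn := (poisson_prob theta 0).

Lemma measurable_fun_nat {d} {T : measurableType d} (D : set nat) (f : nat -> T) :
  measurable_fun D f.
Proof. by []. Qed.

Lemma ge0_integral_poisson (f : nat -> R) : (forall k, 0 <= f k) ->
  (\int[Pn]_k (f k)%:E = \sum_(0 <= k <oo) (f k * poisson_pmf theta k)%:E)%E.
Proof.
move=> f0.
have UT : \bigcup_k [set k] = [set: nat].
  by apply/seteqP; split=> // k _; exists k.
rewrite -{1}UT ge0_integral_bigcup//=; last 2 first.
- by move=> k _; rewrite lee_fin.
- by apply/trivIsetP => i j _ _ ij; apply/seteqP; split => // k [/= -> /eqP]; rewrite (negbTE ij).
apply: eq_eseriesr => k _.
rewrite (eq_integral (fun=> (f k)%:E)); last by move=> j; rewrite inE => ->.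
rewrite integral_cst//= /poisson_prob theta_gt0 esum_set1 ?EFinM//.
by rewrite lee_fin poisson_pmf_ge0.
Qed.

Lemma poisson_mean : (\int[Pn]_k (k%:R : R)%:E = theta%:E)%E.
Proof.
rewrite ge0_integral_poisson; last by move=> k; exact: ler0n.
rewrite nneseries_recl//; last first.
  by move=> k _; rewrite lee_fin mulr_ge0// poisson_pmf_ge0.
rewrite mul0r add0e -nneseries_addn; last first.
  by move=> k; rewrite lee_fin mulr_ge0// poisson_pmf_ge0.
under eq_eseriesr => k _.
  rewrite addn1.
  have -> : k.+1%:R * poisson_pmf theta k.+1 = theta * (1 * poisson_pmf theta k) :> R.
    rewrite /poisson_pmf theta_gt0 factS natrM exprS; field.
    by rewrite nat1r !pnatr_eq0 -!lt0n fact_gt0.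
  rewrite EFinM; over.
rewrite nneseriesZl; last first.
  by move=> k _; rewrite lee_fin mul1r poisson_pmf_ge0.
rewrite -(@ge0_integral_poisson (fun=> 1))//.
by rewrite integral_cst// mul1e [X in (_ * X)%E](_ : _ = 1%E) ?mule1//; exact: (probability_setT Pn).
Qed.

Lemma poisson_integrable (f : nat -> R) :
  linear_growth f -> Pn.-integrable setT (EFin \o f).
Proof.
move=> [C hC].
apply: (@le_integrable _ _ _ _ _ _ _ (EFin \o (fun k => C * k.+1%:R))) => //.
  move=> k _ /=; rewrite lee_fin; apply: (le_trans (hC k)); exact: ler_norm.
have i1 : Pn.-integrable setT (EFin \o (fun k : nat => k%:R : R)).
  apply/integrableP; split => //.
  under eq_integral do rewrite /= normr_nat.
  by rewrite poisson_mean ltry.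
have i2 : Pn.-integrable setT (EFin \o (fun _ : nat => 1 : R)).
  exact: finite_measure_integrable_cst.
have := integrableZl measurableT C (integrableD measurableT i1 i2).
apply: eq_integrable => // k _ /=.
by rewrite -EFinD -EFinM natr1.
Qed.

Definition poisson_expectation (f : nat -> R) : R := \int[Pn]_k f k.

Lemma poisson_expectationE (f : nat -> R) : linear_growth f ->
  (\int[Pn]_k (f k)%:E = (poisson_expectation f)%:E)%E.
Proof.
move=> hf; rewrite /poisson_expectation /Rintegral fineK//.
exact: integrable_fin_num (poisson_integrable hf).
Qed.

Lemma poisson_expectation_functional : poisson_functional theta poisson_expectation.
Proof.
rewrite /poisson_expectation; split => [a phi psi hphi hpsi|phi _ phi0|j||].
- have i1 := poisson_integrable hphi; have i2 := poisson_integrable hpsi.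
  rewrite RintegralD//; last exact: (integrableZl measurableT a i1).
  by rewrite RintegralZl.
- exact: Rintegral_ge0.
- rewrite /Rintegral (eq_integral (fun k => (\1_[set j] k)%:E)).
    rewrite integral_indic// setIT /= /poisson_prob theta_gt0 esum_set1//.
    by rewrite lee_fin poisson_pmf_ge0.
  by move=> k _ /=; rewrite indicE in_set1.
- by rewrite Rintegral_cst// [X in fine X](_ : _ = 1%E) ?mulr1//; exact: (probability_setT Pn).
- by rewrite /Rintegral poisson_mean.
Qed.

Lemma poisson_stein_solution (h : nat -> R) : lipschitz1 h ->
  exists g : nat -> R,
  [/\ forall k, theta * g k.+1 - k%:R * g k = h k - poisson_expectation h,
      forall k, `|g k| <= 1,
      forall k, `|g k.+1 - g k| <=
        Num.min 1 (8 / (3 * Num.sqrt (2 * expR 1 * theta))) &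
      forall k, `|g k.+2 - 2 * g k.+1 + g k| <= 2 * Num.min (2 / 3) (1 / theta)].
Proof.
move=> hh; have pE := poisson_expectation_functional.
set E := poisson_expectation in pE *.
pose w := stein_sol theta E h.
have w1 k : `|w k| <= 1 by exact: (stein_sol_le1 theta_gt0 pE).
have wd k : `|w k.+1 - w k| <= Num.min 1 (8 / (3 * Num.sqrt (2 * expR 1 * theta))).
  rewrite le_min (stein_sol_diff_le1 theta_gt0 pE)//=.
  apply: le_trans (stein_sol_diff_le theta_gt0 pE _ hh) _.
  exact: stein_bound_le.
have wdd k : `|w k.+2 - 2 * w k.+1 + w k| <= 2 * Num.min (2 / 3) (1 / theta).
  have -> : 2 * Num.min (2 / 3) (1 / theta) = Num.min (4 / 3) (2 / theta).
    rewrite minr_pMr//; congr Num.min; last by rewrite mulrA mulr1.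
    by field.
  by rewrite le_min (stein_sol_diff2_le43 theta_gt0 pE)//= (stein_sol_diff2_le theta_gt0 pE).
have weq := stein_equation E theta_gt0 h.
have c1 : 0 <= Num.min 1 (8 / (3 * Num.sqrt (2 * expR 1 * theta))).
  exact: le_trans (wd 0%N).
have c2 : 0 <= 2 * Num.min (2 / 3) (1 / theta) by exact: le_trans (wdd 0%N).
(* The Stein equation leaves [g 0] free; it must keep both differences at [0] small. *)
pose g0 := if theta < 1 then w 0%N else 2 * w 0%N - w 1%N.
exists (fun k => if k is k'.+1 then w k' else g0); split => -[|k] //=.
- by have := weq 0%N => /=; rewrite !mul0r.
- rewrite /g0; case: ltP => // th1.
  have e0 := weq 0%N; have e1 := weq 1%N; rewrite /= -!/w in e0 e1.
  (* By the Stein equation at 0 and 1, the extrapolated value is a convex combination, with weight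
     [theta^-1 <= 1], of [w 0] and [- (h 1 - h 0)], both at most 1 in size. *)
  have wE : 2 * w 0%N - w 1%N = (1 - theta^-1) * w 0%N - theta^-1 * (h 1%N - h 0%N).
    have -> : h 1%N - h 0%N = theta * w 1%N - w 0%N - theta * w 0%N by lra.
    by field; rewrite gt_eqF.
  have ti : 0 <= theta^-1 <= 1.
    by rewrite invr_ge0 ltW//= invf_le1.
  have hd : `|h 1%N - h 0%N| <= 1.
    by apply: (le_trans (hh _ _)); rewrite subr0 normr1.
  move: ti => /andP[ti0 ti1].
  rewrite wE; apply: (le_trans (ler_normB _ _)).
  rewrite (normrM (1 - _)) (normrM theta^-1).
  rewrite (ger0_norm ti0) ger0_norm ?subr_ge0//.
  have t1 : 0 <= 1 - theta^-1 by rewrite subr_ge0.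
  have := ler_wpM2l t1 (w1 0%N); have := ler_wpM2l ti0 hd; lra.
- rewrite /g0; case: ltP => th1; first by rewrite subrr normr0.
  have -> : w 0%N - (2 * w 0%N - w 1%N) = w 1%N - w 0%N by ring.
  exact: wd.
(* Linear extrapolation makes the second difference at 0 vanish. For [theta < 1] it equals a first
   difference, at most 1, and both [2 / 3] and [1 / theta] exceed [1 / 2]. *)
- rewrite /g0; case: ltP => th1; last first.
    have -> : w 1%N - 2 * w 0%N + (2 * w 0%N - w 1%N) = 0 by ring.
    by rewrite normr0.
  have -> : w 1%N - 2 * w 0%N + w 0%N = w 1%N - w 0%N by ring.
  have := wd 0%N; rewrite le_min => /andP[h1 _]; apply: le_trans h1 _.
  apply: (@le_trans _ _ (2 * (1 / 2))); first lra.
  rewrite ler_wpM2l// le_min; apply/andP; split; first lra.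
  have : 1 <= theta^-1 by rewrite invf_ge1// ltW.
  lra.
Qed.

End poisson_prob_functional.

(* The sign of [a - b] decides on which side [g] is expanded; both cases give
   the bound [n (n - 1) / 2] or [n (n + 1) / 2] with [n = |a - b|]. *)
Lemma discrete_taylor (R : realType) (g : nat -> R) (C : R) :
  (forall k, `|g k.+2 - 2 * g k.+1 + g k| <= 2 * C) ->
  forall a b : nat, `|g a - g b - (g a.+1 - g a) * (a%:R - b%:R)| <=
    C * ((a%:R - b%:R) ^+ 2 + (a%:R - b%:R)).
Proof.
move=> gC.
have slope k n : `|(g (k + n).+1 - g (k + n)%N) - (g k.+1 - g k)| <= 2 * C * n%:R.
  elim: n => [|n IH]; first by rewrite addn0 subrr normr0 mulr0.
  have := gC (k + n)%N; move: IH; rewrite addnS -(natr1 n) mulrDr mulr1.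
  by rewrite !ler_norml => /andP[? ?] /andP[? ?]; apply/andP; split; lra.
have up a n : `|g a - g (a + n)%N + (g a.+1 - g a) * n%:R| <= C * (n%:R ^+ 2 - n%:R).
  elim: n => [|n IH].
    by rewrite addn0 subrr mulr0 add0r normr0 expr0n subr0 mulr0.
  have := slope a n; move: IH; rewrite addnS -(natr1 n).
  by rewrite !ler_norml => /andP[? ?] /andP[? ?]; apply/andP; split; nra.
have dn a n : (n <= a)%N ->
    `|g a - g (a - n)%N - (g a.+1 - g a) * n%:R| <= C * (n%:R ^+ 2 + n%:R).
  elim: n => [|n IH] na.
    by rewrite subn0 subrr mulr0 subr0 normr0 expr0n addr0 mulr0.
  have := IH (ltnW na); have := slope (a - n.+1)%N n.+1.
  rewrite subnK// -(natr1 n).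
  have -> : (a - n = (a - n.+1).+1)%N by rewrite subnSK.
  by rewrite !ler_norml => /andP[? ?] /andP[? ?]; apply/andP; split; nra.
move=> a b; have [ab|ba] := leqP a b.
  have := up a (b - a)%N; rewrite subnKC// natrB//.
  have -> : (g a.+1 - g a) * (b%:R - a%:R) = - ((g a.+1 - g a) * (a%:R - b%:R)) by ring.
  have -> : (b%:R - a%:R) ^+ 2 - (b%:R - a%:R) =
    (a%:R - b%:R) ^+ 2 + (a%:R - b%:R) :> R by ring.
  by [].
have := dn a (a - b)%N (leq_subr _ _); rewrite subKn; last exact: ltnW.
by rewrite natrB// ltnW.
Qed.

(** * Product laws on sequence space *)

Section seq_space_measurability.
Context {d : measure_display} {T : measurableType d}.
Local Notation S := (seq_space T).

Lemma measurable_coord i : measurable_fun [set: S] (fun x : S => x i).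
Proof.
move=> _ B mB; rewrite setTI; apply: sub_sigma_algebra.
by exists i, B.
Qed.

Lemma measurable_fun_seq_space d' (U : measurableType d') (F : U -> S) :
  (forall i, measurable_fun [set: U] (fun u => F u i)) -> measurable_fun [set: U] F.
Proof.
move=> mF; apply: (@measurability _ _ U S setT F (@cylinders d T) erefl).
move=> _ [_ [i [B mB ->]] <-].
by have := mF i measurableT B mB.
Qed.

(** Conditioning and resampling are both expressed by splicing two full sequences, so that no space
    of partial sequences is needed. *)
Definition splice (J : pred nat) (x y : S) : S := fun k => if J k then x k else y k.

Lemma splice_splice J K x y z :
  splice K (splice J x y) z = splice (fun k => J k && K k) x (splice K y z).
Proof.
by apply/funext => k; rewrite /splice; case: (J k); case: (K k).
Qed.

Lemma splice_swap J x y : splice J (splice J x y) (splice J y x) = x.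
Proof. by apply/funext => k; rewrite /splice; case: (J k). Qed.

Lemma splice_left J x y z : splice J (splice J x y) z = splice J x z.
Proof. by apply/funext => k; rewrite /splice; case: (J k). Qed.

Lemma measurable_splice2 J d' (U : measurableType d') (F G : U -> S) :
  measurable_fun [set: U] F -> measurable_fun [set: U] G ->
  measurable_fun [set: U] (fun u => splice J (F u) (G u)).
Proof.
move=> mF mG; apply: measurable_fun_seq_space => i; rewrite /splice.
by case: (J i); exact: (measurableT_comp (measurable_coord i)).
Qed.

Lemma measurable_splice J : measurable_fun [set: S * S] (fun p => splice J p.1 p.2).
Proof. exact: measurable_splice2. Qed.

Lemma measurable_splice_l J x : measurable_fun [set: S] (splice J x).
Proof. exact: (@measurable_splice2 J _ S (cst x) id). Qed.

Lemma measurable_splice_r J y : measurable_fun [set: S] (fun x => splice J x y).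
Proof. exact: (@measurable_splice2 J _ S id (cst y)). Qed.

Definition swap_coords J (p : S * S) : S * S := (splice J p.1 p.2, splice J p.2 p.1).

Lemma measurable_swap_coords J : measurable_fun [set: S * S] (swap_coords J).
Proof. by apply/measurable_fun_pairP; split; exact: measurable_splice2. Qed.

HB.instance Definition _ J := isMeasurableFun.Build _ _ _ _
  (swap_coords J) (measurable_swap_coords J).

Definition box n (B : nat -> set T) : set S :=
  [set x | forall i, (i < n)%N -> B i (x i)].

Lemma measurable_box n B : (forall i, measurable (B i)) -> measurable (box n B).
Proof.
move=> mB.
have -> : box n B = \bigcap_(i in [set i | (i < n)%N]) ((fun x : S => x i) @^-1` B i).
  by apply/seteqP; split.
apply: bigcap_measurableType => i _.
by rewrite -[_ @^-1` _]setTI; exact: measurable_coord.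
Qed.

Lemma box_widen n m B : (n <= m)%N ->
  box n B = box m (fun i => if (i < n)%N then B i else setT).
Proof.
move=> nm; apply/seteqP; split=> x h i im.
  by case: ifP => // /h.
by have := h i (leq_trans im nm); rewrite im.
Qed.

Lemma box_setI n m B C : box n B `&` box m C = box (maxn n m)
  (fun i => (if (i < n)%N then B i else setT) `&` (if (i < m)%N then C i else setT)).
Proof.
rewrite (box_widen B (leq_maxl n m)) (box_widen C (leq_maxr n m)).
apply/seteqP; split=> [x [h1 h2] i im|x h]; first by split; [exact: h1|exact: h2].
by split=> i im; have [] := h i im.
Qed.

Definition box_system : set (set (S * S)) :=
  [set A | exists n B C, [/\ forall i, measurable (B i), forall i, measurable (C i) &
     A = box n B `*` box n C]].

(** It suffices that both projections are measurable for the generated sigma-algebra, and this can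
    be checked on one-coordinate cylinders, which are boxes padded with the full set. *)
Lemma measurable_box_system : @measurable _ (S * S)%type = <<s box_system >>.
Proof.
apply/seteqP; split; last first.
  apply: smallest_sub; first exact: sigma_algebra_measurable.
  move=> _ [n [B [C [mB mC ->]]]].
  by apply: measurableX; exact: measurable_box.
have gen (p : S * S -> S) : (forall i B, measurable B ->
    <<s box_system >> (p @^-1` ((fun x : S => x i) @^-1` B))) ->
    forall A, measurable A -> <<s box_system >> (p @^-1` A).
  move=> h.
  have : measurable `<=` image_set_system [set: S * S] p <<s box_system >>.
    apply: smallest_sub.
      exact/sigma_algebra_image/smallest_sigma_algebra.
    by move=> _ [i [B mB ->]]; rewrite /image_set_system /= setTI; exact: h.
  by move=> sub A /sub; rewrite /image_set_system /= setTI.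
have cyl i B : box i.+1 (fun k => if k == i then B else setT) =
    (fun x : S => x i) @^-1` B.
  apply/seteqP; split=> [x /(_ i)|x Bx k _]; first by rewrite eqxx; exact.
  by case: eqP => // ->.
have g1 : forall A, measurable A -> <<s box_system >> ((@fst S S) @^-1` A).
  apply: gen => i B mB; apply: sub_sigma_algebra.
  exists i.+1, (fun k => if k == i then B else setT), (fun=> setT); split => //.
    by move=> k; case: ifP.
  by rewrite cyl; apply/seteqP; split=> -[x y] // [].
have g2 : forall A, measurable A -> <<s box_system >> ((@snd S S) @^-1` A).
  apply: gen => i B mB; apply: sub_sigma_algebra.
  exists i.+1, (fun=> setT), (fun k => if k == i then B else setT); split => //.
    by move=> k; case: ifP.
  by rewrite cyl; apply/seteqP; split=> -[x y] // [].
rewrite measurable_prod_measurableType.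
apply: smallest_sub; first exact: smallest_sigma_algebra.
move=> _ [A mA [B mB <-]].
have -> : A `*` B = fst @^-1` A `&` snd @^-1` B by apply/seteqP; split=> -[x y].
exact: (@measurableI _ (g_sigma_algebraType box_system) _ _ (g1 A mA) (g2 B mB)).
Qed.

Lemma box_system_setI : setI_closed box_system.
Proof.
move=> _ _ [n [B [C [mB mC ->]]]] [m [B' [C' [mB' mC' ->]]]].
rewrite -setXI !box_setI.
exists (maxn n m); do 2 eexists; split; last by [].
- by move=> i; apply: measurableI; case: ifP.
- by move=> i; apply: measurableI; case: ifP.
Qed.

End seq_space_measurability.

Section product_law.
Context {d : measure_display} {T : measurableType d} {R : realType}.
Local Notation S := (seq_space T).

Definition product_law (Q : set S -> \bar R) : Prop :=
  forall n (B : nat -> set T), (forall i, measurable (B i)) ->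
  Q (box n B) = (\prod_(i < n) Q ((fun x : S => x i) @^-1` B i))%E.

Variable Q : probability S R.
Hypothesis prodQ : product_law Q.
Local Notation QQ := (Q \x Q)%E.


(** Exchanging the coordinates outside [J] between two independent paths only permutes the factors
    in the probability of a pair of boxes, and such pairs form a generating system closed under
    intersection. The properties of [CE] rest on this symmetry. *)
Lemma swap_coords_preserving J (A : set (S * S)) : measurable A ->
  distribution QQ (swap_coords J) A = QQ A.
Proof.
move=> mA.
apply: (measure_unique (@box_system d T) (fun=> setT)) => //.
- exact: measurable_box_system.
- exact: box_system_setI.
- move=> _; exists 0%N, (fun=> setT), (fun=> setT); split => //.
  by rewrite -setXTT; congr (_ `*` _); apply/seteqP; split.
- by apply/seteqP; split => // x _; exists 0%N.
- move=> _ [n [B [C [mB mC ->]]]].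
  pose B' i := if J i then B i else C i.
  pose C' i := if J i then C i else B i.
  have mB' i : measurable (B' i) by rewrite /B'; case: ifP.
  have mC' i : measurable (C' i) by rewrite /C'; case: ifP.
  have E : swap_coords J @^-1` (box n B `*` box n C) = box n B' `*` box n C'.
    apply/seteqP; split=> -[x y] /= [h1 h2]; split=> i im;
    have := h1 i im; have := h2 i im; rewrite /= /splice /B' /C'; by case: (J i).
  transitivity (QQ (box n B' `*` box n C')); first by rewrite -E.
  have QQbox B1 B2 : (forall i, measurable (B1 i)) -> (forall i, measurable (B2 i)) ->
      QQ (box n B1 `*` box n B2) =
      (\prod_(i < n) (Q ((fun x : S => x i) @^-1` B1 i) *
                      Q ((fun x : S => x i) @^-1` B2 i)))%E.
    move=> m1 m2; rewrite big_split /=.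
    transitivity (Q (box n B1) * Q (box n B2))%E.
      by apply: product_measure1E; exact: measurable_box.
    by congr (_ * _)%E; exact: prodQ.
  transitivity (\prod_(i < n) (Q ((fun x : S => x i) @^-1` B' i) *
                      Q ((fun x : S => x i) @^-1` C' i)))%E; first exact: QQbox.
  apply: etrans; last exact/esym/QQbox.
  apply: eq_bigr => i _.
  by rewrite /B' /C'; case: (J i) => //; rewrite muleC.
- by move=> _; rewrite (le_lt_trans (probability_le1 _ measurableT))// ltry.
Qed.

End product_law.

(** * Square-integrable functions and conditional expectations *)

Section square_integrable.
Context {d : measure_display} {U : measurableType d} {R : realType}.
Variable P : probability U R.
Implicit Types (f g : U -> R).

Definition L1 f : Prop := P.-integrable setT (EFin \o f).

(** Measurability of [f] is a separate clause because it does not follow from that of its square. *)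
Definition sqint f : Prop :=
  measurable_fun setT f /\ L1 (fun x => f x ^+ 2).

Lemma L1_measurable f : L1 f -> measurable_fun setT f.
Proof. by move=> /measurable_int/measurable_EFinP. Qed.

Lemma EFin_Rintegral f : L1 f ->
  (\int[P]_x (f x)%:E = (\int[P]_x f x)%:E)%E.
Proof. by move=> hf; rewrite /Rintegral fineK// (integrable_fin_num _ hf). Qed.

Lemma L1_le f g : measurable_fun setT f -> L1 g -> (forall x, `|f x| <= g x) -> L1 f.
Proof.
move=> mf hg fg; apply: le_integrable hg => //; first exact/measurable_EFinP.
by move=> x _ /=; rewrite lee_fin; apply: (le_trans (fg x)); exact: ler_norm.
Qed.

Lemma L1_cst c : L1 (fun=> c).
Proof. exact: finite_measure_integrable_cst. Qed.

Lemma L1D f g : L1 f -> L1 g -> L1 (fun x => f x + g x).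
Proof. exact: integrableD. Qed.

Lemma L1B f g : L1 f -> L1 g -> L1 (fun x => f x - g x).
Proof. exact: integrableB. Qed.

Lemma L1Z c f : L1 f -> L1 (fun x => c * f x).
Proof. exact: integrableZl. Qed.

Lemma L1_norm f : L1 f -> L1 (fun x => `|f x|).
Proof. exact: integrable_norm. Qed.

Lemma L1_sum (I : Type) (s : seq I) (f : I -> U -> R) :
  (forall i, L1 (f i)) -> L1 (fun x => \sum_(i <- s) f i x).
Proof.
move=> hf; elim: s => [|i s IH].
  by under eq_fun do rewrite big_nil; exact: L1_cst.
by under eq_fun do rewrite big_cons; exact: L1D.
Qed.

Lemma ge0_L1P f : measurable_fun setT f -> (forall x, 0 <= f x) ->
  (\int[P]_x (f x)%:E < +oo)%E -> L1 f.
Proof.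
move=> mf f0 foo; apply/integrableP; split; first exact/measurable_EFinP.
by under eq_integral => x _ do rewrite /= ger0_norm//.
Qed.

Lemma Rintegral_ae_eq f g : measurable_fun setT f -> measurable_fun setT g ->
  {ae P, forall x, f x = g x} -> \int[P]_x f x = \int[P]_x g x.
Proof.
move=> mf mg fg; rewrite /Rintegral; congr fine.
apply: ae_eq_integral => //; [exact/measurable_EFinP|exact/measurable_EFinP|].
by apply: filterS fg => x /= -> _.
Qed.

Lemma L1_ae_eq f g : measurable_fun setT g ->
  {ae P, forall x, f x = g x} -> L1 f -> L1 g.
Proof.
move=> mg fg hf; have mf := L1_measurable hf.
move/integrableP: hf => [_ foo]; apply/integrableP; split; first exact/measurable_EFinP.
rewrite (@ae_eq_integral _ _ _ _ setT (fun x => `|(f x)%:E|%E))//.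
- by apply/measurable_EFinP; exact: measurableT_comp.
- by apply/measurable_EFinP; exact: measurableT_comp.
- by apply: filterS fg => x /= -> _.
Qed.

Lemma Rintegral_cst_prob c : \int[P]_x c = c.
Proof. by rewrite Rintegral_cst// [X in fine X](@probability_setT _ _ _ P) mulr1. Qed.

Lemma sqint_L1 f : sqint f -> L1 f.
Proof.
move=> [mf hf]; apply: (L1_le mf (L1D (L1_cst 1) hf)) => x.
rewrite -[in f x ^+ 2]real_normK ?num_real//; set y := `|f x|.
by have : 0 <= (y - 1) ^+ 2 := sqr_ge0 _; nra.
Qed.

Lemma sqint_mul f g : sqint f -> sqint g -> L1 (fun x => f x * g x).
Proof.
move=> [mf hf] [mg hg].
apply: (L1_le _ (L1D hf hg)) => [|x]; first exact: measurable_funM.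
rewrite ler_norml; apply/andP; split.
  by have := sqr_ge0 (f x + g x); have := sqr_ge0 (f x); have := sqr_ge0 (g x); nra.
by have := sqr_ge0 (f x - g x); have := sqr_ge0 (f x); have := sqr_ge0 (g x); nra.
Qed.

Lemma sqint_le f g : measurable_fun setT f -> sqint g ->
  (forall x, `|f x| <= `|g x|) -> sqint f.
Proof.
move=> mf [mg hg] fg; split => //; apply: (L1_le _ hg) => [|x].
  exact: measurable_funX.
rewrite ger0_norm ?sqr_ge0// -[leLHS]real_normK ?num_real//.
by rewrite -[leRHS]real_normK ?num_real// ler_sqr ?nnegrE.
Qed.

Lemma sqintD f g : sqint f -> sqint g -> sqint (fun x => f x + g x).
Proof.
move=> hf hg; have [mf if_] := hf; have [mg ig] := hg; split.
  exact: measurable_funD.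
have := L1D (L1D if_ ig) (L1Z 2 (sqint_mul hf hg)).
by congr L1; apply/funext => x; ring.
Qed.

Lemma sqintZ c f : sqint f -> sqint (fun x => c * f x).
Proof.
move=> [mf hf]; split; first exact: measurable_funM.
by have := L1Z (c ^+ 2) hf; congr L1; apply/funext => x; ring.
Qed.

Lemma sqintB f g : sqint f -> sqint g -> sqint (fun x => f x - g x).
Proof.
move=> hf hg; have := sqintD hf (sqintZ (-1) hg).
by congr sqint; apply/funext => x; rewrite mulN1r.
Qed.

Lemma sqint_bounded f C : measurable_fun setT f -> (forall x, `|f x| <= C) -> sqint f.
Proof.
move=> mf fC; apply: (@sqint_le _ (fun=> C)) => //.
  by split => //; exact: L1_cst.
by move=> x; apply: (le_trans (fC x)); exact: ler_norm.
Qed.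

Lemma sqint_cst c : sqint (fun=> c).
Proof. exact: (@sqint_bounded _ `|c|). Qed.

Lemma sqint_mul_bounded f g C : measurable_fun setT g -> (forall x, `|g x| <= C) ->
  sqint f -> sqint (fun x => g x * f x).
Proof.
move=> mg gC hf; apply: sqint_le (sqintZ C hf) _ => [|x].
  by case: hf => mf _; exact: measurable_funM.
rewrite !normrM ler_wpM2r//; apply: le_trans (gC x) _; exact: ler_norm.
Qed.

Lemma sqint_norm f : sqint f -> sqint (fun x => `|f x|).
Proof.
move=> hf; have [mf _] := hf; apply: sqint_le hf _ => [|x]; last by rewrite normr_id.
exact: measurableT_comp.
Qed.

(* Jensen, from the tangent line of the convex function at the mean. *)
Lemma jensen_sqr f : measurable_fun setT f ->
  (((\int[P]_x f x) ^+ 2)%:E <= \int[P]_x (f x ^+ 2)%:E)%E.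
Proof.
move=> mf.
have [foo|] := ltP (\int[P]_x (f x ^+ 2)%:E)%E +oo%E; last first.
  by rewrite leye_eq => /eqP ->; rewrite leey.
have hf : sqint f.
  split => //; apply: ge0_L1P => // [|x]; [exact: measurable_funX|exact: sqr_ge0].
rewrite EFin_Rintegral; last by case: hf.
rewrite lee_fin; set m := \int[P]_x f x.
have h : L1 (fun x => 2 * m * f x - m ^+ 2).
  by apply: L1B; [exact/L1Z/sqint_L1|exact: L1_cst].
have : \int[P]_x (2 * m * f x - m ^+ 2) <= \int[P]_x (f x ^+ 2).
  apply: le_Rintegral => //; first by case: hf.
  by move=> x _; have := sqr_ge0 (f x - m); nra.
rewrite RintegralB//; [|exact/L1Z/sqint_L1|exact: L1_cst].
rewrite RintegralZl//; last exact: sqint_L1.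
by rewrite Rintegral_cst_prob -/m; apply: le_trans; nra.
Qed.

(** Only measurability is assumed and the right-hand side may be infinite, so the inequality applies
    to every section of a function of two paths, not just to almost every one. The tangent to the
    cube at [m] is used on the half-line of nonnegative numbers. *)
Lemma jensen_cube f : measurable_fun setT f ->
  ((`|\int[P]_x f x| ^+ 3)%:E <= \int[P]_x (`|f x| ^+ 3)%:E)%E.
Proof.
move=> mf.
have mnf : measurable_fun setT (fun x => `|f x|) by exact: measurableT_comp.
have [foo|] := ltP (\int[P]_x (`|f x| ^+ 3)%:E)%E +oo%E; last first.
  by rewrite leye_eq => /eqP ->; rewrite leey.
have h3 : L1 (fun x => `|f x| ^+ 3).
  by apply: ge0_L1P => //; exact: measurable_funX.
have h1 : L1 f.
  apply: (L1_le mf (L1D (L1_cst 1) h3)) => x.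
  have := normr_ge0 (f x); set y := `|f x| => y0.
  have [y1|y1] := leP y 1; first by have := exprn_ge0 3 y0; lra.
  have : 0 <= y * (y - 1) * (y + 1) by rewrite !mulr_ge0//; lra.
  by nra.
rewrite EFin_Rintegral// lee_fin.
set m := `|\int[P]_x f x|.
have m0 : 0 <= m by exact: normr_ge0.
have mle : m <= \int[P]_x `|f x| by exact: le_normr_Rintegral.
have h : L1 (fun x => 3 * m ^+ 2 * `|f x| - 2 * m ^+ 3).
  by apply: L1B; [exact/L1Z/L1_norm|exact: L1_cst].
have : \int[P]_x (3 * m ^+ 2 * `|f x| - 2 * m ^+ 3) <= \int[P]_x (`|f x| ^+ 3).
  apply: le_Rintegral => // x _.
  have y0 := normr_ge0 (f x); set y := `|f x| in y0 *.
  rewrite -subr_ge0.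
  have -> : y ^+ 3 - (3 * m ^+ 2 * y - 2 * m ^+ 3) = (y - m) ^+ 2 * (y + 2 * m) by ring.
  by rewrite mulr_ge0 ?sqr_ge0// addr_ge0// mulr_ge0.
rewrite RintegralB//; [|exact/L1Z/L1_norm|exact: L1_cst].
rewrite RintegralZl//; last exact: L1_norm.
rewrite Rintegral_cst_prob; apply: le_trans.
have m2 : 0 <= 3 * m ^+ 2 by rewrite mulr_ge0// sqr_ge0.
by have := ler_wpM2l m2 mle; nra.
Qed.

End square_integrable.

(** * Conditional expectation by integrating out coordinates *)

Section conditional_expectation_operator.
Context {d : measure_display} {T : measurableType d} {R : realType}.
Local Notation S := (seq_space T).
Variable Q : probability S R.
Hypothesis prodQ : product_law Q.
Local Notation QQ := (Q \x Q)%E.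
Implicit Types (J K : pred nat) (phi psi : S -> R).

Lemma ge0_integral_swap_coords J (u : S * S -> \bar R) :
  measurable_fun setT u -> (forall p, 0 <= u p)%E ->
  (\int[QQ]_p u (swap_coords J p) = \int[QQ]_p u p)%E.
Proof.
move=> mu u0.
transitivity (\int[distribution QQ (swap_coords J)]_p u p)%E.
  by rewrite ge0_integral_distribution.
by apply: eq_measure_integral => A mA _; exact: swap_coords_preserving.
Qed.

Lemma L1_swap_coords J (u : S * S -> R) : L1 QQ u -> L1 QQ (u \o swap_coords J).
Proof.
move=> hu; have mu := L1_measurable hu.
have ms : measurable_fun setT (u \o swap_coords J).
  exact: measurableT_comp mu (measurable_swap_coords J).
move/integrableP: hu => [_ uoo]; apply/integrableP; split; first exact/measurable_EFinP.
rewrite (ge0_integral_swap_coords J (u := fun p => `|(u p)%:E|%E))//.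
by apply/measurable_EFinP; exact: measurableT_comp.
Qed.

Lemma Rintegral_swap_coords J (u : S * S -> R) : L1 QQ u ->
  \int[QQ]_p u (swap_coords J p) = \int[QQ]_p u p.
Proof.
move=> hu; rewrite /Rintegral; congr fine.
have mu := L1_measurable hu.
transitivity (\int[distribution QQ (swap_coords J)]_p (u p)%:E)%E.
  rewrite integral_distribution//; first exact/measurable_EFinP.
  exact: L1_swap_coords.
by apply: eq_measure_integral => A mA _; exact: swap_coords_preserving.
Qed.

Lemma ge0_integral_fst (u : S -> \bar R) : measurable_fun setT u ->
  (forall x, 0 <= u x)%E -> (\int[QQ]_p u p.1 = \int[Q]_x u x)%E.
Proof.
move=> mu u0; rewrite (fubini_tonelli1 (fun p : S * S => u p.1))//=; last first.
  exact: measurableT_comp.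
rewrite /fubini_F /=; apply: eq_integral => x _.
by rewrite integral_cst// [X in (_ * X)%E](@probability_setT _ _ _ Q) mule1.
Qed.

Lemma L1_fst phi : L1 Q phi -> L1 QQ (fun p => phi p.1).
Proof.
move=> hphi; have mphi := L1_measurable hphi.
have mf : measurable_fun setT (fun p : S * S => phi p.1) by exact: measurableT_comp.
move/integrableP: hphi => [_ oo]; apply/integrableP; split; first exact/measurable_EFinP.
rewrite (@ge0_integral_fst (fun x => `|(phi x)%:E|%E))//.
by apply/measurable_EFinP; exact: measurableT_comp.
Qed.

Lemma measurable_comp_splice J phi : measurable_fun setT phi ->
  measurable_fun setT (fun p : S * S => phi (splice J p.1 p.2)).
Proof. by move=> mphi; exact: measurableT_comp mphi (measurable_splice J). Qed.

Lemma ge0_integral_splice J (u : S -> \bar R) : measurable_fun setT u ->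
  (forall x, 0 <= u x)%E ->
  (\int[Q]_x \int[Q]_y u (splice J x y) = \int[Q]_x u x)%E.
Proof.
move=> mu u0.
have ms : measurable_fun setT (fun p : S * S => u (splice J p.1 p.2)).
  exact: measurableT_comp mu (measurable_splice J).
transitivity (\int[QQ]_p u (splice J p.1 p.2))%E.
  by rewrite (fubini_tonelli1 (fun p : S * S => u (splice J p.1 p.2))).
transitivity (\int[QQ]_p u p.1)%E; last exact: ge0_integral_fst.
apply: (ge0_integral_swap_coords J (u := fun p => u p.1)) => //.
exact: measurableT_comp.
Qed.

Lemma L1_splice J phi : L1 Q phi -> L1 QQ (fun p => phi (splice J p.1 p.2)).
Proof. by move=> /L1_fst/(@L1_swap_coords J). Qed.

Lemma Fubini_Rintegral (u : S * S -> R) (I := fun x => \int[Q]_y u (x, y)) :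
  L1 QQ u -> [/\ L1 Q I, \int[Q]_x I x = \int[QQ]_p u p &
                 {ae Q, forall x, L1 Q (fun y => u (x, y))}].
Proof.
move=> hu; have ae := ae_integrable1 hu.
have iF := integrable_fubini_F hu.
have mF := measurable_fubini_F hu.
have aeI : ae_eq Q setT (EFin \o I) (fubini_F Q (EFin \o u)).
  apply: filterS ae => x /= ix _; rewrite /I /fubini_F/= EFin_Rintegral//.
have mI : measurable_fun setT I by exact: measurableT_comp mF.
split => //.
  apply/integrableP; split; first exact/measurable_EFinP.
  move/integrableP: (iF) => [_]; apply: le_lt_trans.
  apply: ge0_le_integral => //.
  - by apply/measurable_EFinP; exact: measurableT_comp.
  - exact: measurableT_comp.
  - move=> x _; rewrite /I /fubini_F /Rintegral /=.
    by case: (integral _ _ _) => [r||] //=; rewrite normr0 leey.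
rewrite /Rintegral -(integral12_prod_meas1 hu); congr fine.
by apply: ae_eq_integral => //; exact/measurable_EFinP.
Qed.

(* The conditional expectation given the coordinates in [J]; it is [0] at the
   (negligible) paths where the integral diverges. *)
Definition CE J phi : S -> R := fun x => \int[Q]_y phi (splice J x y).

Lemma L1_CE J phi : L1 Q phi -> L1 Q (CE J phi).
Proof. by move=> /(@L1_splice J)/Fubini_Rintegral[]. Qed.

Lemma ae_L1_splice J phi : L1 Q phi ->
  {ae Q, forall x, L1 Q (fun y => phi (splice J x y))}.
Proof. by move=> /(@L1_splice J)/Fubini_Rintegral[]. Qed.

Lemma Rintegral_splice J phi : L1 Q phi ->
  \int[QQ]_p phi (splice J p.1 p.2) = \int[Q]_x phi x.
Proof.
move=> hphi.
rewrite (Rintegral_swap_coords J (u := fun p => phi p.1)); last exact: L1_fst.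
have [_ <- _] := Fubini_Rintegral (L1_fst hphi).
by rewrite /=; under eq_Rintegral do rewrite Rintegral_cst_prob.
Qed.

Lemma Rintegral_CE J phi : L1 Q phi -> \int[Q]_x CE J phi x = \int[Q]_x phi x.
Proof.
move=> hphi; rewrite -(Rintegral_splice J hphi).
by have [_ <-] := Fubini_Rintegral (L1_splice J hphi).
Qed.

(** Fubini for two paths that agree on [J] and are independent elsewhere. Only the product has to be
    integrable, so indicator functions and cubic expressions outside L2 are covered as well. *)
Lemma CE_mul J phi psi : L1 Q phi -> measurable_fun setT psi ->
  L1 QQ (fun p => phi (splice J p.1 p.2) * psi p.1) ->
  L1 Q (fun x => CE J phi x * psi x) /\
  \int[Q]_x (CE J phi x * psi x) = \int[QQ]_p (phi (splice J p.1 p.2) * psi p.1).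
Proof.
move=> hphi mpsi hu; have [LI <- _] := Fubini_Rintegral hu.
have mC := L1_measurable (L1_CE J hphi).
have mCp : measurable_fun setT (fun x => CE J phi x * psi x) by exact: measurable_funM.
have ae : {ae Q, forall x, \int[Q]_y (phi (splice J x y) * psi x) = CE J phi x * psi x}.
  apply: filterS (ae_L1_splice J hphi) => x hx.
  by rewrite RintegralZr.
split; first by apply: L1_ae_eq ae LI.
apply/esym/Rintegral_ae_eq => //.
exact: L1_measurable LI.
Qed.

Lemma sqint_splice J phi : sqint Q phi -> sqint QQ (fun p => phi (splice J p.1 p.2)).
Proof.
move=> [mphi hphi]; split; first exact: measurable_comp_splice.
exact: (L1_splice J hphi).
Qed.

Lemma sqint_fst phi : sqint Q phi -> sqint QQ (fun p => phi p.1).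
Proof.
move=> [mphi hphi]; split; first exact: measurableT_comp.
exact: (L1_fst hphi).
Qed.

Lemma sqint_CE_mul J phi psi : sqint Q phi -> sqint Q psi ->
  \int[Q]_x (CE J phi x * psi x) = \int[QQ]_p (phi (splice J p.1 p.2) * psi p.1).
Proof.
move=> hphi hpsi; have [|//|_ ->//] := @CE_mul J phi psi (sqint_L1 hphi).
  by case: hpsi.
by apply: sqint_mul; [exact: sqint_splice|exact: sqint_fst].
Qed.

(** Both sides are integrals over pairs of paths with common coordinates in [J], and [swap_coords]
    exchanges the two members of the pair. *)
Lemma CE_selfadjoint J phi psi : sqint Q phi -> sqint Q psi ->
  \int[Q]_x (CE J phi x * psi x) = \int[Q]_x (phi x * CE J psi x).
Proof.
move=> hphi hpsi; rewrite sqint_CE_mul//.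
under [RHS]eq_Rintegral do rewrite mulrC.
rewrite sqint_CE_mul//.
rewrite -[RHS](Rintegral_swap_coords J (u := fun p => psi (splice J p.1 p.2) * phi p.1)).
  by apply: eq_Rintegral => p _; rewrite /= splice_swap mulrC.
by apply: sqint_mul; [exact: sqint_splice|exact: sqint_fst].
Qed.

Lemma measurable_splice_section J phi x : measurable_fun setT phi ->
  measurable_fun setT (fun y => phi (splice J x y)).
Proof. by move=> mphi; exact: measurableT_comp mphi (measurable_splice_l J x). Qed.

Lemma integral_CE_sqr_le J phi : sqint Q phi ->
  (\int[Q]_x (CE J phi x ^+ 2)%:E <= \int[Q]_x (phi x ^+ 2)%:E)%E.
Proof.
move=> hphi; have [mphi iphi] := hphi.
have mC := L1_measurable (L1_CE J (sqint_L1 hphi)).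
have mp2 : measurable_fun setT (fun x => phi x ^+ 2) by exact: measurable_funX.
have mu : measurable_fun setT (fun x => (phi x ^+ 2)%:E) by exact/measurable_EFinP.
rewrite -(ge0_integral_splice J mu)/=; last by move=> x; rewrite lee_fin sqr_ge0.
apply: ge0_le_integral => //.
- by move=> x _; rewrite lee_fin sqr_ge0.
- by apply/measurable_EFinP; exact: measurable_funX.
- apply: (measurable_fun_fubini_tonelli_F (fun p => (phi (splice J p.1 p.2) ^+ 2)%:E)) => //=.
    apply/measurable_EFinP; exact: (measurable_comp_splice J mp2).
  by move=> p; rewrite lee_fin sqr_ge0.
- by move=> x _; apply: jensen_sqr; exact: measurable_splice_section.
Qed.

Lemma sqint_CE J phi : sqint Q phi -> sqint Q (CE J phi).
Proof.
move=> hphi; have mC := L1_measurable (L1_CE J (sqint_L1 hphi)).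
split => //; apply: ge0_L1P => [|x|]; [exact: measurable_funX|exact: sqr_ge0|].
apply: le_lt_trans (integral_CE_sqr_le J hphi) _.
by rewrite EFin_Rintegral ?ltry//; case: hphi.
Qed.

Lemma CE_sqr_le J phi : sqint Q phi ->
  \int[Q]_x (CE J phi x ^+ 2) <= \int[Q]_x (phi x ^+ 2).
Proof.
move=> hphi; have [_ h1] := sqint_CE J hphi; have [_ h2] := hphi.
by have := integral_CE_sqr_le J hphi; rewrite !EFin_Rintegral// lee_fin.
Qed.

Lemma integral_CE_cube_le J phi : L1 Q phi ->
  (\int[Q]_x (`|CE J phi x| ^+ 3)%:E <= \int[Q]_x (`|phi x| ^+ 3)%:E)%E.
Proof.
move=> hphi; have mphi := L1_measurable hphi.
have mC := L1_measurable (L1_CE J hphi).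
have mp2 : measurable_fun setT (fun x => `|phi x| ^+ 3).
  by apply: measurable_funX; exact: measurableT_comp.
have mu : measurable_fun setT (fun x => (`|phi x| ^+ 3)%:E) by exact/measurable_EFinP.
rewrite -(ge0_integral_splice J mu)/=; last by move=> x; rewrite lee_fin exprn_ge0.
apply: ge0_le_integral => //.
- by apply/measurable_EFinP; apply: measurable_funX; exact: measurableT_comp.
- apply: (measurable_fun_fubini_tonelli_F (fun p => (`|phi (splice J p.1 p.2)| ^+ 3)%:E)) => //=.
  apply/measurable_EFinP; exact: (measurable_comp_splice J mp2).
- by move=> x _; apply: jensen_cube; exact: measurable_splice_section.
Qed.

(** Independence of the coordinates makes two conditionings compose to the one on the common
    coordinates, for arbitrary [J] and [K] and not only for nested ones. *)
Lemma CE_tower J K phi : L1 Q phi ->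
  {ae Q, forall x, CE J (CE K phi) x = CE (fun k => J k && K k) phi x}.
Proof.
move=> hphi; apply: filterS (ae_L1_splice (fun k => J k && K k) hphi) => x hx.
rewrite {1}/CE -[RHS](Rintegral_CE K hx); apply: eq_Rintegral => y _.
by rewrite /CE; apply: eq_Rintegral => z _; rewrite splice_splice.
Qed.

Lemma CEB J phi psi : L1 Q phi -> L1 Q psi ->
  {ae Q, forall x, CE J (fun x => phi x - psi x) x = CE J phi x - CE J psi x}.
Proof.
move=> hphi hpsi; move: (ae_L1_splice J hphi) (ae_L1_splice J hpsi).
by apply: filterS2 => x h1 h2; rewrite /CE RintegralB.
Qed.

Lemma CE_dependent J phi x : (forall x y, phi (splice J x y) = phi x) -> CE J phi x = phi x.
Proof.
by move=> h; rewrite /CE; under eq_Rintegral do rewrite h; rewrite Rintegral_cst_prob.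
Qed.

Lemma CE_splice J phi x y : CE J phi (splice J x y) = CE J phi x.
Proof. by apply: eq_Rintegral => z _; rewrite splice_left. Qed.

Lemma CE_none phi x : CE xpred0 phi x = \int[Q]_y phi y.
Proof. by apply: eq_Rintegral. Qed.

End conditional_expectation_operator.

(** * Martingale differences *)

Section martingale_convergence.
Context {d : measure_display} {T : measurableType d} {R : realType}.
Local Notation S := (seq_space T).
Variable Q : probability S R.
Hypothesis prodQ : product_law Q.
Implicit Types (phi psi : S -> R).

Definition CEn n := CE Q (fun k => (k < n)%N).

Definition CEn_error n phi : R := \int[Q]_x ((phi x - CEn n phi x) ^+ 2).

Definition CEn_cvg phi : Prop :=
  sqint Q phi /\ forall e, 0 < e -> exists N, forall n, (N <= n)%N -> CEn_error n phi <= e.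

Lemma sqint_CEn_diff n phi : sqint Q phi -> sqint Q (fun x => phi x - CEn n phi x).
Proof. by move=> h; apply: sqintB => //; exact: sqint_CE. Qed.

Lemma CE_comb J (a : R) phi psi : L1 Q phi -> L1 Q psi ->
  {ae Q, forall x, CE Q J (fun x => a * phi x + psi x) x = a * CE Q J phi x + CE Q J psi x}.
Proof.
move=> hphi hpsi; move: (ae_L1_splice prodQ J hphi) (ae_L1_splice prodQ J hpsi).
apply: filterS2 => x h1 h2; rewrite /CE RintegralD//; last exact: L1Z.
by rewrite RintegralZl.
Qed.

Lemma CEn_error_comb n (a : R) phi psi : sqint Q phi -> sqint Q psi ->
  CEn_error n (fun x => a * phi x + psi x) <=
  2 * a ^+ 2 * CEn_error n phi + 2 * CEn_error n psi.
Proof.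
move=> hphi hpsi.
have hs : sqint Q (fun x => a * phi x + psi x) by apply: sqintD => //; exact: sqintZ.
have [m1 d1] := sqint_CEn_diff n hphi; have [m2 d2] := sqint_CEn_diff n hpsi.
have [m3 d3] := sqint_CEn_diff n hs.
rewrite /CEn_error -!RintegralZl// -RintegralD//; [|exact: L1Z..].
rewrite (@Rintegral_ae_eq _ _ _ Q _ (fun x => (a * (phi x - CEn n phi x) +
    (psi x - CEn n psi x)) ^+ 2)).
- apply: le_Rintegral => //.
  + apply: (@L1_ae_eq _ _ _ Q _ _ _ _ d3).
      apply: measurable_funX; apply: measurable_funD => //.
      exact: measurable_funM.
    apply: filterS (CE_comb (fun k => (k < n)%N) a (sqint_L1 hphi) (sqint_L1 hpsi)).
    by move=> x E; rewrite /CEn E; ring.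
  + by apply: L1D; exact: L1Z.
  + by move=> x _; have := sqr_ge0 (a * (phi x - CEn n phi x) - (psi x - CEn n psi x)); nra.
- exact: measurable_funX.
- apply: measurable_funX; apply: measurable_funD => //.
  exact: measurable_funM.
- apply: filterS (CE_comb (fun k => (k < n)%N) a (sqint_L1 hphi) (sqint_L1 hpsi)).
  by move=> x E; rewrite /CEn E; ring.
Qed.

Lemma CEn_error_le n phi : sqint Q phi ->
  CEn_error n phi <= 4 * \int[Q]_x (phi x ^+ 2).
Proof.
move=> hphi; have [m1 d1] := sqint_CEn_diff n hphi; have [m2 d2] := hphi.
have [m3 d3] := sqint_CE prodQ (fun k => (k < n)%N) hphi.
have h := CE_sqr_le prodQ (fun k => (k < n)%N) hphi.
apply: (@le_trans _ _ (2 * \int[Q]_x (phi x ^+ 2) + 2 * \int[Q]_x (CEn n phi x ^+ 2))).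
  rewrite -!RintegralZl// -RintegralD//; [|exact: L1Z..].
  apply: le_Rintegral => //; first by apply: L1D; exact: L1Z.
  by move=> x _; have := sqr_ge0 (phi x + CEn n phi x); nra.
by move: h; rewrite -/(CEn n phi); lra.
Qed.

Lemma CEn_cvg_comb (a : R) phi psi :
  CEn_cvg phi -> CEn_cvg psi -> CEn_cvg (fun x => a * phi x + psi x).
Proof.
move=> [hphi cphi] [hpsi cpsi]; split.
  by apply: sqintD => //; exact: sqintZ.
move=> e e0.
have D0 : 0 < 4 * (a ^+ 2 + 1) by rewrite mulr_gt0// ltr_wpDl// sqr_ge0.
have [N1 h1] := cphi _ (divr_gt0 e0 D0).
have e4 : 0 < e / 4 by rewrite divr_gt0.
have [N2 h2] := cpsi _ e4.
exists (maxn N1 N2) => n; rewrite geq_max => /andP[/h1 {}h1 /h2 {}h2].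
apply: le_trans (CEn_error_comb n a hphi hpsi) _.
have a2 : 0 <= 2 * a ^+ 2 by rewrite mulr_ge0// sqr_ge0.
have h3 : 2 * a ^+ 2 * (e / (4 * (a ^+ 2 + 1))) <= e / 2.
  rewrite mulrA ler_pdivrMr//; move: (a ^+ 2) (sqr_ge0 a) => b b0.
  have -> : e / 2 * (4 * (b + 1)) = 2 * b * e + 2 * e by field.
  by rewrite lerDl mulr_ge0// ltW.
have h4 := le_trans (ler_wpM2l a2 h1) h3.
have h5 := ler_wpM2l (ler0n R 2) h2.
apply: le_trans (lerD h4 h5) _.
by have -> : e / 2 + 2 * (e / 4) = e by field.
Qed.

(** By [CEn_error_le] the error of [phi - psi] is small uniformly in [n], so the class is closed in
    L2. The constants add up as [2 * (e / 4) + 2 * (4 * (e / 16)) = e]. *)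
Lemma CEn_cvg_approx phi : sqint Q phi ->
  (forall e, 0 < e -> exists2 psi, CEn_cvg psi & \int[Q]_x ((phi x - psi x) ^+ 2) <= e) ->
  CEn_cvg phi.
Proof.
move=> hphi h; split => // e e0.
have e16 : 0 < e / 16 by rewrite divr_gt0.
have [psi [hpsi cpsi] le] := h _ e16.
have e4 : 0 < e / 4 by rewrite divr_gt0.
have [N hN] := cpsi _ e4.
exists N => n /hN {}hN.
have -> : phi = (fun x => 1 * psi x + (phi x - psi x)) by apply/funext => x; ring.
have hd := sqintB hphi hpsi.
apply: le_trans (CEn_error_comb n 1 hpsi hd) _.
have h2 := le_trans (CEn_error_le n hd) (ler_wpM2l (ler0n R 4) le).
have h3 := lerD (ler_wpM2l (ler0n R 2) hN) (ler_wpM2l (ler0n R 2) h2).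
rewrite expr1n mulr1; apply: le_trans h3 _.
by have -> : 2 * (e / 4) + 2 * (4 * (e / 16)) = e by field.
Qed.

Lemma CEn_cvg_dominated phi (psi : nat -> S -> R) : sqint Q phi ->
  (forall m, CEn_cvg (psi m)) -> (forall m x, `|phi x - psi m x| <= `|phi x|) ->
  (forall x, exists m0, forall m, (m0 <= m)%N -> psi m x = phi x) -> CEn_cvg phi.
Proof.
move=> hphi cpsi dom ev; apply: CEn_cvg_approx => // e e0.
have [mphi iphi] := hphi.
have hd m : sqint Q (fun x => phi x - psi m x).
  by apply: sqintB => //; case: (cpsi m).
have [|||||_ _] := @dominated_convergence _ _ _ Q setT measurableT
  (fun m x => ((phi x - psi m x) ^+ 2)%:E) (cst 0%E) (fun x => (phi x ^+ 2)%:E).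
- by move=> m; have [? _] := hd m; apply/measurable_EFinP; exact: measurable_funX.
- exact: measurable_cst.
- apply: aeW => x _; have [m0 hm0] := ev x.
  apply: cvg_near_cst; near=> m.
  rewrite hm0 ?subrr ?expr0n//; near: m; exact: nbhs_infty_ge.
- exact: iphi.
- apply: aeW => x m _; rewrite /= lee_fin ger0_norm ?sqr_ge0//.
  by rewrite -[leLHS]real_normK ?num_real// -[leRHS]real_normK ?num_real// ler_sqr ?nnegrE.
rewrite integral0 => /fine_cvgP[_] /cvgr0Pnorm_le/(_ _ e0)[m _ /(_ m (leqnn m))].
rewrite /= => hm; exists (psi m) => //; apply: le_trans hm; exact: ler_norm.
Unshelve. all: by end_near. Qed.

Definition cylinder_boxes : set (set S) :=
  [set A | exists n B, (forall i, measurable (B i)) /\ A = box n B].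

Lemma measurable_cylinder_boxes : @measurable _ S = <<s cylinder_boxes >>.
Proof.
apply/seteqP; split; last first.
  apply: smallest_sub; first exact: sigma_algebra_measurable.
  by move=> _ [n [B [mB ->]]]; exact: measurable_box.
apply: sub_sigma_algebra2 => _ [i [B mB ->]].
exists i.+1, (fun k => if k == i then B else setT); split.
  by move=> k; case: ifP.
apply/seteqP; split=> [x Bx k _|x /(_ i)]; last by rewrite eqxx; exact.
by case: eqP => // ->.
Qed.

(** Dynkin induction from boxes: a box on [n] coordinates is fixed by [CEn m] as soon as [n <= m],
    complements are linear combinations, and the indicator of a disjoint union is a dominated limit
    of finite sums. *)
Lemma CEn_cvg_indic (A : set S) : measurable A -> CEn_cvg (\1_A).
Proof.
have sqi (B : set S) : measurable B -> sqint Q (\1_B).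
  move=> mB; apply: (@sqint_bounded _ _ _ Q _ 1) => [|x]; first exact: measurable_indic.
  by rewrite indicE; case: (_ \in _); rewrite ?normr1 ?normr0.
have cvgbox n (B : nat -> set T) : (forall i, measurable (B i)) -> CEn_cvg (\1_(box n B)).
  move=> mB; split; first by apply: sqi; exact: measurable_box.
  move=> e e0; exists n => m nm; rewrite /CEn_error.
  rewrite (@eq_Rintegral _ _ _ Q setT (fun=> 0)); first by rewrite Rintegral_cst_prob ltW.
  move=> x _; rewrite /CEn CE_dependent ?subrr ?expr0n// => {}x y.
  rewrite !indicE; congr ((nat_of_bool _)%:R); apply/idP/idP; rewrite !inE => h i im.
    by have := h i im; rewrite /splice (leq_trans im nm).
  by rewrite /splice (leq_trans im nm); exact: h.
have boxT : box 0 (fun=> setT) = setT :> set S by apply/seteqP; split.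
have cT : CEn_cvg (\1_(setT : set S)) by rewrite -boxT; exact: cvgbox.
move=> mA; apply: (@dynkin_induction _ S cylinder_boxes (fun A => CEn_cvg (\1_A))).
- exact: measurable_cylinder_boxes.
- move=> _ _ [n [B [mB ->]]] [m [C [mC ->]]]; rewrite box_setI.
  exists (maxn n m); eexists; split; last by [].
  by move=> i; apply: measurableI; case: ifP.
- exact: cT.
- by move=> _ [n [B [mB ->]]]; exact: cvgbox.
- move=> B mB cB; have := CEn_cvg_comb (-1) cB cT.
  congr CEn_cvg; apply/funext => x; rewrite !indicE in_setT in_setC.
  by case: (x \in B); rewrite /= ?mulr1 ?mulr0 ?addNr ?add0r.
- move=> F mF tF cF.
  pose G m := \bigcup_(k in [set k | (k < m)%N]) F k.
  have GS m x : \1_(G m.+1) x = 1 * \1_(G m) x + \1_(F m) x :> R.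
    rewrite mul1r !indicE; have [xF|xF] := boolP (x \in F m).
      have -> : x \in G m.+1 by rewrite inE; exists m => //=; exact: set_mem.
      have -> : (x \in G m) = false.
        apply/negbTE/negP; rewrite inE => -[k /= km Fk].
        move/trivIsetP: tF => /(_ k m I I); rewrite (ltn_eqF km) => /(_ isT).
        move/seteqP => [/(_ x) + _]; apply; split => //.
        exact: set_mem.
      by rewrite add0r.
    rewrite addr0; congr ((nat_of_bool _)%:R); apply/idP/idP; rewrite !inE.
      move=> [k /= + Fk]; rewrite ltnS leq_eqVlt => /predU1P[km|km]; last by exists k.
      by move: xF; rewrite notin_setE -km.
    by move=> [k /= km Fk]; exists k => //=; exact: ltnW.
  have cG m : CEn_cvg (\1_(G m)).
    elim: m => [|m IH].
      have -> : G 0 = ~` setT by rewrite setCT; apply/seteqP; split => // x [].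
      have := CEn_cvg_comb (-1) cT cT.
      congr CEn_cvg; apply/funext => x; rewrite !indicE in_setT in_setC in_setT.
      by rewrite /= mulN1r addNr.
    have := CEn_cvg_comb 1 IH (cF m).
    by congr CEn_cvg; apply/funext => x; rewrite GS.
  apply: (@CEn_cvg_dominated _ (fun m => \1_(G m))) => //.
  + by apply: sqi; exact: bigcup_measurable.
  + move=> m x; rewrite !indicE.
    have : (x \in G m) -> (x \in \bigcup_k F k).
      by rewrite !inE => -[k _ Fk]; exists k.
    case: (x \in G m) => [->//|_]; first by rewrite subrr normr0.
    by rewrite subr0.
  + move=> x; have [xF|xF] := pselect ((\bigcup_k F k) x).
      have [k _ Fk] := xF; exists k.+1 => m km; rewrite !indicE.
      by rewrite !mem_set//; exists k.
    exists 0%N => m _; rewrite !indicE !memNset//.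
    by move=> [k _ Fk]; apply: xF; exists k.
- by rewrite -measurable_cylinder_boxes.
Qed.

(** For a function with values in the natural numbers, finite combinations of indicators of level
    sets give its truncations, which agree with it from some rank on at each path. *)
Lemma CEn_cvg_nat (f : S -> nat) : measurable_fun setT f ->
  sqint Q (fun x => (f x)%:R) -> CEn_cvg (fun x => (f x)%:R).
Proof.
move=> mf hf.
apply: (@CEn_cvg_dominated _ (fun m x => \sum_(k < m) k%:R * \1_(f @^-1` [set nat_of_ord k]) x)) => //.
- elim=> [|m IH].
    have := CEn_cvg_indic (@measurable0 _ S).
    by congr CEn_cvg; apply/funext => x; rewrite big_ord0 indicE in_set0.
  have cI : CEn_cvg (\1_(f @^-1` [set m])).
    by apply: CEn_cvg_indic; rewrite -[_ @^-1` _]setTI; exact: mf.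
  have := CEn_cvg_comb m%:R cI IH.
  by congr CEn_cvg; apply/funext => x; rewrite big_ord_recr /= addrC.
- move=> m x.
  have -> : \sum_(k < m) k%:R * \1_(f @^-1` [set nat_of_ord k]) x =
      if (f x < m)%N then (f x)%:R else 0 :> R.
    rewrite (eq_bigr (fun k : 'I_m => if nat_of_ord k == f x then (f x)%:R else 0)); last first.
      move=> k _; rewrite indicE; case: eqP => [->|kf].
        by rewrite mem_set ?mulr1.
      by rewrite memNset ?mulr0// => /esym.
    case: ltnP => fm.
      rewrite (bigD1 (Ordinal fm))//= eqxx big1 ?addr0// => k /negPf.
      by rewrite -val_eqE /= => ->.
    by rewrite big1// => k _; case: eqP => // kf; have := ltn_ord k; rewrite kf ltnNge fm.
  by case: ifP => _; rewrite ?subrr ?normr0 ?subr0.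
- move=> x; exists (f x).+1 => m fm.
  rewrite (bigD1 (Ordinal fm))//= indicE mem_set// mulr1 big1 ?addr0// => k /negPf.
  rewrite -val_eqE /= => kf; rewrite indicE memNset ?mulr0//=.
  by move=> /esym/eqP; rewrite kf.
Qed.

Lemma CEn_weak_cvg phi psi : CEn_cvg phi -> sqint Q psi ->
  \int[Q]_x (CEn n phi x * psi x) @[n --> \oo] --> \int[Q]_x (phi x * psi x).
Proof.
move=> [hphi cphi] hpsi; apply/cvgrPdist_le => e e0.
pose C := \int[Q]_x (psi x ^+ 2).
have C0 : 0 <= C by apply: Rintegral_ge0 => x _; exact: sqr_ge0.
(* The weight [t] of the Young inequality makes the contribution of [psi] at most [e / 2], and an
   error at most [e / t] makes the other one at most [e / 2]. *)
pose t := C / e + 1.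
have t0 : 0 < t by rewrite /t ltr_wpDl// divr_ge0// ltW.
have [N hN] := cphi _ (divr_gt0 e0 t0).
exists N => // n /= /hN {}hN.
have hd := sqint_CEn_diff n hphi; have [md id] := hd; have [mpsi ipsi] := hpsi.
rewrite -RintegralB//; [|exact: sqint_mul..|]; last first.
  by apply: sqint_mul => //; exact: sqint_CE.
have ip : L1 Q (fun x => (phi x - CEn n phi x) * psi x) by exact: sqint_mul.
have E : (fun x => phi x * psi x - CEn n phi x * psi x) =
    (fun x => (phi x - CEn n phi x) * psi x) by apply/funext => x; ring.
rewrite E.
apply: le_trans (le_normr_Rintegral _ _) _ => //.
apply: (@le_trans _ _ (\int[Q]_x (t / 2 * (phi x - CEn n phi x) ^+ 2 + (2 * t)^-1 * psi x ^+ 2))).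
  apply: le_Rintegral => //; first exact: L1_norm.
    by apply: L1D; exact: L1Z.
  move=> x _; rewrite normrM; set u := _ - _.
  rewrite -[u ^+ 2]real_normK ?num_real// -[psi x ^+ 2]real_normK ?num_real//.
  set y := `|u|; set z := `|psi x|.
  rewrite -subr_ge0.
  have -> : t / 2 * y ^+ 2 + (2 * t)^-1 * z ^+ 2 - y * z = (2 * t)^-1 * (t * y - z) ^+ 2.
    by field; rewrite gt_eqF.
  by rewrite mulr_ge0 ?sqr_ge0// invr_ge0 mulr_ge0// ltW.
rewrite RintegralD//; [|exact: L1Z..].
rewrite !RintegralZl// -/C -/(CEn_error n phi).
have h1 : t / 2 * CEn_error n phi <= e / 2.
  have := ler_wpM2l (ltW t0) hN; rewrite [t * (e / t)]mulrC divfK ?gt_eqF//; lra.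
have h2 : (2 * t)^-1 * C <= e / 2.
  rewrite mulrC ler_pdivrMr ?mulr_gt0//.
  have -> : e / 2 * (2 * t) = C + e by rewrite /t; field; rewrite gt_eqF.
  by rewrite lerDl ltW.
lra.
Qed.

End martingale_convergence.

(** * Covariance formula and Taylor remainders *)

Section martingale_differences.
Context {d : measure_display} {T : measurableType d} {R : realType}.
Local Notation S := (seq_space T).
Variable Q : probability S R.
Hypothesis prodQ : product_law Q.
Local Notation QQ := (Q \x Q)%E.
Variable F : S -> R.
Hypothesis sqF : sqint Q F.

Local Notation E_ i := (CE Q (fun k => k != i)).

Definition pathD i : S -> R := fun x => F x - E_ i F x.

Definition pathV i : S -> R := CE Q (fun k => (k <= i)%N) (pathD i).

Definition increment i (p : S * S) : R := F p.1 - F (splice (fun k => k != i) p.1 p.2).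

(** The path version of twice the square of the difference operator [frakd]: the factor one half and
    the square root are dropped. *)
Definition pathd i : S -> R := fun x => \int[Q]_y (increment i (x, y) ^+ 2).

Lemma sqint_pathD i : sqint Q (pathD i).
Proof. by apply: sqintB => //; exact: sqint_CE. Qed.

Lemma sqint_pathV i : sqint Q (pathV i).
Proof. by apply: sqint_CE => //; exact: sqint_pathD. Qed.

Lemma sqint_increment i : sqint QQ (increment i).
Proof. by apply: sqintB; [exact: sqint_fst|exact: sqint_splice]. Qed.

Lemma L1_pathd i : L1 Q (pathd i).
Proof. by have [_ /Fubini_Rintegral[]] := sqint_increment i. Qed.

(** Removing [i] from the coordinates [k <= i] leaves [k < i], so the tower property sends the
    second term of [pathD] to [CEn i]. Conditioning on [k <= i] is [CEn] with index [i.+1]. *)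
Lemma pathV_martingale i :
  {ae Q, forall x, pathV i x = CEn Q i.+1 F x - CEn Q i F x}.
Proof.
have h1 := CEB prodQ (fun k => (k <= i)%N) (sqint_L1 sqF)
  (L1_CE prodQ (fun k => k != i) (sqint_L1 sqF)).
have := CE_tower prodQ (fun k => (k <= i)%N) (fun k => k != i) (sqint_L1 sqF).
have -> : (fun k => (k <= i)%N && (k != i)) = (fun k => (k < i)%N).
  by apply/funext => k; rewrite ltn_neqAle andbC.
by apply: filterS2 h1 => x + E2; rewrite E2.
Qed.

(** Conditioning on [k <= i] and on [k <> i] keeps only [k < i], for which F and its average over
    coordinate [i] have the same conditional expectation. *)
Lemma CE_pathV0 i : {ae Q, forall x, E_ i (pathV i) x = 0}.
Proof.
have LF := sqint_L1 sqF.
have h0 := CE_tower prodQ (fun k => k != i) (fun k => (k <= i)%N) (sqint_L1 (sqint_pathD i)).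
pose J k := (k != i) && (k <= i)%N.
have h1 := CEB prodQ J LF (L1_CE prodQ (fun k => k != i) LF).
have := CE_tower prodQ J (fun k => k != i) LF.
have -> : (fun k => J k && (k != i)) = J.
  by apply/funext => k; rewrite /J; case: (k != i); rewrite ?andbT ?andbF.
by move: h0 h1; apply: filterS3 => x E0 E1 E2; rewrite E0 /pathD E1 E2 subrr.
Qed.

Lemma CE_pathD0 i : {ae Q, forall x, E_ i (pathD i) x = 0}.
Proof.
have LF := sqint_L1 sqF.
have h1 := CEB prodQ (fun k => k != i) LF (L1_CE prodQ (fun k => k != i) LF).
have := CE_tower prodQ (fun k => k != i) (fun k => k != i) LF.
have -> : (fun k => (k != i) && (k != i)) = (fun k => k != i).
  by apply/funext => k; rewrite andbb.
by apply: filterS2 h1 => x E1 E2; rewrite /pathD E1 E2 subrr.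
Qed.

Lemma Rintegral_fst (u : S -> R) : L1 Q u -> \int[QQ]_p u p.1 = \int[Q]_x u x.
Proof.
move=> hu; have [_ <- _] := Fubini_Rintegral (L1_fst hu).
by rewrite /=; under eq_Rintegral do rewrite Rintegral_cst_prob.
Qed.

Lemma measurable_sqint phi : sqint Q phi -> measurable_fun setT phi.
Proof. by case. Qed.

Lemma Rintegral_ae0 (u : S -> R) : measurable_fun setT u ->
  {ae Q, forall x, u x = 0} -> \int[Q]_x u x = 0.
Proof.
move=> mu u0; rewrite (@Rintegral_ae_eq _ _ _ Q u (fun=> 0))//.
exact: Rintegral_cst_prob.
Qed.

Lemma CE_pathV_mul i phi : sqint Q phi ->
  \int[Q]_x (E_ i phi x * pathV i x) = 0.
Proof.
move=> hphi; have sV := sqint_pathV i.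
rewrite CE_selfadjoint//; apply: Rintegral_ae0.
  apply: measurable_funM; first exact: measurable_sqint.
  by apply: measurable_sqint; exact: sqint_CE.
by apply: filterS (CE_pathV0 i) => x ->; rewrite mulr0.
Qed.

Lemma Rintegral_pathD_pathV i :
  \int[Q]_x (pathD i x * pathV i x) = \int[Q]_x (F x * pathV i x).
Proof.
have sV := sqint_pathV i; have sC := sqint_CE prodQ (fun k => k != i) sqF.
have -> : (fun x => pathD i x * pathV i x) =
    (fun x => F x * pathV i x - E_ i F x * pathV i x).
  by apply/funext => x; rewrite -mulrBl.
by rewrite RintegralB//; [rewrite CE_pathV_mul// subr0|exact: sqint_mul..].
Qed.

Lemma sum_Rintegral_pathV n phi : sqint Q phi ->
  \sum_(i < n) \int[Q]_x (phi x * pathV i x) =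
  \int[Q]_x (CEn Q n F x * phi x) - (\int[Q]_x F x) * \int[Q]_x phi x.
Proof.
move=> hphi.
have sC m : sqint Q (CEn Q m F) by exact: sqint_CE.
elim: n => [|n IH].
  rewrite big_ord0.
  have -> : CEn Q 0 F = fun=> \int[Q]_x F x by apply/funext => x; exact: CE_none.
  by rewrite RintegralZl ?subrr//; exact: sqint_L1.
rewrite big_ord_recr /= IH.
rewrite (@Rintegral_ae_eq _ _ _ Q (fun x => phi x * pathV n x)
  (fun x => CEn Q n.+1 F x * phi x - CEn Q n F x * phi x)).
- have I1 := sqint_mul (sC n.+1) hphi; have I2 := sqint_mul (sC n) hphi.
  have telescope (a b c : R) : b - c + (a - b) = a - c by ring.
  by rewrite (RintegralB measurableT I1 I2); exact: telescope.
- by apply: measurable_funM; apply: measurable_sqint => //; exact: sqint_pathV.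
- by apply: measurable_funB; apply: measurable_funM; apply: measurable_sqint.
- by apply: filterS (pathV_martingale n) => x ->; ring.
Qed.

Lemma sum_pathV_cvg phi : CEn_cvg Q F -> sqint Q phi ->
  \sum_(i < n) \int[Q]_x (phi x * pathV i x) @[n --> \oo] -->
  \int[Q]_x (F x * phi x) - (\int[Q]_x F x) * \int[Q]_x phi x.
Proof.
move=> cF hphi.
under eq_fun do rewrite sum_Rintegral_pathV//.
by apply: cvgB; [exact: CEn_weak_cvg|exact: cvg_cst].
Qed.

Lemma ae_sqint_splice i :
  {ae Q, forall x, sqint Q (fun y => F (splice (fun k => k != i) x y))}.
Proof.
have [mF iF] := sqF.
apply: filterS (ae_L1_splice prodQ (fun k => k != i) iF) => x hx; split => //.
exact: measurable_splice_section.
Qed.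

Lemma ae_increment_section i : {ae Q, forall x,
  L1 Q (fun y => increment i (x, y) ^+ 2 + increment i (x, y)) /\
  \int[Q]_y (increment i (x, y) ^+ 2 + increment i (x, y)) = pathd i x + pathD i x}.
Proof.
apply: filterS (ae_sqint_splice i) => x hx.
have hc := sqint_cst Q (F x).
have hi : sqint Q (fun y => increment i (x, y)) by exact: sqintB.
have [_ hi2] := hi.
split; first by apply: L1D => //; exact: sqint_L1.
rewrite RintegralD//; last exact: sqint_L1.
congr (_ + _); rewrite /increment/= RintegralB//; [|exact: sqint_L1..].
by rewrite Rintegral_cst_prob.
Qed.

Lemma measurable_pathdD i : measurable_fun setT (fun x => (pathd i x + pathD i x) * `|pathV i x|).
Proof.
apply: measurable_funM.
  apply: measurable_funD; first exact/L1_measurable/L1_pathd.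
  by apply: measurable_sqint; exact: sqint_pathD.
by apply: measurableT_comp => //; apply: measurable_sqint; exact: sqint_pathV.
Qed.

Lemma measurable_increment_pathV i : measurable_fun setT
  (fun p : S * S => (increment i p ^+ 2 + increment i p) * `|pathV i p.1|).
Proof.
have [mi _] := sqint_increment i.
apply: measurable_funM.
  by apply: measurable_funD; [exact: measurable_funX mi|exact: mi].
have mV := measurable_sqint (sqint_pathV i).
exact: (measurableT_comp (@normr_measurable R setT) (measurableT_comp mV measurable_fst)).
Qed.

(** The trace of integrality in this section, supplied by [nat_increment_ge0]. It makes the
    remainder weight nonnegative, so that Tonelli applies even if its integral is infinite. *)
Hypothesis incr_ge0 : forall i p, 0 <= increment i p ^+ 2 + increment i p.

Lemma pathdD_ge0 i : {ae Q, forall x, 0 <= (pathd i x + pathD i x) * `|pathV i x|}.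
Proof.
apply: filterS (ae_increment_section i) => x [hx <-].
by apply: mulr_ge0 => //; apply: Rintegral_ge0 => y _; exact: incr_ge0.
Qed.

Lemma integral_pathdD i :
  (\int[QQ]_p ((increment i p ^+ 2 + increment i p) * `|pathV i p.1|)%:E =
   \int[Q]_x ((pathd i x + pathD i x) * `|pathV i x|)%:E)%E.
Proof.
have mip := measurable_increment_pathV i.
have ip0 p : (0 <= ((increment i p ^+ 2 + increment i p) * `|pathV i p.1|)%:E)%E.
  by rewrite lee_fin mulr_ge0.
have mipE : measurable_fun setT
    (fun p => ((increment i p ^+ 2 + increment i p) * `|pathV i p.1|)%:E).
  exact/measurable_EFinP.
rewrite (fubini_tonelli1 _ mipE ip0).
apply: ae_eq_integral => //.
- exact: measurable_fun_fubini_tonelli_F mipE ip0.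
- by apply/measurable_EFinP; exact: measurable_pathdD.
- apply: filterS (ae_increment_section i) => x [hx Ex] _.
  rewrite /fubini_F /=.
  under eq_integral do rewrite mulrC.
  rewrite EFin_Rintegral; last exact: L1Z.
  by rewrite RintegralZl// Ex mulrC.
Qed.

(** Both integrals are lifted to a path and its copy resampled at coordinate [i]. The term with G at
    the resampled path integrates to zero by [CE_pathV_mul], and [pathD] is the average of the
    increment, so the difference is the integral of the Taylor error [r]. Boundedness of [H] keeps
    [H * pathV] square integrable, which allows the splitting into four integrals. *)
Lemma stein_remainder i (G H : S -> R) (C : R) :
  sqint Q G -> measurable_fun setT H -> (exists B, forall x, `|H x| <= B) ->
  (forall x y, `|G x - G y - H x * (F x - F y)| <= C * ((F x - F y) ^+ 2 + (F x - F y))) ->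
  0 <= C ->
  ((`|\int[Q]_x (G x * pathV i x) - \int[Q]_x (H x * (pathD i x * pathV i x))|)%:E <=
    C%:E * \int[Q]_x ((pathd i x + pathD i x) * `|pathV i x|)%:E)%E.
Proof.
move=> sG mH [B HB] taylor C0.
have sV := sqint_pathV i; have mV := measurable_sqint sV.
have sHV : sqint Q (fun x => H x * pathV i x) by exact: sqint_mul_bounded HB sV.
pose r (p : S * S) := (G p.1 - G (splice (fun k => k != i) p.1 p.2) -
  H p.1 * (F p.1 - F (splice (fun k => k != i) p.1 p.2))) * pathV i p.1.
have a1 : L1 QQ (fun p => G p.1 * pathV i p.1).
  by apply: (L1_fst (phi := fun x => G x * pathV i x)); exact: sqint_mul.
have a2 : L1 QQ (fun p => G (splice (fun k => k != i) p.1 p.2) * pathV i p.1).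
  by apply: sqint_mul; [exact: sqint_splice|exact: sqint_fst].
have a3 : L1 QQ (fun p => F p.1 * (H p.1 * pathV i p.1)).
  by apply: (L1_fst (phi := fun x => F x * (H x * pathV i x))); exact: sqint_mul.
have a4 : L1 QQ (fun p => F (splice (fun k => k != i) p.1 p.2) * (H p.1 * pathV i p.1)).
  apply: sqint_mul; first exact: sqint_splice.
  exact: (sqint_fst (phi := fun x => H x * pathV i x)).
have hr : L1 QQ r.
  have := L1B (L1B a1 a2) (L1B a3 a4).
  by congr L1; apply/funext => p; rewrite /r; ring.
have rE : \int[QQ]_p r p =
    \int[Q]_x (G x * pathV i x) - \int[Q]_x (H x * (pathD i x * pathV i x)).
  have -> : r = fun p => (G p.1 * pathV i p.1 - G (splice (fun k => k != i) p.1 p.2) * pathV i p.1) -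
     (F p.1 * (H p.1 * pathV i p.1) - F (splice (fun k => k != i) p.1 p.2) * (H p.1 * pathV i p.1)).
    by apply/funext => p; rewrite /r; ring.
  rewrite (RintegralB measurableT (L1B a1 a2) (L1B a3 a4)).
  rewrite (RintegralB measurableT a1 a2) (RintegralB measurableT a3 a4).
  rewrite -(sqint_CE_mul prodQ (fun k => k != i) sG sV) (CE_pathV_mul i sG) subr0.
  rewrite -(sqint_CE_mul prodQ (fun k => k != i) sqF sHV).
  rewrite (Rintegral_fst (sqint_mul sG sV)) (Rintegral_fst (sqint_mul sqF sHV)).
  have s1 := sqint_mul sqF sHV.
  have s2 := sqint_mul (sqint_CE prodQ (fun k => k != i) sqF) sHV.
  have -> : \int[Q]_x (H x * (pathD i x * pathV i x)) =
      \int[Q]_x (F x * (H x * pathV i x)) - \int[Q]_x (E_ i F x * (H x * pathV i x)).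
    rewrite -(RintegralB measurableT s1 s2); apply: eq_Rintegral => x _.
    by rewrite /pathD -mulrBl mulrCA.
  by [].
rewrite -rE -integral_pathdD EFin_normr_Rintegral//.
have mip := measurable_increment_pathV i.
rewrite -ge0_integralZl//=; last 2 first.
- exact/measurable_EFinP.
- by move=> p _; rewrite lee_fin mulr_ge0.
apply: le_trans (le_abse_integral _ _ _) _ => //.
  by apply/measurable_EFinP; exact: L1_measurable hr.
apply: ge0_le_integral => //.
- apply/measurable_EFinP; apply: measurableT_comp => //; exact: L1_measurable hr.
- apply/measurable_EFinP; exact: measurable_funM.
- move=> p _; rewrite /= lee_fin /r normrM mulrA ler_wpM2r//.
Qed.

Lemma increment_pathD i p :
  increment i p = pathD i p.1 - pathD i (splice (fun k => k != i) p.1 p.2).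
Proof. by rewrite /increment /pathD CE_splice; ring. Qed.

Lemma young_cube (a b : R) : 0 <= a -> 0 <= b -> a ^+ 2 * b <= 2 / 3 * a ^+ 3 + 1 / 3 * b ^+ 3.
Proof.
move=> a0 b0; rewrite -subr_ge0.
have -> : 2 / 3 * a ^+ 3 + 1 / 3 * b ^+ 3 - a ^+ 2 * b = (a - b) ^+ 2 * (2 * a + b) / 3.
  by field.
by rewrite divr_ge0// mulr_ge0 ?sqr_ge0// addr_ge0// mulr_ge0.
Qed.

Lemma young_sqr (a b : R) : a * b <= 2^-1 * a ^+ 2 + 2^-1 * b ^+ 2.
Proof. by have := sqr_ge0 (a - b); nra. Qed.

(** The increment is a difference of two copies of [pathD]. In the expanded square the cross term
    vanishes, and Young with weights 2/3 and 1/3 bounds each square term by the third moment of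
    [pathD], which dominates that of [pathV] by Jensen. The linear part costs at most one second
    moment. An infinite third moment makes the bound trivial. *)
Lemma integral_pathdD_le i :
  (\int[Q]_x ((pathd i x + pathD i x) * `|pathV i x|)%:E <=
   2%:E * \int[Q]_x (`|pathD i x| ^+ 3)%:E + \int[Q]_x (pathD i x ^+ 2)%:E)%E.
Proof.
have sD := sqint_pathD i; have sV := sqint_pathV i.
have [mD D2] := sD; have [mV V2] := sV.
have mnD : measurable_fun setT (fun x => `|pathD i x|) by exact: measurableT_comp.
have mnV : measurable_fun setT (fun x => `|pathV i x|) by exact: measurableT_comp.
have [oo|] := ltP (\int[Q]_x (`|pathD i x| ^+ 3)%:E)%E +oo%E; last first.
  rewrite leye_eq => /eqP ->; rewrite gt0_muley// addye ?leey//.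
  by rewrite (EFin_Rintegral D2).
have D3 : L1 Q (fun x => `|pathD i x| ^+ 3).
  by apply: ge0_L1P => //; exact: measurable_funX.
have V3le := integral_CE_cube_le prodQ (fun k => (k <= i)%N) (sqint_L1 sD).
rewrite -/(pathV i) in V3le.
have V3 : L1 Q (fun x => `|pathV i x| ^+ 3).
  by apply: ge0_L1P => //; [exact: measurable_funX|exact: le_lt_trans oo].
rewrite (EFin_Rintegral D3) (EFin_Rintegral V3) lee_fin in V3le.
pose sp (p : S * S) := splice (fun k => k != i) p.1 p.2.
have msp : measurable_fun setT sp by exact: measurable_splice.
have mD1 : measurable_fun setT (fun p : S * S => pathD i p.1).
  exact: (measurableT_comp mD measurable_fst).
have mV1 : measurable_fun setT (fun p : S * S => `|pathV i p.1|).
  exact: (measurableT_comp mnV measurable_fst).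
have mDs : measurable_fun setT (fun p : S * S => pathD i (sp p)).
  exact: (measurableT_comp mD msp).
have D3s := L1_splice prodQ (fun k => k != i) D3; rewrite -/sp in D3s.
have D31 := L1_fst D3; have V31 := L1_fst V3.
have young2 (a b : R) : 0 <= b -> `|a ^+ 2 * b| <= `|a| ^+ 3 + b ^+ 3.
  move=> b0; rewrite normrM (ger0_norm b0) normrX.
  have := young_cube (normr_ge0 a) b0.
  have := exprn_ge0 3 (normr_ge0 a); have := exprn_ge0 3 b0; lra.
have b1 : L1 QQ (fun p => pathD i p.1 ^+ 2 * `|pathV i p.1|).
  apply: (L1_le _ (L1D D31 V31)) => [|p]; last exact: young2.
  by apply: measurable_funM => //; exact: measurable_funX.
have b2 : L1 QQ (fun p => pathD i (sp p) ^+ 2 * `|pathV i p.1|).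
  apply: (L1_le _ (L1D D3s V31)) => [|p]; last exact: young2.
  by apply: measurable_funM => //; exact: measurable_funX.
have b3 : L1 QQ (fun p => pathD i (sp p) * (pathD i p.1 * `|pathV i p.1|)).
  apply: (L1_le _ (L1D b1 b2)) => [|p].
    by apply: measurable_funM => //; exact: measurable_funM.
  rewrite !normrM normr_id mulrA -mulrDl ler_wpM2r//.
  rewrite -[pathD i p.1 ^+ 2]real_normK ?num_real//.
  rewrite -[pathD i (sp p) ^+ 2]real_normK ?num_real//.
  move: (normr_ge0 (pathD i p.1)) (normr_ge0 (pathD i (sp p))).
  move: `|pathD i p.1| `|pathD i (sp p)| => a b a0 b0.
  by have := sqr_ge0 (a - b); have := sqr_ge0 a; have := sqr_ge0 b; nra.
have b4 : L1 QQ (fun p => pathD i p.1 * `|pathV i p.1|).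
  by apply: sqint_mul; [exact: sqint_fst|exact: sqint_fst (sqint_norm sV)].
have b5 : L1 QQ (fun p => pathD i (sp p) * `|pathV i p.1|).
  by apply: sqint_mul; [exact: sqint_splice|exact: sqint_fst (sqint_norm sV)].
have c1 : L1 Q (fun x => pathD i x ^+ 2 * `|pathV i x|).
  apply: (L1_le _ (L1D D3 V3)) => [|p]; last exact: young2.
  by apply: measurable_funM => //; exact: measurable_funX.
have c4 : L1 Q (fun x => pathD i x * `|pathV i x|) := sqint_mul sD (sqint_norm sV).
(* Given the first path, the average of [pathD] at the resampled path is zero almost surely; this
   removes the cross term and the second linear term. *)
have E0 (psi : S -> R) : measurable_fun setT psi ->
    L1 QQ (fun p => pathD i (sp p) * psi p.1) ->
    \int[QQ]_p (pathD i (sp p) * psi p.1) = 0.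
  move=> mpsi hp.
  have [h <-] := CE_mul prodQ (sqint_L1 sD) mpsi hp.
  apply: Rintegral_ae0; first exact: L1_measurable h.
  by apply: filterS (CE_pathD0 i) => x ->; rewrite mul0r.
have e3 := E0 _ (measurable_funM mD mnV) b3.
have e5 := E0 _ mnV b5.
have e1 := Rintegral_fst c1.
have e4 := Rintegral_fst c4.
have e2 : \int[QQ]_p (pathD i (sp p) ^+ 2 * `|pathV i p.1|) <=
    2 / 3 * \int[Q]_x (`|pathD i x| ^+ 3) + 1 / 3 * \int[Q]_x (`|pathV i x| ^+ 3).
  rewrite -(Rintegral_splice prodQ (fun k => k != i) D3) -(Rintegral_fst V3).
  rewrite -(RintegralZl _ measurableT D3s) -(RintegralZl _ measurableT V31).
  rewrite -(RintegralD measurableT (L1Z _ D3s) (L1Z _ V31)).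
  apply: (le_Rintegral measurableT b2 (L1D (L1Z _ D3s) (L1Z _ V31))) => p _.
  rewrite -[pathD i (sp p) ^+ 2]real_normK ?num_real//.
  exact: young_cube.
have e1' : \int[Q]_x (pathD i x ^+ 2 * `|pathV i x|) <=
    2 / 3 * \int[Q]_x (`|pathD i x| ^+ 3) + 1 / 3 * \int[Q]_x (`|pathV i x| ^+ 3).
  rewrite -(RintegralZl _ measurableT D3) -(RintegralZl _ measurableT V3).
  rewrite -(RintegralD measurableT (L1Z _ D3) (L1Z _ V3)).
  apply: (le_Rintegral measurableT c1 (L1D (L1Z _ D3) (L1Z _ V3))) => p _.
  rewrite -[pathD i p ^+ 2]real_normK ?num_real//.
  exact: young_cube.
have V2le := CE_sqr_le prodQ (fun k => (k <= i)%N) sD; rewrite -/(pathV i) in V2le.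
have e4' : \int[Q]_x (pathD i x * `|pathV i x|) <=
    2^-1 * \int[Q]_x (pathD i x ^+ 2) + 2^-1 * \int[Q]_x (pathV i x ^+ 2).
  rewrite -(RintegralZl _ measurableT D2) -(RintegralZl _ measurableT V2).
  rewrite -(RintegralD measurableT (L1Z _ D2) (L1Z _ V2)).
  apply: (le_Rintegral measurableT c4 (L1D (L1Z _ D2) (L1Z _ V2))) => p _.
  rewrite -[pathV i p ^+ 2]real_normK ?num_real//.
  exact: young_sqr.
have I1 := L1B (L1D b1 b2) (L1Z 2 b3).
have I2 := L1B b4 b5.
rewrite -integral_pathdD (EFin_Rintegral D3) (EFin_Rintegral D2).
have -> : (fun p => ((increment i p ^+ 2 + increment i p) * `|pathV i p.1|)%:E) =
    (fun p => ((pathD i p.1 ^+ 2 * `|pathV i p.1| + pathD i (sp p) ^+ 2 * `|pathV i p.1| -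
       2 * (pathD i (sp p) * (pathD i p.1 * `|pathV i p.1|))) +
      (pathD i p.1 * `|pathV i p.1| - pathD i (sp p) * `|pathV i p.1|))%:E).
  by apply/funext => p; congr EFin; rewrite increment_pathD -/(sp p); ring.
rewrite (EFin_Rintegral (L1D I1 I2)) -EFinM -EFinD lee_fin.
rewrite (RintegralD measurableT I1 I2) (RintegralB measurableT (L1D b1 b2) (L1Z 2 b3)).
rewrite (RintegralD measurableT b1 b2) (RintegralB measurableT b4 b5).
rewrite (RintegralZl _ measurableT b3) e3 e5 e1 e4.
move: e1' e2 e4' V2le V3le.
move: (\int[Q]_x (pathD i x ^+ 2 * `|pathV i x|)) => A1.
move: (\int[QQ]_p (pathD i (sp p) ^+ 2 * `|pathV i p.1|)) => A2.
move: (\int[Q]_x (pathD i x * `|pathV i x|)) => A4.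
move: (\int[Q]_x (`|pathD i x| ^+ 3)) (\int[Q]_x (`|pathV i x| ^+ 3)) => B1 B2.
move: (\int[Q]_x (pathD i x ^+ 2)) (\int[Q]_x (pathV i x ^+ 2)) => B3 B4.
clear - A1 A2 A4 B1 B2 B3 B4; lra.
Qed.

Lemma Rintegral_normM_pathDV i :
  \int[Q]_x `|pathD i x * pathV i x| <= \int[Q]_x (pathD i x ^+ 2).
Proof.
have sD := sqint_pathD i; have sV := sqint_pathV i.
have [mD D2] := sD; have [mV V2] := sV.
have V2le := CE_sqr_le prodQ (fun k => (k <= i)%N) sD; rewrite -/(pathV i) in V2le.
apply: (@le_trans _ _ (2^-1 * \int[Q]_x (pathD i x ^+ 2) + 2^-1 * \int[Q]_x (pathV i x ^+ 2))).
  rewrite -(RintegralZl _ measurableT D2) -(RintegralZl _ measurableT V2).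
  rewrite -(RintegralD measurableT (L1Z _ D2) (L1Z _ V2)).
  apply: (le_Rintegral measurableT (L1_norm (sqint_mul sD sV))
    (L1D (L1Z _ D2) (L1Z _ V2))) => p _.
  rewrite -[pathV i p ^+ 2]real_normK ?num_real//.
  rewrite -[pathD i p ^+ 2]real_normK ?num_real// normrM.
  exact: young_sqr.
move: V2le.
move: (\int[Q]_x (pathD i x ^+ 2)) (\int[Q]_x (pathV i x ^+ 2)) => B3 B4; lra.
Qed.

End martingale_differences.

(** * Versions of conditional expectations on Omega *)

Section conditional_expectation_versions.
Context {d : measure_display} {Omega : measurableType d} {R : realType}.
Variable P : probability Omega R.
Implicit Types (Y W : Omega -> R) (G : set (set Omega)).

Lemma is_cond_exp_L1 G Y W : is_cond_exp P G Y W -> L1 P W.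
Proof. by case=> /Lfun1_integrable. Qed.

(** Both versions are tested on the event where [W1] exceeds [W2], which lies in [G]. There the
    positive difference has integral zero. *)
Lemma is_cond_exp_ae_le G Y W1 W2 : sigma_algebra setT G -> G `<=` measurable ->
  is_cond_exp P G Y W1 -> is_cond_exp P G Y W2 -> {ae P, forall w, W1 w <= W2 w}.
Proof.
move=> sG Gm h1 h2.
have L1W1 := is_cond_exp_L1 h1; have L1W2 := is_cond_exp_L1 h2.
have [mW1 mW2] := (L1_measurable L1W1, L1_measurable L1W2).
case: h1 => _ m1 i1; case: h2 => _ m2 i2.
pose OG := g_sigma_algebraType G.
have GE (A : set Omega) : @measurable _ OG A -> G A.
  by rewrite /measurable/= (sigma_algebra_id sG).
have EG (A : set Omega) : G A -> @measurable _ OG A.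
  by rewrite /measurable/= (sigma_algebra_id sG).
pose A := (fun w => W1 w - W2 w) @^-1` `]0, +oo[%classic.
have GA : G A.
  apply: GE.
  have mB : measurable_fun setT ((fun w => W1 w - W2 w) : OG -> R).
    by apply: measurable_funB => _ B mB; rewrite setTI; apply: EG; [exact: m1|exact: m2].
  by rewrite /A -[X in measurable X]setTI; exact: mB.
have mA := Gm _ GA.
have mB : measurable_fun setT (fun w => W1 w - W2 w) by exact: measurable_funB.
have i0 : (\int[P]_(w in A) `|(W1 w - W2 w)%:E| = 0)%E.
  transitivity (\int[P]_(w in A) ((EFin \o W1) \- (EFin \o W2)) w)%E.
    apply: eq_integral => w; rewrite inE /A /= in_itv/= andbT => w0.
    by rewrite ger0_norm ?ltW.
  rewrite integralB//; [|exact: integrableS L1W1|exact: integrableS L1W2].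
  rewrite [X in (X - _)%E](i1 _ GA) -[X in (X - _)%E](i2 _ GA) subee//.
  by apply: integrable_fin_num => //; exact: integrableS L1W2.
have : ae_eq P A (fun w => (W1 w - W2 w)%:E) (cst 0%E).
  apply/ae_eq_integral_abs => //; apply/measurable_EFinP.
  exact: measurable_funTS.
apply: filterS => w hw; rewrite leNgt; apply/negP => W21.
have := hw; rewrite /A /= in_itv/= andbT subr_gt0 => /(_ W21) [].
by move/eqP; rewrite subr_eq0 => /eqP e; rewrite e ltxx in W21.
Qed.

Lemma is_cond_exp_unique G Y W1 W2 : sigma_algebra setT G -> G `<=` measurable ->
  is_cond_exp P G Y W1 -> is_cond_exp P G Y W2 -> {ae P, forall w, W1 w = W2 w}.
Proof.
move=> sG Gm h1 h2.
have h12 := is_cond_exp_ae_le sG Gm h1 h2; have h21 := is_cond_exp_ae_le sG Gm h2 h1.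
by apply: filterS2 h12 h21 => w a b; apply/le_anti/andP; split.
Qed.

Lemma is_cond_exp_ae_eq G Y Y' W : measurable_fun setT Y -> measurable_fun setT Y' ->
  G `<=` measurable ->
  {ae P, forall w, Y w = Y' w} -> is_cond_exp P G Y W -> is_cond_exp P G Y' W.
Proof.
move=> mY mY' Gm YY' [h1 h2 h3]; split => // A GA; rewrite h3//.
apply: ae_eq_integral => //; [exact: Gm| | |].
- by apply/measurable_EFinP; exact: measurable_funTS.
- by apply/measurable_EFinP; exact: measurable_funTS.
- by apply: filterS YY' => w -> _.
Qed.

(** [cond_exp] is a choice with default value zero, so some version [W] has to be exhibited before
    its properties can be used. *)
Lemma cond_expP G Y W : is_cond_exp P G Y W -> is_cond_exp P G Y (cond_exp P G Y).
Proof. by move=> h; exact: (xgetPex (cst 0) (ex_intro _ W h)). Qed.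

Lemma cond_exp_ae_eq G Y W : sigma_algebra setT G -> G `<=` measurable ->
  is_cond_exp P G Y W -> {ae P, forall w, cond_exp P G Y w = W w}.
Proof. by move=> sG Gm h; exact: is_cond_exp_unique (cond_expP h) h. Qed.

End conditional_expectation_versions.

(** * The law of the sample path *)

Section sample_path_law.
Context {R : realType} {d d' : measure_display} {Omega : measurableType d}
  {T : measurableType d'} (P : probability Omega R).
Implicit Types X : nat -> {RV P >-> T}.
Local Notation S := (seq_space T).

Lemma measurable_sample_path X : measurable_fun setT (sample_path X).
Proof. by apply: measurable_fun_seq_space => i; exact: measurable_funP. Qed.

HB.instance Definition _ X := isMeasurableFun.Build _ _ _ _
  (sample_path X) (measurable_sample_path X).

Definition path_law X : probability S R := distribution P (sample_path X).

Lemma path_law_ae X (A : S -> Prop) :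
  {ae path_law X, forall x, A x} -> {ae P, forall w, A (sample_path X w)}.
Proof.
case=> B [mB B0 AB]; exists (sample_path X @^-1` B); split => //.
- by rewrite -[X in measurable X]setTI; exact: measurable_sample_path.
- by move=> w Aw; exact: AB.
Qed.

Lemma ge0_integral_path_law X (u : S -> \bar R) : measurable_fun setT u ->
  (forall x, 0 <= u x)%E -> (\int[P]_w u (sample_path X w) = \int[path_law X]_x u x)%E.
Proof. by move=> mu u0; rewrite ge0_integral_distribution. Qed.

Lemma L1_path_law X (phi : S -> R) : measurable_fun setT phi ->
  L1 P (phi \o sample_path X) <-> L1 (path_law X) phi.
Proof.
move=> mphi.
have mp : measurable_fun setT (phi \o sample_path X).
  by apply: measurableT_comp => //; exact: measurable_sample_path.
have E := @ge0_integral_path_law X (fun x => `|(phi x)%:E|)%E.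
split=> /integrableP[_ oo]; apply/integrableP; split; try exact/measurable_EFinP.
  by rewrite -E//; apply/measurable_EFinP; exact: measurableT_comp.
by rewrite [ltLHS]E//; apply/measurable_EFinP; exact: measurableT_comp.
Qed.

Lemma integral_path_law X (phi : S -> R) : L1 (path_law X) phi ->
  (\int[P]_w (phi (sample_path X w))%:E = \int[path_law X]_x (phi x)%:E)%E.
Proof.
move=> hphi; have mphi := L1_measurable hphi; rewrite integral_distribution//.
  exact/measurable_EFinP.
exact/L1_path_law.
Qed.

Lemma Rintegral_path_law X (phi : S -> R) : L1 (path_law X) phi ->
  \int[P]_w phi (sample_path X w) = \int[path_law X]_x phi x.
Proof. by move=> hphi; rewrite /Rintegral integral_path_law. Qed.

Lemma product_law_path_law X : mutually_independent X -> product_law (path_law X).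
Proof.
move=> indX n B mB; have := indX (iota 0 n) B (iota_uniq 0 n) mB.
have -> : \bigcap_(i in [set` iota 0 n]) (X i @^-1` B i) = sample_path X @^-1` (box n B).
  apply/seteqP; split=> w /= h i; first by move=> im; apply: h; rewrite /= mem_iota.
  by rewrite /= mem_iota => im; exact: h.
have -> : iota 0 n = index_iota 0 n by rewrite /index_iota subn0.
by rewrite big_mkord.
Qed.

Lemma ge0_integral_joint_law X X' (Q := path_law X) (u : S * S -> \bar R) :
  independent_copy X X' -> measurable_fun setT u -> (forall p, 0 <= u p)%E ->
  (\int[P]_w u (sample_path X w, sample_path X' w) = \int[Q \x Q]_p u p)%E.
Proof.
move=> [sameX indX] mu u0.
pose pr w := (sample_path X w, sample_path X' w).
have mpr : measurable_fun setT pr.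
  by apply: measurable_fun_pair; exact: measurable_sample_path.
transitivity (\int[pushforward P (mfun_Sub (mem_set mpr))]_p u p)%E.
  by rewrite ge0_integral_pushforward.
apply: eq_measure_integral => A mA _ /=.
symmetry; have := @product_measure_unique _ _ S S R Q Q
   (pushforward P (mfun_Sub (mem_set mpr))); apply => // A1 A2 mA1 mA2.
transitivity (P (sample_path X @^-1` A1 `&` sample_path X' @^-1` A2)); first by [].
by rewrite indX// sameX.
Qed.

Lemma sigma_of_subset X J (G : set (set Omega)) : sigma_algebra setT G ->
  (forall k B, J k -> measurable B -> G (X k @^-1` B)) -> sigma_of X J `<=` G.
Proof.
move=> sG h; apply: smallest_sub => // _ [k Jk [B mB <-]].
by rewrite setTI; exact: h.
Qed.

Lemma sigma_of_sigma_algebra X J : sigma_algebra setT (sigma_of X J).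
Proof. exact: smallest_sigma_algebra. Qed.

Lemma sigma_of_measurable X J : sigma_of X J `<=` measurable.
Proof.
apply: sigma_of_subset => [|k B _ mB]; first exact: sigma_algebra_measurable.
by rewrite -[X in measurable X]setTI; exact: measurable_funP.
Qed.

Lemma sigma_of_preimage X J k B : J k -> measurable B -> sigma_of X J (X k @^-1` B).
Proof.
by move=> Jk mB; apply: sub_sigma_algebra; exists k => //; exists B => //; rewrite setTI.
Qed.

End sample_path_law.

(** * Explicit versions of the conditional expectations *)

Section conditional_expectations_of_path_functionals.
Context {R : realType} {d d' : measure_display} {Omega : measurableType d}
  {T : measurableType d'} (P : probability Omega R).
Variables X X' : nat -> {RV P >-> T}.
Local Notation S := (seq_space T).
Local Notation xi := (sample_path X).
Local Notation xi' := (sample_path X').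
Hypothesis X_indep : mutually_independent X.
Hypothesis X'_copy : independent_copy X X'.
Let Q := path_law X.
Let prodQ : product_law Q := product_law_path_law X_indep.

Lemma sigma_of_measurable_splice (J : pred nat) x0 C : measurable C ->
  sigma_of X [set k | J k] ((fun w => splice J (xi w) x0) @^-1` C).
Proof.
move=> mC.
pose OJ := g_sigma_algebraType (sigma_of X [set k | J k]).
have sJ : sigma_algebra setT (sigma_of X [set k | J k]) := sigma_of_sigma_algebra _ _.
have m : measurable_fun setT ((fun w => splice J (xi w) x0) : OJ -> S).
  apply: measurable_fun_seq_space => k; rewrite /splice.
  case E: (J k); last exact: measurable_cst.
  move=> _ B mB; rewrite setTI /measurable/= (sigma_algebra_id sJ).
  exact: sigma_of_preimage.
have := m measurableT _ mC.
by rewrite setTI /measurable/= (sigma_algebra_id sJ).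
Qed.

(** Freezing the coordinates outside [J] at a fixed path [x0] realises the sigma-algebra of the
    remaining ones as the preimages under a single map into path space. *)
Lemma sigma_of_splice (J : pred nat) x0 A : sigma_of X [set k | J k] A ->
  exists2 C, measurable C & A = (fun w => splice J (xi w) x0) @^-1` C.
Proof.
pose eta w := splice J (xi w) x0.
move=> sA; suff : preimage_set_system setT eta measurable A.
  by case=> C mC; rewrite setTI => <-; exists C.
apply: sigma_of_subset sA => [|k B Jk mB].
  by apply: sigma_algebra_preimage; exact: sigma_algebra_measurable.
exists ((fun x : S => x k) @^-1` B).
  by rewrite -[X in measurable X]setTI; exact: measurable_coord.
by rewrite setTI; apply/seteqP; split=> w; rewrite /= /eta /splice /= (Jk : J k).
Qed.

Lemma integral_preimage (Y : Omega -> R) (U : Type) (zeta : Omega -> U) (C : set U) :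
  (\int[P]_(w in zeta @^-1` C) (Y w)%:E = \int[P]_w (Y w * \1_C (zeta w))%:E)%E.
Proof.
rewrite integral_mkcond; apply: eq_integral => w _.
rewrite patchE EFinM indicE [w \in _](_ : _ = (zeta w \in C)).
  by case: (zeta w \in C); rewrite ?mule1 ?mule0.
by apply/idP/idP; rewrite !inE.
Qed.

Lemma L1_indic (d0 : measure_display) (U : measurableType d0) (Q0 : probability U R) C phi :
  measurable C -> L1 Q0 phi -> L1 Q0 (fun x => phi x * \1_C x).
Proof.
move=> mC hphi; apply: (L1_le _ (L1_norm hphi)) => [|x].
  by apply: measurable_funM; [exact: L1_measurable hphi|exact: measurable_indic].
by rewrite indicE; case: (_ \in _); rewrite ?mulr1 ?mulr0 ?normr0.
Qed.

(** The indicator of an event that depends on the coordinates in [J] is unchanged by splicing, so it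
    can be moved inside the integral that defines [CE]. *)
Lemma is_cond_exp_CE (J : pred nat) phi : L1 Q phi ->
  is_cond_exp P (sigma_of X [set k | J k]) (phi \o xi) (CE Q J phi \o xi).
Proof.
move=> hphi; have hC := L1_CE prodQ J hphi; have mC := L1_measurable hC.
pose x0 := xi point.
split.
- by apply/Lfun1_integrable/L1_path_law.
- move=> B mB; have -> : (CE Q J phi \o xi) @^-1` B =
      (fun w => splice J (xi w) x0) @^-1` (CE Q J phi @^-1` B).
    by apply/seteqP; split=> w; rewrite /= CE_splice.
  apply: sigma_of_measurable_splice.
  by rewrite -[X in measurable X]setTI; exact: mC.
- move=> A /(@sigma_of_splice _ x0)[C mC' ->].
  pose C' := (fun x => splice J x x0) @^-1` C.
  have mC1 : measurable C'.
    by rewrite -[X in measurable X]setTI; exact: measurable_splice_r.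
  have m1 : measurable_fun setT (\1_C' : S -> R) by exact: measurable_indic.
  have E (u : S -> R) : L1 Q u ->
      (\int[P]_(w in (fun w => splice J (xi w) x0) @^-1` C) (u (xi w))%:E =
       \int[Q]_x (u x * \1_C' x)%:E)%E.
    move=> hu; rewrite -[LHS]/(\int[P]_(w in xi @^-1` C') (u (xi w))%:E)%E.
    rewrite integral_preimage.
    exact: (integral_path_law (phi := fun x => u x * \1_C' x) (L1_indic mC1 hu)).
  rewrite [LHS]E// [RHS]E//.
  have s1 : (fun p : S * S => phi (splice J p.1 p.2) * \1_C' p.1) =
      (fun p => (fun x => phi x * \1_C' x) (splice J p.1 p.2)).
    apply/funext => p; congr (_ * _); rewrite !indicE; congr (_%:R); congr nat_of_bool.
    by apply/idP/idP; rewrite !inE /C' /= splice_left.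
  have Lp := L1_indic mC1 hphi.
  have [|L1p Ep] := CE_mul prodQ hphi m1 (J := J).
    by rewrite s1; exact: (L1_splice prodQ J Lp).
  rewrite !EFin_Rintegral// Ep; congr (_%:E).
  by rewrite s1; exact: (Rintegral_splice prodQ J Lp).
Qed.


Lemma ge0_integral_independent J (a b : S -> \bar R) :
  measurable_fun setT a -> measurable_fun setT b ->
  (forall y, 0 <= a y)%E -> (forall y, 0 <= b y)%E ->
  (forall y z, a (splice J y z) = a z) -> (forall y z, b (splice J y z) = b y) ->
  (\int[Q]_y (a y * b y) = \int[Q]_y a y * \int[Q]_y b y)%E.
Proof.
move=> ma mb a0 b0 aJ bJ.
have ia0 : (0 <= \int[Q]_y a y)%E by apply: integral_ge0.
rewrite -(ge0_integral_splice prodQ J (u := fun y => (a y * b y)%E)); last 2 first.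
- exact: emeasurable_funM.
- by move=> y; exact: mule_ge0.
rewrite -ge0_integralZl//; apply: eq_integral => y _.
rewrite -ge0_integralZr//.
by apply: eq_integral => z _; rewrite aJ bJ.
Qed.

Section resampling.
Variables (F : S -> R) (i : nat).
Hypothesis sqF : sqint Q F.
Let J : pred nat := fun k => k != i.
Let G := <<s sigma_of X setT `|` sigma_of X' [set k | J k] >>.
Let zeta x0 w : S * S := (xi w, splice J (xi' w) x0).

Lemma sigma_resampling_preimage x0 A : G A ->
  exists2 C, measurable C & A = zeta x0 @^-1` C.
Proof.
move=> GA; suff : preimage_set_system setT (zeta x0) measurable A.
  by case=> C mC; rewrite setTI => <-; exists C.
have sz : sigma_algebra setT (preimage_set_system setT (zeta x0) measurable).
  by apply: sigma_algebra_preimage; exact: sigma_algebra_measurable.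
apply: smallest_sub GA => // B [|].
- apply: sigma_of_subset => // k C _ mC.
  exists ((fun p : S * S => p.1 k) @^-1` C); last by rewrite setTI.
  rewrite -[X in measurable X]setTI.
  exact: (measurableT_comp (measurable_coord k) measurable_fst).
- apply: sigma_of_subset => // k C Jk mC.
  exists ((fun p : S * S => p.2 k) @^-1` C).
    rewrite -[X in measurable X]setTI.
    exact: (measurableT_comp (measurable_coord k) measurable_snd).
  by rewrite setTI; apply/seteqP; split=> w; rewrite /= /splice /= (Jk : J k).
Qed.

(** Given the path, the increment involves the copy only through its coordinate [i], which is
    independent of the other coordinates that generate [G]. The test indicator is therefore handled
    by Tonelli and independence, one path at a time. *)
Lemma is_cond_exp_pathd : is_cond_exp P G
  (fun w => increment F i (xi w, xi' w) ^+ 2) (pathd Q F i \o xi).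
Proof.
have Ld := L1_pathd prodQ sqF i; have md := L1_measurable Ld.
have [mi _] := sqint_increment prodQ sqF i.
have mi2 : measurable_fun setT (fun p => (increment F i p ^+ 2)%:E).
  by apply/measurable_EFinP; exact: measurable_funX.
pose x0 := xi point.
split.
- by apply/Lfun1_integrable/L1_path_law.
- move=> B mB; apply: sub_sigma_algebra; left.
  have -> : [set: nat] = [set k | xpredT k] by apply/seteqP; split.
  have -> : (pathd Q F i \o xi) @^-1` B =
      (fun w => splice xpredT (xi w) x0) @^-1` (pathd Q F i @^-1` B) by [].
  by apply: sigma_of_measurable_splice; rewrite -[X in measurable X]setTI; exact: md.
- move=> A /(@sigma_resampling_preimage x0)[C mC ->].
  pose h (p : S * S) : S * S := (p.1, splice J p.2 x0).
  have mh : measurable_fun setT h.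
    apply: measurable_fun_pair => //.
    exact: (measurableT_comp (measurable_splice_r J x0) measurable_snd).
  have m1 : measurable_fun setT (fun p => (\1_C (h p) : R)%:E).
    apply/measurable_EFinP; apply: measurableT_comp mh; exact: measurable_indic.
  have E (u : S * S -> R) : measurable_fun setT (EFin \o u) -> (forall p, 0 <= u p) ->
      (\int[P]_(w in zeta x0 @^-1` C) (u (xi w, xi' w))%:E =
       \int[Q]_x \int[Q]_y ((u (x, y))%:E * (\1_C (h (x, y)))%:E))%E.
    move=> mu u0; rewrite integral_preimage.
    have mv : measurable_fun setT (fun p => ((u p)%:E * (\1_C (h p) : R)%:E)%E).
      exact: emeasurable_funM mu m1.
    have v0 p : (0 <= (u p)%:E * (\1_C (h p) : R)%:E)%E by rewrite -EFinM lee_fin mulr_ge0.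
    have := ge0_integral_joint_law X'_copy mv v0.
    rewrite (fubini_tonelli1 _ mv v0) => <-.
    by apply: eq_integral => w _; rewrite EFinM.
  have md1 : measurable_fun setT (fun p : S * S => (pathd Q F i p.1)%:E).
    by apply/measurable_EFinP; exact: measurableT_comp md measurable_fst.
  have d0 x : 0 <= pathd Q F i x by apply: Rintegral_ge0 => y _; exact: sqr_ge0.
  have El := E (fun p => pathd Q F i p.1) md1 (fun p => d0 p.1).
  have Er := E (fun p => increment F i p ^+ 2) mi2 (fun p => sqr_ge0 (increment F i p)).
  apply: (etrans El); apply: (etrans _ (esym Er)).
  have mF (u : S * S -> \bar R) : measurable_fun setT u -> (forall p, 0 <= u p)%E ->
      measurable_fun setT (fun x => \int[Q]_y (u (x, y) * (\1_C (h (x, y)) : R)%:E))%E.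
    move=> mu u0; apply: (measurable_fun_fubini_tonelli_F
      (fun p => (u p * (\1_C (h p) : R)%:E)%E)).
    - exact: emeasurable_funM.
    - by move=> p; rewrite mule_ge0// lee_fin.
  apply: ae_eq_integral => //.
  - by apply: (mF (fun p => (pathd Q F i p.1)%:E) md1) => p; rewrite lee_fin d0.
  - by apply: (mF (fun p => (increment F i p ^+ 2)%:E) mi2) => p; rewrite lee_fin sqr_ge0.
  apply: filterS (ae_sqint_splice prodQ sqF i) => x hx _.
  have hc := sqint_cst Q (F x).
  have [mix hi] : sqint Q (fun y => increment F i (x, y)) by exact: sqintB.
  have m1x : measurable_fun setT (fun y => (\1_C (h (x, y)) : R)%:E).
    by apply: (measurableT_comp m1); exact: measurable_pair1.
  have e1 y : (0 <= (\1_C (h (x, y)) : R)%:E)%E by rewrite lee_fin.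
  have Ex := ge0_integralZl_EFin Q measurableT (fun y _ => e1 y) m1x (d0 x).
  apply: (etrans Ex).
  have -> : (pathd Q F i x)%:E = (\int[Q]_y (increment F i (x, y) ^+ 2)%:E)%E.
    by rewrite EFin_Rintegral.
  (* For fixed [x] the increment depends on [y] only at coordinate [i], and the indicator only at
     the other coordinates. *)
  apply/esym/(@ge0_integral_independent J (fun y => (increment F i (x, y) ^+ 2)%:E)
    (fun y => (\1_C (h (x, y)))%:E)) => //.
  - by apply/measurable_EFinP; exact: measurable_funX.
  - by move=> y; rewrite lee_fin sqr_ge0.
  - move=> y z; rewrite /increment /=; congr (_%:E); congr (_ ^+ 2); congr (_ - F _).
    by apply/funext => k; rewrite /splice /J; case: (k != i).
  - by move=> y z; rewrite /h /= splice_left.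
Qed.

End resampling.

End conditional_expectations_of_path_functionals.

(** * The difference operators up to negligible events *)

Section difference_operators.
Context {R : realType} {d d' : measure_display} {Omega : measurableType d}
  {T : measurableType d'} (P : probability Omega R).
Variables X X' : nat -> {RV P >-> T}.
Local Notation S := (seq_space T).
Local Notation xi := (sample_path X).
Hypothesis X_indep : mutually_independent X.
Hypothesis X'_copy : independent_copy X X'.
Variable f : S -> nat.
Hypothesis f_meas : measurable_fun [set: S] f.
Hypothesis F_L2 : rvR X f \in Lfun P 2%:E.
Let Q := path_law X.
Let prodQ : product_law Q := product_law_path_law X_indep.
Let F (x : S) : R := (f x)%:R.

Lemma sqint_rvR : sqint Q F.
Proof.
have mF : measurable_fun setT F by exact: measurableT_comp (measurable_fun_nat _) f_meas.
split => //; apply/L1_path_law; first exact: measurable_funX.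
exact: Lfun2_integrable_sqr F_L2.
Qed.

Lemma E_at_ae i : {ae P, forall w, E_at X f i w = CE Q (fun k => k != i) F (xi w)}.
Proof.
apply: (cond_exp_ae_eq (sigma_of_sigma_algebra _ _) (@sigma_of_measurable _ _ _ _ _ _ _ _)).
exact: (is_cond_exp_CE X_indep (fun k => k != i) (sqint_L1 sqint_rvR)).
Qed.

Lemma frakD_ae i : {ae P, forall w, frakD X f i w = pathD Q F i (xi w)}.
Proof. by apply: filterS (E_at_ae i) => w; rewrite /frakD => ->. Qed.

Lemma measurable_E_at i : measurable_fun setT (E_at X f i).
Proof.
exact: L1_measurable (is_cond_exp_L1 (cond_expP
  (is_cond_exp_CE X_indep (fun k => k != i) (sqint_L1 sqint_rvR)))).
Qed.

Lemma measurable_frakD i : measurable_fun setT (frakD X f i).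
Proof.
apply: measurable_funB; last exact: measurable_E_at.
have [mF _] := sqint_rvR.
exact: measurableT_comp mF (measurable_sample_path X).
Qed.

Lemma is_cond_exp_pathV i : is_cond_exp P (sigma_of X [set k | (k <= i)%N]) (frakD X f i)
  (pathV Q F i \o xi).
Proof.
have LD := sqint_L1 (sqint_pathD prodQ sqint_rvR i).
have := is_cond_exp_CE X_indep (fun k => (k <= i)%N) LD.
apply: is_cond_exp_ae_eq; [|exact: measurable_frakD|exact: sigma_of_measurable|].
  exact: measurableT_comp (L1_measurable LD) (measurable_sample_path X).
by apply: filterS (frakD_ae i) => w ->.
Qed.

Lemma proj_frakD_ae i : {ae P, forall w, proj_frakD X f i w = pathV Q F i (xi w)}.
Proof.
apply: (cond_exp_ae_eq (sigma_of_sigma_algebra _ _) (@sigma_of_measurable _ _ _ _ _ _ _ _)).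
exact: is_cond_exp_pathV.
Qed.

Lemma measurable_proj_frakD i : measurable_fun setT (proj_frakD X f i).
Proof.
exact: L1_measurable (is_cond_exp_L1 (cond_expP (is_cond_exp_pathV i))).
Qed.

Lemma resampling_is_cond_exp i :
  is_cond_exp P <<s sigma_of X setT `|` sigma_of X' [set k | k != i] >>
    (fun w => `|rvR X f w - replaced X X' f i w| ^+ 2) (pathd Q F i \o xi).
Proof.
have := is_cond_exp_pathd X_indep X'_copy i sqint_rvR.
congr (is_cond_exp P _ _ _); apply/funext => w.
rewrite real_normK ?num_real// /increment /F /rvR /replaced /=.
congr ((_ - (f _)%:R) ^+ 2); apply/funext => k; rewrite /splice /=.
by case: (k == i).
Qed.

Lemma resampling_sigma_measurable i :
  <<s sigma_of X setT `|` sigma_of X' [set k | k != i] >> `<=` measurable.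
Proof.
apply: smallest_sub; first exact: sigma_algebra_measurable.
by move=> A [] /sigma_of_measurable.
Qed.

Lemma frakd_ae i : {ae P, forall w, 2 * frakd X X' f i w ^+ 2 = pathd Q F i (xi w)}.
Proof.
have h := cond_exp_ae_eq (smallest_sigma_algebra _ _) (@resampling_sigma_measurable i)
  (resampling_is_cond_exp i).
apply: filterS h => w h; rewrite /frakd /E'_at h /=.
rewrite sqr_sqrtr; last by rewrite mulr_ge0// Rintegral_ge0// => y _; exact: sqr_ge0.
by rewrite mulrA divff ?mul1r.
Qed.

Lemma measurable_frakd i : measurable_fun setT (frakd X X' f i).
Proof.
have h := L1_measurable (is_cond_exp_L1 (cond_expP (resampling_is_cond_exp i))).
apply: measurableT_comp; first exact: continuous_measurable_fun (@sqrt_continuous R).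
by apply: measurable_funM.
Qed.

End difference_operators.

(** * The Stein bound *)

Section measurable_limits.
Context {d : measure_display} {U : measurableType d} {R : realType}.

Lemma limn_einf_esup_cvg (u : nat -> \bar R) : limn_einf u = limn_esup u ->
  u @ \oo --> limn_esup u.
Proof.
move=> e; apply: (@squeeze_cvge _ _ _ _ (einfs u) _ (esups u)).
- near=> n; apply/andP; split.
    by apply: ereal_inf_lbound; exists n => /=.
  by apply: ereal_sup_ubound; exists n => /=.
- by rewrite -e limn_einf_lim; exact: is_cvg_einfs.
- by rewrite limn_esup_lim; exact: is_cvg_esups.
Unshelve. all: by end_near. Qed.

(** Where the sequence diverges, [limn] is the default [point]. Convergence takes place exactly
    where the lower and upper limits agree, a measurable set. *)
Lemma measurable_limn (a : nat -> U -> \bar R) : (forall n, measurable_fun setT (a n)) ->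
  measurable_fun setT (fun x => limn (a ^~ x)).
Proof.
move=> ma.
have ms : measurable_fun setT (fun x => limn_esup (a ^~ x)) by exact: measurable_fun_limn_esup.
have mi : measurable_fun setT (fun x => limn_einf (a ^~ x)).
  rewrite /limn_einf; apply: measurableT_comp => //.
  by apply: measurable_fun_limn_esup => n; exact: measurableT_comp.
pose C x := limn_einf (a ^~ x) == limn_esup (a ^~ x).
have -> : (fun x => limn (a ^~ x)) =
    (fun x => if C x then limn_esup (a ^~ x) else point).
  apply/funext => x; rewrite /C; case: eqP => [/limn_einf_esup_cvg/cvg_lim ->//|nc].
  apply: dvgP => /cvg_ex[l al]; apply: nc.
  by have [-> ->] := cvg_limn_einf_sup al.
apply: measurable_fun_ifT => //.
exact: measurable_fun_eqe.
Qed.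

Variable P : probability U R.

(** The chosen versions give summands [a] that are nonnegative only almost everywhere, so the
    interchange is made on nonnegative modifications [b]. *)
Lemma integral_ae_nneseries (a b : nat -> U -> R) :
  (forall i, measurable_fun setT (a i)) -> (forall i, measurable_fun setT (b i)) ->
  (forall i, {ae P, forall x, a i x = b i x}) ->
  (forall i x, 0 <= b i x) ->
  (\int[P]_x \sum_(0 <= i <oo) (a i x)%:E = \sum_(0 <= i <oo) \int[P]_x (b i x)%:E)%E.
Proof.
move=> ma mb ab b0.
have mlim (c : nat -> U -> R) : (forall i, measurable_fun setT (c i)) ->
    measurable_fun setT (fun x => \sum_(0 <= i <oo) (c i x)%:E)%E.
  move=> mc; apply: measurable_limn => n; apply: emeasurable_sum => i.
  exact/measurable_EFinP.
transitivity (\int[P]_x \sum_(0 <= i <oo) (b i x)%:E)%E.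
  apply: ae_eq_integral => //; [exact: mlim|exact: mlim|].
  have : {ae P, forall x i, a i x = b i x} by apply/ae_foralln.
  apply: filterS => x h _; congr (limn _); apply/funext => n.
  by apply: eq_bigr => i _; rewrite h.
by rewrite integral_nneseries// => i; [exact/measurable_EFinP|move=> *; rewrite lee_fin].
Qed.

End measurable_limits.

Section L1_series.
Context {d : measure_display} {U : measurableType d} {R : realType}.
Variable P : probability U R.
Implicit Types (u : nat -> U -> R) (Z H : U -> R).

Lemma Rintegral_sum u n : (forall i, L1 P (u i)) ->
  \int[P]_w (\sum_(i < n) u i w) = \sum_(i < n) \int[P]_w u i w.
Proof.
move=> hu; elim: n => [|n IH].
  by rewrite big_ord0; under eq_Rintegral do rewrite big_ord0; rewrite Rintegral_cst_prob.
have hS : L1 P (fun w => \sum_(i < n) u i w) by apply: L1_sum.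
rewrite big_ord_recr/= -IH -(RintegralD measurableT hS (hu n)).
by apply: eq_Rintegral => w _; rewrite big_ord_recr.
Qed.

(** Convergence in L1 passes to integrals against bounded functions, which suffices because the
    differences of g are bounded. *)
Lemma L1_sum_weak_cvg u Z H (B : R) : (forall i, L1 P (u i)) -> is_L1_sum P u Z ->
  measurable_fun setT H -> (forall w, `|H w| <= B) ->
  \sum_(i < n) \int[P]_w (H w * u i w) @[n --> \oo] --> \int[P]_w (H w * Z w).
Proof.
move=> hu [/Lfun1_integrable hZ Zcvg] mH HB.
have LH v : L1 P v -> L1 P (fun w => H w * v w).
  move=> hv; apply: (L1_le _ (L1Z B (L1_norm hv))) => [|w].
    by apply: measurable_funM => //; exact: L1_measurable hv.
  by rewrite (normrM (H w)) ler_wpM2r.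
have hS n : L1 P (fun w => \sum_(i < n) u i w) by exact: L1_sum.
have hSZ n := L1_norm (L1B (hS n) hZ).
have B0 : 0 <= B by apply: le_trans (HB point).
have e0 : B * \int[P]_w (`|\sum_(i < n) u i w - Z w|) @[n --> \oo] --> (0 : R).
  rewrite -[X in _ --> X](mulr0 B); apply: cvgMr.
  exact: (fine_cvg Zcvg).
apply/cvgrPdist_le => e /(cvgr0_norm_le _ e0).
apply: filterS => n; apply: le_trans.
rewrite -(@Rintegral_sum (fun i w => H w * u i w)); last by move=> i; exact: LH.
have LHS : L1 P (fun w => \sum_(i < n) H w * u i w).
  by apply: L1_sum => i; exact: LH.
rewrite -RintegralB//; last exact: LH.
apply: le_trans (le_normr_Rintegral measurableT (L1B (LH _ hZ) LHS)) _.
rewrite ger0_norm; last by rewrite mulr_ge0// Rintegral_ge0.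
rewrite -RintegralZl//; last exact: hSZ.
apply: le_Rintegral => //; first exact: (L1_norm (L1B (LH _ hZ) LHS)).
  exact: (L1Z B (hSZ n)).
move=> w _; rewrite -mulr_sumr -mulrBr (normrM (H w)) distrC.
by rewrite ler_wpM2r.
Qed.

(** The sum of the absolute values is integrable, hence almost everywhere finite; it dominates all
    partial sums, which converge where it is finite. *)
Lemma summable_is_L1_sum u : (forall i, L1 P (u i)) ->
  (\sum_(0 <= i <oo) \int[P]_w (`|u i w|)%:E < +oo)%E -> exists Z, is_L1_sum P u Z.
Proof.
move=> hu sumoo.
have mu i := L1_measurable (hu i).
have mn i : measurable_fun setT (fun w => (`|u i w|)%:E).
  by apply/measurable_EFinP; exact: measurableT_comp.
pose g w := (\sum_(0 <= i <oo) (`|u i w|)%:E)%E.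
have g0 w : (0 <= g w)%E by apply: nneseries_ge0 => *; rewrite lee_fin.
have mg : measurable_fun setT g.
  by apply: measurable_limn => n; exact: emeasurable_sum.
have ig : P.-integrable setT g.
  apply/integrableP; split => //.
  under eq_integral => w _ do rewrite gee0_abs//.
  by rewrite /g integral_nneseries//.
pose S n w := \sum_(i < n) u i w.
have mS n : measurable_fun setT (EFin \o S n).
  by apply/measurable_EFinP; apply: measurable_sum.
pose Z w := fine (limn (fun n => (S n w)%:E)).
have mZ : measurable_fun setT Z.
  by apply: measurableT_comp => //; exact: measurable_limn.
have cvgS : {ae P, forall w, setT w -> EFin (S n w) @[n --> \oo] --> (Z w)%:E}.
  apply: filterS (integrable_ae measurableT ig) => w /(_ I) gfin _.
  have gc : cvgn [normed series (fun i => u i w)].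
    apply: nondecreasing_is_cvgn; first by apply: nondecreasing_series => i _ _ /=; exact: normr_ge0.
    exists (fine (g w)) => _ [n _ <-].
    rewrite -lee_fin fineK// /series /= -sumEFin.
    by apply: nneseries_lim_ge => *; rewrite lee_fin.
  have /cvg_ex[l ul] := normed_cvg gc.
  have Sl : EFin (S n w) @[n --> \oo] --> l%:E.
    apply: cvg_EFin; first exact: nearW.
    rewrite (_ : fine \o _ = series (u ^~ w))//.
    by apply/funext => n; rewrite /series/= big_mkord.
  by rewrite /Z (cvg_lim _ Sl).
have Sg : {ae P, forall w n, setT w -> (`|EFin (S n w)| <= g w)%E}.
  apply: nearW => w n _; apply: le_trans (nneseries_lim_ge n _); last by move=> *; rewrite lee_fin.
  by rewrite big_mkord sumEFin abse_EFin lee_fin; exact: ler_norm_sum.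
have mZE : measurable_fun setT (EFin \o Z) by exact/measurable_EFinP.
have [iZ cvgZ _] := dominated_convergence measurableT mS mZE cvgS ig Sg.
exists Z; split; first exact/Lfun1_integrable.
exact: cvgZ.
Qed.

End L1_series.

(** * Assembling the estimates *)

Section stein_malliavin_poisson.
Context {R : realType} {d d' : measure_display} {Omega : measurableType d}
  {T : measurableType d'} (P : probability Omega R).
Variables X X' : nat -> {RV P >-> T}.
Local Notation S := (seq_space T).
Local Notation xi := (sample_path X).
Hypothesis X_indep : mutually_independent X.
Hypothesis X'_copy : independent_copy X X'.
Variable f : S -> nat.
Hypothesis f_meas : measurable_fun [set: S] f.
Hypothesis F_L2 : rvR X f \in Lfun P 2%:E.
Variables mu sigma : R.
Hypothesis F_mean : 'E_P[rvR X f]%E = mu%:E.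
Hypothesis F_var : 'V_P[rvR X f]%E = (sigma ^+ 2)%:E.

Let Q := path_law X.
Let prodQ : product_law Q := product_law_path_law X_indep.
Let F (x : S) : R := (f x)%:R.
Let sqF : sqint Q F := sqint_rvR f_meas F_L2.
Let u i w := frakD X f i w * proj_frakD X f i w.
Let r i := (\int[Q]_x ((pathd Q F i x + pathD Q F i x) * `|pathV Q F i x|)%:E)%E.

Lemma nat_increment_ge0 i p : 0 <= increment F i p ^+ 2 + increment F i p.
Proof.
rewrite /increment /F; move: (f p.1) (f (splice _ _ _)) => a b.
have [ab|ba] := leqP b a.
  by rewrite addr_ge0 ?sqr_ge0// subr_ge0 ler_nat.
have [k ->] : exists k, b = (a + k.+1)%N by exists (b - a.+1)%N; rewrite addnS -addSn subnKC.
have -> : (a%:R - (a + k.+1)%:R : R) ^+ 2 + (a%:R - (a + k.+1)%:R) = (k * k.+1)%:R.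
  by rewrite natrM natrD -natr1; ring.
exact: ler0n.
Qed.

Lemma frakD_proj_ae i : {ae P, forall w,
  frakD X f i w = pathD Q F i (xi w) /\ proj_frakD X f i w = pathV Q F i (xi w)}.
Proof.
have hD : {ae P, forall w, frakD X f i w = pathD Q F i (xi w)} :=
  frakD_ae X_indep f_meas F_L2 i.
have hV : {ae P, forall w, proj_frakD X f i w = pathV Q F i (xi w)} :=
  proj_frakD_ae X_indep f_meas F_L2 i.
by apply: filterS2 hD hV.
Qed.

Lemma integral_remainder_series :
  (\int[P]_w \sum_(0 <= i <oo) ((2 * frakd X X' f i w ^+ 2 + frakD X f i w) *
     `|proj_frakD X f i w|)%R%:E = \sum_(0 <= i <oo) r i)%E.
Proof.
have mpD i := measurable_pathdD prodQ sqF i.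
(* The weight is known to be nonnegative only where its section is integrable; the maximum with 0
   makes it so everywhere. *)
pose c i x := Num.max ((pathd Q F i x + pathD Q F i x) * `|pathV Q F i x|) 0.
have mc i : measurable_fun setT (c i) by apply: measurable_maxr.
have c0 i x : 0 <= c i x by rewrite le_max lexx orbT.
have ac i : {ae Q, forall x, (pathd Q F i x + pathD Q F i x) * `|pathV Q F i x| = c i x}.
  by apply: filterS (pathdD_ge0 prodQ sqF (nat_increment_ge0) i) => x h; rewrite /c max_l.
have ma i : measurable_fun setT (fun w =>
    (2 * frakd X X' f i w ^+ 2 + frakD X f i w) * `|proj_frakD X f i w|).
  have mD := measurable_frakD X_indep f_meas F_L2 i.
  have md := measurable_frakd X_indep X'_copy f_meas F_L2 i.
  have mV := measurable_proj_frakD X_indep f_meas F_L2 i.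
  apply: measurable_funM; last exact: measurableT_comp.
  by apply: measurable_funD => //; apply: measurable_funM => //; exact: measurable_funX.
have mb i : measurable_fun setT (c i \o xi).
  exact: (measurableT_comp (mc i) (measurable_sample_path X)).
have ab i : {ae P, forall w, (2 * frakd X X' f i w ^+ 2 + frakD X f i w) *
    `|proj_frakD X f i w| = (c i \o xi) w}.
  have hac : {ae P, forall w, (pathd Q F i (xi w) + pathD Q F i (xi w)) *
    `|pathV Q F i (xi w)| = c i (xi w)} := path_law_ae (ac i).
  have hd : {ae P, forall w, 2 * frakd X X' f i w ^+ 2 = pathd Q F i (xi w)} :=
    frakd_ae X_indep X'_copy f_meas F_L2 i.
  by apply: filterS3 hd (frakD_proj_ae i) hac => w -> [-> ->].
apply: (etrans (integral_ae_nneseries ma mb ab (fun i w => c0 i (xi w)))).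
apply: eq_eseriesr => i _.
have mcE : measurable_fun setT (EFin \o c i) by exact/measurable_EFinP.
have c0E x : (0 <= (EFin \o c i) x)%E by rewrite lee_fin.
have E : (\int[P]_w (c i (xi w))%:E = \int[Q]_x (EFin \o c i) x)%E :=
  ge0_integral_path_law X mcE c0E.
apply: (etrans E).
apply: ae_eq_integral => //; first exact/measurable_EFinP.
by apply: filterS (ac i) => x /= ->.
Qed.

Lemma Rintegral_F : \int[Q]_x F x = mu.
Proof.
have := F_mean; rewrite unlock /Rintegral => E.
by rewrite -(integral_path_law (sqint_L1 sqF)) [X in fine X]E.
Qed.

Lemma Rintegral_F_var : \int[Q]_x (F x * F x) - mu * mu = sigma ^+ 2.
Proof.
have := F_var; rewrite /variance unlock F_mean unlock => E.
have sG : sqint Q (fun x => F x - mu) by apply: sqintB => //; exact: sqint_cst.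
have := integral_path_law (sqint_mul sG sG).
rewrite [LHS]E EFin_Rintegral; last exact: sqint_mul.
case=> ->.
have LF := sqint_L1 sqF; have LF2 := sqint_mul sqF sqF.
have -> : (fun x => (F x - mu) * (F x - mu)) =
  (fun x => F x * F x - (2 * mu) * F x + mu * mu) by apply/funext => x; ring.
have L2 := L1Z (2 * mu) LF.
rewrite RintegralD//; [|exact: L1B|exact: L1_cst].
rewrite RintegralB// RintegralZl// Rintegral_cst_prob Rintegral_F; ring.
Qed.

Lemma L1_pathD_pathV i : L1 Q (fun x => pathD Q F i x * pathV Q F i x).
Proof. exact: sqint_mul (sqint_pathD prodQ sqF i) (sqint_pathV prodQ sqF i). Qed.

Lemma measurable_summand i : measurable_fun setT (u i).
Proof.
have mD := measurable_frakD X_indep f_meas F_L2 i.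
have mV := measurable_proj_frakD X_indep f_meas F_L2 i.
exact: measurable_funM.
Qed.

Lemma summand_ae i : {ae P, forall w, pathD Q F i (xi w) * pathV Q F i (xi w) = u i w}.
Proof. by apply: filterS (frakD_proj_ae i) => w [hD hV]; rewrite /u hD hV. Qed.

Lemma L1_summand i : L1 P (u i).
Proof.
apply: L1_ae_eq (measurable_summand i) (summand_ae i) _.
have LDV := L1_pathD_pathV i.
exact: (L1_path_law X (L1_measurable LDV)).2 LDV.
Qed.

Lemma Rintegral_mul_summand i (H : S -> R) B : measurable_fun setT H ->
  (forall x, `|H x| <= B) ->
  \int[P]_w (H (xi w) * u i w) = \int[Q]_x (H x * (pathD Q F i x * pathV Q F i x)).
Proof.
move=> mH HB; have LDV := L1_pathD_pathV i; have mDV := L1_measurable LDV.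
have mxi := measurable_sample_path X.
have LH : L1 Q (fun x => H x * (pathD Q F i x * pathV Q F i x)).
  apply: (L1_le _ (L1Z B (L1_norm LDV))) => [|x]; first exact: measurable_funM mH mDV.
  by rewrite (normrM (H x)) ler_wpM2r.
have mHx : measurable_fun setT (H \o xi) by exact: measurableT_comp mH mxi.
rewrite -(Rintegral_path_law LH); apply: Rintegral_ae_eq.
- exact: measurable_funM mHx (measurable_summand i).
- exact: measurableT_comp (L1_measurable LH) mxi.
- by apply: filterS (summand_ae i) => w <-.
Qed.

Lemma lyapunov_pathD (k : nat) :
  lyapunov X f k%:R = (\sum_(0 <= i <oo) \int[Q]_x (`|pathD Q F i x| ^+ k)%:E)%E.
Proof.
apply: eq_eseriesr => i _.
have mD := measurable_sqint (sqint_pathD prodQ sqF i).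
have mk : measurable_fun setT (fun x => (`|pathD Q F i x| ^+ k)%:E).
  by apply/measurable_EFinP; apply: measurable_funX; exact: measurableT_comp.
have k0 x : (0 <= (`|pathD Q F i x| ^+ k)%:E)%E by rewrite lee_fin exprn_ge0.
have E : (\int[P]_w (`|pathD Q F i (xi w)| ^+ k)%:E = \int[Q]_x (`|pathD Q F i x| ^+ k)%:E)%E
  := ge0_integral_path_law X mk k0.
rewrite -E; apply: ae_eq_integral => //.
- apply/measurable_EFinP; under eq_fun do rewrite powR_mulrn//.
  have mfD := measurable_frakD X_indep f_meas F_L2 i.
  apply: measurable_funX; exact: (measurableT_comp (@normr_measurable R setT) mfD).
- exact: measurableT_comp mk (measurable_sample_path X).
- by apply: filterS (frakD_proj_ae i) => w [hD _] _; rewrite powR_mulrn// hD.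
Qed.

Lemma exists_L1_sum : (lyapunov X f 2 < +oo)%E -> exists Z, is_L1_sum P u Z.
Proof.
move=> oo; apply: summable_is_L1_sum; first exact: L1_summand.
apply: le_lt_trans oo; rewrite (lyapunov_pathD 2).
apply: lee_nneseries => [i _ _|i _]; first by apply: integral_ge0 => w _; rewrite lee_fin.
have LDV := L1_pathD_pathV i; have [_ D2] := sqint_pathD prodQ sqF i.
have E : (\int[P]_w (`|u i w|)%:E = (\int[Q]_x `|pathD Q F i x * pathV Q F i x|)%:E)%E.
  rewrite -EFin_Rintegral; last exact: L1_norm.
  rewrite -(integral_path_law (L1_norm LDV)).
  apply: ae_eq_integral => //.
  - by apply/measurable_EFinP/measurableT_comp => //; exact: measurable_summand.
  - apply/measurable_EFinP.
    exact: measurableT_comp (L1_measurable (L1_norm LDV)) (measurable_sample_path X).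
  - by apply: filterS (summand_ae i) => w <-.
rewrite E; under eq_integral do rewrite real_normK ?num_real//.
by rewrite EFin_Rintegral// lee_fin; exact: (Rintegral_normM_pathDV prodQ sqF).
Qed.

Lemma bounded_functional_cvg Z (H : S -> R) B : is_L1_sum P u Z ->
  measurable_fun setT H -> (forall x, `|H x| <= B) ->
  \sum_(i < n) \int[Q]_x (H x * (pathD Q F i x * pathV Q F i x)) @[n --> \oo] -->
  \int[P]_w (H (xi w) * Z w).
Proof.
move=> Zsum mH HB.
have mHx : measurable_fun setT (H \o xi) := measurableT_comp mH (measurable_sample_path X).
have := L1_sum_weak_cvg L1_summand Zsum mHx (fun w => HB (xi w)).
have -> // : (fun n => \sum_(i < n) \int[P]_w ((H \o xi) w * u i w)) =
  (fun n => \sum_(i < n) \int[Q]_x (H x * (pathD Q F i x * pathV Q F i x))).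
by apply/funext => n; apply: eq_bigr => i _; exact: Rintegral_mul_summand mH HB.
Qed.

(** The covariance formula for F with itself and the L1 convergence tested on the constant 1
    evaluate the limit of the same sums, because [pathD] and F have the same integral against
    [pathV]. *)
Lemma Rintegral_L1_sum Z : is_L1_sum P u Z -> \int[P]_w Z w = sigma ^+ 2.
Proof.
move=> Zsum.
have cF := CEn_cvg_nat prodQ f_meas sqF.
have := sum_pathV_cvg prodQ sqF cF sqF.
rewrite Rintegral_F Rintegral_F_var => lim1.
have one_le1 (x : S) : `|1 : R| <= 1 by rewrite normr1.
have := bounded_functional_cvg Zsum (measurable_cst (1 : R)) one_le1.
have -> : (fun n => \sum_(i < n) \int[Q]_x (1 * (pathD Q F i x * pathV Q F i x))) =
    (fun n => \sum_(i < n) \int[Q]_x (F x * pathV Q F i x)).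
  apply/funext => n; apply: eq_bigr => i _; under eq_Rintegral do rewrite mul1r.
  exact: Rintegral_pathD_pathV.
under eq_Rintegral do rewrite mul1r.
move=> lim2; exact: (cvg_unique (@norm_hausdorff _ _) lim2 lim1).
Qed.

Lemma remainder_ge0 i : (0 <= r i)%E.
Proof.
rewrite /r -(integral_pathdD prodQ sqF nat_increment_ge0).
by apply: integral_ge0 => p _; rewrite lee_fin mulr_ge0// nat_increment_ge0.
Qed.

Section stein_equation.
Variables (theta : R) (h g : nat -> R) (Z : Omega -> R) (pi c1 c2 : R).
Hypothesis Z_sum : is_L1_sum P u Z.
Hypothesis stein_eq : forall k, theta * g k.+1 - k%:R * g k = h k - pi.
Hypothesis g_bound : forall k, `|g k| <= 1.
Hypothesis dg_bound : forall k, `|g k.+1 - g k| <= c1.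
Hypothesis d2g_bound : forall k, `|g k.+2 - 2 * g k.+1 + g k| <= 2 * c2.

Let G (x : S) : R := g (f x).
Let H (x : S) : R := g (f x).+1 - g (f x).

Let mcomp (v : nat -> R) : measurable_fun setT (v \o f).
Proof. exact: measurableT_comp (measurable_fun_nat v) f_meas. Qed.
Let mG : measurable_fun setT G. Proof. exact: mcomp g. Qed.
Let mH : measurable_fun setT H.
Proof. exact: mcomp (fun k => g k.+1 - g k). Qed.
Let sqG : sqint Q G. Proof. exact: (sqint_bounded Q mG (fun x => g_bound (f x))). Qed.
Let sqH : sqint Q H. Proof. exact: (sqint_bounded Q mH (fun x => dg_bound (f x))). Qed.

(** The estimates of [stein_remainder] are summed over [i < n]. As [n] grows, the sums with [G]
    converge by the covariance formula and those with [H] by L1 convergence, while the nonnegative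
    remainders stay below their full series. *)
Lemma covariance_remainder_le :
  (`|\int[Q]_x (F x * G x) - mu * \int[Q]_x G x - \int[P]_w (H (xi w) * Z w)|%:E <=
   c2%:E * \sum_(0 <= i <oo) r i)%E.
Proof.
have C0 : 0 <= c2 by have := le_trans (normr_ge0 _) (d2g_bound 0); lra.
have rem i := stein_remainder prodQ sqF nat_increment_ge0 i sqG mH
  (ex_intro _ c1 (fun x => dg_bound (f x)))
  (fun x y => discrete_taylor d2g_bound (f x) (f y)) C0.
have cF := CEn_cvg_nat prodQ f_meas sqF.
have lim1 := sum_pathV_cvg prodQ sqF cF sqG; rewrite Rintegral_F in lim1.
have lim2 := bounded_functional_cvg Z_sum mH (fun x => dg_bound (f x)).
pose s n := `|\sum_(i < n) \int[Q]_x (G x * pathV Q F i x) -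
  \sum_(i < n) \int[Q]_x (H x * (pathD Q F i x * pathV Q F i x))|.
have lim : s n @[n --> \oo] -->
    `|\int[Q]_x (F x * G x) - mu * \int[Q]_x G x - \int[P]_w (H (xi w) * Z w)|.
  by apply: cvg_norm; exact: (cvgB lim1 lim2).
have limE : (s n)%:E @[n --> \oo] -->
  (`|\int[Q]_x (F x * G x) - mu * \int[Q]_x G x - \int[P]_w (H (xi w) * Z w)|)%:E.
  by apply: cvg_EFin; [exact: nearW|exact: lim].
rewrite -(cvg_lim _ limE)//; apply: lime_le; first by apply/cvg_ex; eexists; exact: limE.
apply: nearW => n; rewrite /s /=.
apply: (@le_trans _ _ (\sum_(i < n) c2%:E * r i)%E).
  apply: (@le_trans _ _ (\sum_(i < n) (`|\int[Q]_x (G x * pathV Q F i x) -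
      \int[Q]_x (H x * (pathD Q F i x * pathV Q F i x))|)%:E)%E).
    by rewrite -sumrB sumEFin lee_fin; exact: ler_norm_sum.
  by apply: lee_sum => i _; exact: rem.
rewrite -ge0_sume_distrr; last by move=> i _; exact: remainder_ge0.
apply: lee_wpmul2l; first by rewrite lee_fin.
rewrite -(big_mkord xpredT r).
by apply: nneseries_lim_ge => i _ _; exact: remainder_ge0.
Qed.

Lemma stein_decomposition :
  \int[Q]_x h (f x) - pi = (theta - mu) * \int[Q]_x G x +
    \int[P]_w (H (xi w) * (theta - Z w)) -
    (\int[Q]_x (F x * G x) - mu * \int[Q]_x G x - \int[P]_w (H (xi w) * Z w)).
Proof.
have [/Lfun1_integrable hZ _] := Z_sum.
have [[LG LH] LFG] := (sqint_L1 sqG, sqint_L1 sqH, sqint_mul sqF sqG).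
have mHx : measurable_fun setT (H \o xi) := measurableT_comp mH (measurable_sample_path X).
have LHx : L1 P (H \o xi) := (L1_path_law X mH).2 LH.
have LHZ : L1 P (fun w => H (xi w) * Z w).
  apply: (L1_le _ (L1Z c1 (L1_norm hZ))) => [|w].
    exact: measurable_funM mHx (L1_measurable hZ).
  by rewrite (normrM (H (xi w))) ler_wpM2r// dg_bound.
have -> : \int[P]_w (H (xi w) * (theta - Z w)) =
    theta * \int[Q]_x H x - \int[P]_w (H (xi w) * Z w).
  rewrite -(Rintegral_path_law LH) -(RintegralZl _ measurableT LHx).
  rewrite -(RintegralB measurableT (L1Z theta LHx) LHZ).
  by apply: eq_Rintegral => w _; rewrite mulrBr (mulrC theta).
have LHG := L1D (L1Z theta LH) (L1Z theta LG).
have -> : \int[Q]_x h (f x) = \int[Q]_x (theta * H x + theta * G x - F x * G x + pi).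
  by apply: eq_Rintegral => x _; have := stein_eq (f x); rewrite /H /G /F; lra.
rewrite (RintegralD measurableT (L1B LHG LFG) (L1_cst _ _)) Rintegral_cst_prob.
rewrite (RintegralB measurableT LHG LFG).
rewrite (RintegralD measurableT (L1Z theta LH) (L1Z theta LG)).
rewrite (RintegralZl _ measurableT LH) (RintegralZl _ measurableT LG).
ring.
Qed.

Lemma stein_expectation_le :
  (`|\int[Q]_x h (f x) - pi|%:E <= `|theta - mu|%:E +
     c1%:E * \int[P]_w (`|theta - Z w|)%:E + c2%:E * \sum_(0 <= i <oo) r i)%E.
Proof.
have [/Lfun1_integrable hZ _] := Z_sum.
have LtZ := L1_norm (L1B (L1_cst P theta) hZ).
have mHx : measurable_fun setT (H \o xi) := measurableT_comp mH (measurable_sample_path X).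
have LG := sqint_L1 sqG.
have c10 : 0 <= c1 := le_trans (normr_ge0 _) (dg_bound 0).
have LHZ : L1 P (fun w => H (xi w) * (theta - Z w)).
  apply: (L1_le _ (L1Z c1 LtZ)) => [|w].
    exact: measurable_funM mHx (L1_measurable (L1B (L1_cst P theta) hZ)).
  by rewrite (normrM (H (xi w))) ler_wpM2r// dg_bound.
have bG : `|\int[Q]_x G x| <= 1.
  apply: le_trans (le_normr_Rintegral measurableT LG) _.
  rewrite -[leRHS](Rintegral_cst_prob Q 1).
  apply: (le_Rintegral measurableT (L1_norm LG) (L1_cst Q 1)) => x _.
  exact: g_bound.
have bH : `|\int[P]_w (H (xi w) * (theta - Z w))| <= c1 * \int[P]_w `|theta - Z w|.
  apply: le_trans (le_normr_Rintegral measurableT LHZ) _.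
  rewrite -(RintegralZl _ measurableT LtZ).
  apply: (le_Rintegral measurableT (L1_norm LHZ) (L1Z c1 LtZ)) => w _.
  by rewrite (normrM (H (xi w))) ler_wpM2r// dg_bound.
rewrite (EFin_Rintegral LtZ) -EFinM -EFinD.
apply: le_trans (leeD2l _ covariance_remainder_le).
rewrite stein_decomposition -EFinD lee_fin.
move: (_ - _ - \int[P]_w (H (xi w) * Z w)) bG bH => A.
move: (\int[Q]_x G x) (\int[P]_w (H (xi w) * (theta - Z w))) (\int[P]_w `|theta - Z w|).
move=> I J K hI hJ.
apply: le_trans (ler_normB _ _) _; rewrite lerD2r.
apply: le_trans (ler_normD _ _) _; rewrite lerD// normrM.
by rewrite ler_piMr.
Qed.

End stein_equation.

(** The mean of [Z] is [sigma ^+ 2], so the triangle inequality through it and Jensen suffice. As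
    [Z] is merely integrable its variance may be infinite, whence the extended square root. *)
Lemma expectation_dist_le theta Z : is_L1_sum P u Z ->
  ('E_P[fun w => `|theta - Z w|%R] <= `|theta - sigma ^+ 2|%:E + sqrte 'V_P[Z])%E.
Proof.
move=> Zsum; have [/Lfun1_integrable hZ _] := Zsum.
have EZ := Rintegral_L1_sum Zsum.
pose m := sigma ^+ 2.
have LZm := L1B hZ (L1_cst P m).
have VZ : 'V_P[Z] = (\int[P]_w ((`|Z w - m|) ^+ 2)%:E)%E.
  rewrite /variance unlock [fine _](_ : _ = m); last by rewrite unlock.
  rewrite unlock; apply: eq_integral => w _.
  by rewrite real_normK ?num_real// expr2.
have mnZ : measurable_fun setT (fun w => `|Z w - m|) := L1_measurable (L1_norm LZm).
have sV : (\int[P]_w `|Z w - m|%:E <= sqrte 'V_P[Z])%E.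
  rewrite VZ (EFin_Rintegral (L1_norm LZm)).
  have I0 : 0 <= \int[P]_w `|Z w - m| by apply: Rintegral_ge0.
  rewrite -[leLHS]gee0_abs ?lee_fin// -sqrte_sqr.
  by rewrite lee_sqrt ?jensen_sqr// integral_ge0// => w _; rewrite lee_fin exprn_ge0.
rewrite unlock; apply: le_trans (leeD2l _ sV).
have Lt := L1_norm (L1B (L1_cst P theta) hZ).
have LZm' := L1_norm LZm.
rewrite (EFin_Rintegral Lt) (EFin_Rintegral LZm') -EFinD lee_fin.
rewrite -(Rintegral_cst_prob P `|theta - m|).
rewrite -(RintegralD measurableT (L1_cst P `|theta - m|) LZm').
apply: (le_Rintegral measurableT Lt (L1D (L1_cst P _) LZm')) => w _.
have -> : theta - Z w = (theta - m) - (Z w - m) by ring.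
exact: ler_normB.
Qed.

Lemma remainder_series_le : (\sum_(0 <= i <oo) r i <=
  2%:E * lyapunov X f 3 + lyapunov X f 2)%E.
Proof.
have i0 k i : (0 <= \int[Q]_x (`|pathD Q F i x| ^+ k)%:E)%E.
  by apply: integral_ge0 => x _; rewrite lee_fin exprn_ge0.
rewrite (lyapunov_pathD 3) (lyapunov_pathD 2) -nneseriesZl// -nneseriesD//; last first.
  by move=> i _ _; rewrite mule_ge0.
apply: lee_nneseries => [i _ _|i _]; first exact: remainder_ge0.
have E : (\int[Q]_x (`|pathD Q F i x| ^+ 2)%:E = \int[Q]_x (pathD Q F i x ^+ 2)%:E)%E.
  by apply: eq_integral => x _; rewrite real_normK ?num_real.
rewrite E; exact: (integral_pathdD_le prodQ sqF nat_increment_ge0 i).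
Qed.

Lemma dW_poisson_le theta Z (c1 := Num.min 1 (8 / (3 * Num.sqrt (2 * expR 1 * theta))))
    (c2 := Num.min (2 / 3) (1 / theta)) : 0 < theta -> is_L1_sum P u Z ->
  (dW_poisson P (rv X f) theta <= `|theta - mu|%:E +
     c1%:E * 'E_P[fun w => `|theta - Z w|%R] + c2%:E * \sum_(0 <= i <oo) r i)%E.
Proof.
move=> theta_gt0 Zsum; apply: ge_ereal_sup => _ [h hlip <-].
have [g [geq gb dgb d2gb]] := poisson_stein_solution theta_gt0 hlip.
have growth := lipschitz1_growth hlip.
have mh : measurable_fun setT (h \o f) := measurableT_comp (measurable_fun_nat h) f_meas.
have Lh : L1 Q (h \o f).
  apply: (L1_le mh (L1D (L1_cst Q `|h 0%N|) (sqint_L1 sqF))) => x.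
  have hx := hlip (f x) 0%N; rewrite subr0 (normr_nat _ (f x)) in hx.
  rewrite /= -[h (f x)](subrK (h 0%N)) addrC.
  by apply: le_trans (ler_normD _ _) _; rewrite lerD2l.
have E : (\int[P]_w (h (f (xi w)))%:E = \int[Q]_x (h (f x))%:E)%E := integral_path_law Lh.
rewrite [in leLHS]unlock [X in `|X - _|%E]E (EFin_Rintegral Lh).
rewrite (poisson_expectationE theta_gt0 growth).
rewrite -EFinB abse_EFin unlock.
exact: stein_expectation_le Zsum geq gb dgb d2gb.
Qed.

End stein_malliavin_poisson.

(** The series for Z is read as an L1 limit, and the bounds hold for any such limit. The first
    clause provides one whenever the Lyapunov ratio of order 2 is finite; otherwise the last bound
    is infinite. *)
Theorem theorem4p2 (R : realType) (d d' : measure_display)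
    (Omega : measurableType d) (T : measurableType d')
    (P : probability Omega R) (X X' : nat -> {RV P >-> T})
    (f : seq_space T -> nat) (mu sigma theta : R)
    (X_indep : mutually_independent X)
    (X'_copy : independent_copy X X')
    (f_meas : measurable_fun [set: seq_space T] f)
    (F_L2 : rvR X f \in Lfun P 2%:E)
    (F_mean : 'E_P[rvR X f]%E = mu%:E)
    (F_var : 'V_P[rvR X f]%E = (sigma ^+ 2)%:E)
    (theta_gt0 : 0 < theta) :
  let D := frakD X f in
  let dF := frakd X X' f in
  let ED := proj_frakD X f in
  let c1 := Num.min 1 (8 / (3 * Num.sqrt (2 * expR 1 * theta))) in
  let c2 := Num.min (2 / 3) (1 / theta) in
  let Z_sum := is_L1_sum P (fun i w => D i w * ED i w) in
  ((lyapunov X f 2 < +oo)%E -> exists Z : Omega -> R, Z_sum Z) /\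
  (forall Z : Omega -> R, Z_sum Z ->
    let B := (`|theta - mu|%:E
      + c1%:E * 'E_P[fun w => (`|theta - Z w|)%R]
      + c2%:E * \int[P]_w \sum_(0 <= i <oo)
                  ((2 * dF i w ^+ 2 + D i w) * `|ED i w|)%R%:E)%E in
    (dW_poisson P (rv X f) theta <= B)%E /\
    (B <= `|theta - mu|%:E
      + c1%:E * (`|theta - sigma ^+ 2|%:E + sqrte 'V_P[Z])
      + c2%:E * (2%:E * lyapunov X f 3 + lyapunov X f 2))%E).
Proof.
move=> D dF ED c1 c2 Z_sum.
have c1_ge0 : 0 <= c1.
  by rewrite /c1 le_min ler01 divr_ge0// mulr_ge0// sqrtr_ge0.
have c2_ge0 : 0 <= c2.
  by rewrite /c2 le_min !divr_ge0 ?ltW.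
split; first exact: (exists_L1_sum X_indep f_meas F_L2).
move=> Z Zsum B.
have BE := integral_remainder_series X_indep X'_copy f_meas F_L2.
rewrite /B [X in (_ + _ * X)%E]BE; split.
  exact: (dW_poisson_le X_indep f_meas F_L2 F_mean theta_gt0 Zsum).
apply: leeD; first apply: leeD => //.
- apply: lee_wpmul2l; first by rewrite lee_fin.
  exact: (expectation_dist_le X_indep f_meas F_L2 F_mean F_var theta Zsum).
- apply: lee_wpmul2l; first by rewrite lee_fin.
  exact: (remainder_series_le X_indep f_meas F_L2).
Qed.
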